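(* Let $p$ be an odd prime, let $n$ be a positive integer coprime to $p$, let $h$ be the order of $p$ in $(\mathbb{Z}/n\mathbb{Z})^{\times}$, and let $\alpha = (p^h-1)/n$. Let $s \in \{0,\dots,\alpha-1\}$ be such that $s \equiv (p-1)/2 \pmod{\alpha}$. Then the $p$-rank of the curve $\mathcal{C}_n: y^2=x^n+1$ over $\overline{\mathbb{F}}_p$ is $$\gamma(\mathcal{C}_n) = \frac{n}{p^h-1}\left(\left(\frac{p+1}{2}\right)^h - \delta_n\right),\quad\text{where}\quad \delta_n = \begin{cases} (s+1)^h - \alpha(\delta-1) & \text{if } n \text{ is odd},\\ (s+1)^h - \alpha(\delta-2) & \text{if } n \text{ is even},\end{cases}$$ and $\delta\in \{1,\dots,(s+1)^{h-1}\}$ is the number of solutions $(x_1, \ldots, x_h) \in \{0,\dots,s\}^h$ to $$X_1 + pX_2 + \cdots + p^{h-1}X_h \equiv 0 \pmod{\alpha}.$$ Moreover: (i) if $\alpha \mid (p-1)/2$, then $n$ is even and $\delta_n = \alpha + 1$; (ii) if $\alpha \mid (p+1)/2$, then $\delta_n = \alpha$ if $n$ is odd, and $\delta_n=2\alpha$ if $n$ is even; (iii) if $\alpha \mid (p+3)/2$ and $(p-1) \nmid n$, then $\delta_n = \alpha + (-1)^h$ if $n$ is odd, and $\delta_n=2\alpha + (-1)^h$ if $n$ is even; (iv) if $\alpha \mid (p+3)/2$ and $(p-1) \mid n$, then $n$ is even and $\delta_n = 2\alpha + (-1)^h(1-\alpha)$; (v) if $n$ is odd and $\alpha \mid (p-1)$,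 then $h$ is odd and $\delta_n = (\alpha+2)/2$.
   Context: A ''curve'' given by an affine equation over $\overline{\mathbb{F}}_p$ means the nonsingular, projective, irreducible curve whose function field is defined by that equation. The $p$-rank $\gamma(\mathcal{X})$ of a curve $\mathcal{X}$ with Jacobian $J$ is the integer such that $J[p](\overline{\mathbb{F}}_p)\cong(\mathbb{Z}/p\mathbb{Z})^{\gamma(\mathcal{X})}$; a curve of genus $0$ has $p$-rank $0$. *)

(* Defs.v *)
(* boolp is used for classical choice on the type of places. *)
From HB Require Import structures.
From mathcomp Require Import all_boot all_order all_algebra.
From mathcomp Require Import boolp freeg.

Set Implicit Arguments.
Unset Strict Implicit.
Unset Printing Implicit Defensive.

Import GRing.Theory Num.Theory.

Local Open Scope ring_scope.

(* The nonsingular projective irreducible curve over the algebraically closed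
   field k with function field phi : k -> K is handled through K: its points
   are the discrete valuations of K that are trivial on k, and the group of
   k-points of its Jacobian is the group of divisor classes of degree 0. *)

Section Curve.
Variables (k K : fieldType) (phi : {rmorphism k -> K}).

(* Normalised valuations. The value at 0, mathematically +oo, is set to 0, so
   that distinct places are distinct functions; ord 0 is never meaningful. *)
Record place : Type := Place {
  ord :> K -> int;
  ord0 : ord 0 = 0;
  ordM : forall f g, f != 0 -> g != 0 -> ord (f * g) = ord f + ord g;
  ordD : forall f g, f != 0 -> g != 0 -> f + g != 0 ->
    Num.min (ord f) (ord g) <= ord (f + g);
  ord_const : forall a, ord (phi a) = 0;
  ord_uniformizer : exists2 t, t != 0 & ord t = 1
}.

HB.instance Definition _ := gen_eqMixin place.
HB.instance Definition _ := gen_choiceMixin place.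

Local Notation divisor := {freeg place}.

Definition deg0 : {pred divisor} := [pred D | deg D == 0].

Fact deg0_zmod_closed : zmod_closed deg0.
Proof.
split=> [|D E]; rewrite !inE; first by rewrite raddf0.
by move=> /eqP D0 /eqP E0; rewrite raddfB /= D0 E0 subrr.
Qed.
HB.instance Definition _ :=
  GRing.isZmodClosed.Build divisor deg0 deg0_zmod_closed.

Record divisor0 : Type := Divisor0 { div0_val :> divisor; _ : div0_val \in deg0 }.
HB.instance Definition _ := [isSub for div0_val].
HB.instance Definition _ := [Choice of divisor0 by <:].
HB.instance Definition _ := [SubChoice_isSubZmodule of divisor0 by <:].

Fact div0_val0 : div0_val 0 = 0.
Proof. exact: (raddf0 (val : divisor0 -> divisor)). Qed.

Fact div0_valB D E : div0_val (D - E) = div0_val D - div0_val E.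
Proof. exact: (raddfB (val : divisor0 -> divisor)). Qed.

Definition is_div (f : K) (D : divisor) : Prop :=
  forall P : place, coeff P D = P f.

Definition principal : {pred divisor0} :=
  [pred D | `[< exists2 f : K, f != 0 & is_div f (div0_val D) >]].

Fact place1 (P : place) : P 1 = 0.
Proof. by rewrite -(rmorph1 phi) ord_const. Qed.

Fact placeV (P : place) f : f != 0 -> P f^-1 = - P f.
Proof.
move=> f0; apply/eqP; rewrite -addr_eq0 addrC -ordM ?invr_eq0 //.
by rewrite divff // place1.
Qed.

Fact principal_zmod_closed : zmod_closed principal.
Proof.
split=> [|D E]; rewrite !inE.
  apply/asboolP; exists 1; first exact: oner_neq0.
  by move=> P; rewrite place1 div0_val0 coeff0.
move=> /asboolP[f f0 fD] /asboolP[g g0 gE]; apply/asboolP.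
exists (f / g) => [|P]; first by rewrite mulf_neq0 ?invr_eq0.
by rewrite div0_valB coeffB fD gE ordM ?invr_eq0 // placeV.
Qed.
HB.instance Definition _ :=
  GRing.isZmodClosed.Build divisor0 principal principal_zmod_closed.

Definition jacobian : Type := Quotient.quot principal.
HB.instance Definition _ := GRing.Zmodule.on jacobian.

Section Torsion.
Variable m : nat.

Definition torsion : {pred jacobian} := [pred c | c *+ m == 0].

Fact torsion_zmod_closed : zmod_closed torsion.
Proof.
split=> [|c d]; rewrite !inE; first by rewrite mul0rn.
by move=> /eqP c0 /eqP d0; rewrite mulrnBl c0 d0 subrr.
Qed.
HB.instance Definition _ :=
  GRing.isZmodClosed.Build jacobian torsion torsion_zmod_closed.

Record jac_torsion : Type :=
  JacTorsion { jac_torsion_val :> jacobian; _ : jac_torsion_val \in torsion }.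
HB.instance Definition _ := [isSub for jac_torsion_val].
HB.instance Definition _ := [Choice of jac_torsion by <:].
HB.instance Definition _ := [SubChoice_isSubZmodule of jac_torsion by <:].

End Torsion.

(* J[p](k) is isomorphic to (Z/pZ)^gamma; this determines gamma. *)
Definition has_p_rank (p gamma : nat) : Prop :=
  exists theta : {additive jac_torsion p -> 'rV['F_p]_gamma}, bijective theta.

(* K is the field of rational functions of the curve y^2 = x^n + 1 over k,
   with coordinate functions x and y. *)
Record function_field_C (n : nat) (x y : K) : Prop := FunctionFieldC {
  C_transcendental : ~ algebraicOver phi x;
  C_equation : y ^+ 2 = x ^+ n + 1;
  C_generated : forall z : K, exists u v : {poly {poly k}},
    let ev (w : {poly {poly k}}) := (map_poly (map_poly phi) w).[x, y] in
    ev v != 0 /\ z = ev u / ev v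
}.

End Curve.

Definition is_algebraic_closure (F : fieldType) (k : closedFieldType)
    (iota : {rmorphism F -> k}) : Prop :=
  forall a : k, algebraicOver iota a.

(* h is the order of p in the group of units of Z/nZ (n = 1 is allowed, and
   then h = 1, which is why 'Z_n is not used). *)
Definition is_order_mod (n p h : nat) : Prop :=
  [/\ (0 < h)%N, p ^ h = 1 %[mod n]
    & forall j : nat, (0 < j)%N -> p ^ j = 1 %[mod n] -> (h <= j)%N].

(* The division is exact when h is the order of p modulo n. *)
Definition alpha (p n h : nat) : nat := ((p ^ h - 1) %/ n)%N.

(* The coordinate x_(i+1) is tnth x i. *)
Definition num_sol (p n h s : nat) : nat :=
  #|[set x : h.-tuple 'I_s.+1
      | (\sum_(i < h) p ^ i * tnth x i == 0 %[mod alpha p n h])%N]|.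

Definition delta_ (p n h s : nat) : int :=
  (s.+1 ^ h)%N%:Z
  - (alpha p n h)%:Z * ((num_sol p n h s)%:Z - (if odd n then 1 else 2)).

(* Main.v *)
From HB Require Import structures.
Require Import Defs.
From mathcomp Require Import all_boot all_order all_algebra separable.
From mathcomp Require Import ring zify.
From mathcomp Require Import boolp freeg.

Set Implicit Arguments.
Unset Strict Implicit.
Unset Printing Implicit Defensive.

Import Order.TTheory GRing.Theory Num.Theory.

Local Open Scope ring_scope.

(** The curve has genus g, the integer part of (n-1)/2, and its p-rank is read off
   the logarithmic differentials. Let D = d/dx on the function field K. A class c
   of J[p] is the class of a divisor E with p E = div f for some f, and
   u = Df / f depends on c only: f is unique up to a constant and p-th powers.
   If u = 0 then f is a p-th power q^p (der0_pth_power) and E = div q, so c = 0;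
   thus c |-> u embeds J[p] into K. Its image is found in two steps.

   The differential u dx = df / f has at most simple poles, with residue ord f at
   each place, so it is regular exactly when p divides the divisor of f
   (log_vfield_integral). The regular differentials are the A(x) dx / y with
   deg A < g (bounded_pole). Conversely, if A(x) dx / y = df / f then div f = p E,
   and E has degree 0 because div f has (divisor_exists). On the other hand, by
   Jacobson's formula (twist_powerE) the operator (D - u)^p is D^p - (u^p + D^(p-1) u),
   and D^p = 0, so u is a logarithmic derivative if and only if
   u^p + D^(p-1) u = 0. For u = A(x) / y this equation reads
   A^p + (d/dx)^(p-1) (A (x^n+1)^((p-1)/2)) = 0.
   Writing A = a_1 + a_2 x + ... + a_g x^(g-1) it becomes
   a_j^p = b_j a_i with i = p j mod n, where b_j is a binomial coefficient prime
   to p, and a_i stands for 0 if i > g. Hence a_j = 0 unless p^m j mod n is at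
   most g for all m. On the set of the remaining j, the half_orbit, multiplication
   by p is a permutation, and the system has p^r solutions, r being the size of
   this set (frobenius_system). So J[p] is elementary abelian of order p^r
   (elementary_rV), and the p-rank is r.

   For the divisors and places involved, K is described by smooth affine models
   y^2 = F(x): the given one, and the one in the coordinates 1/x and y / x^(g+1),
   which covers infinity. A place that is nonnegative on x is centered at one
   point (a, b), and every function is a power of a local parameter times a unit
   there; this power gives existence and uniqueness of the place (place_at,
   centered_uniq). A divisor div f has degree 0 because the involution y |-> - y
   preserves degrees and the norm of f is a product of factors x - a, each with two
   zeros and two poles.

   The size of the half_orbit is computed through the digits of alpha j in base p.
   They are at most (p-1)/2 exactly when all p^m j mod n are at most n/2, so r is the
   number of points of [0, (p-1)/2]^h with x_1 + p x_2 + ... + p^(h-1) x_h = 0 modulo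
   alpha, less one for j = 0 and one for j = n/2 if n is even (card_half_orbit).
   Passing from (p-1)/2 to its remainder s adds, in each coordinate, complete residue
   systems modulo alpha, whose contribution is a volume divided by alpha
   (box_count_blocks). This is the stated formula, and (i)-(v) are evaluations of
   the count in boxes of special sides. *)

(** * Counting the points of a box modulo a *)

Section BoxCount.
Local Open Scope nat_scope.

(** The number of points x of the box [0, L)^h with a | c + w_0 x_0 + ... , which
   box_count_tuple confirms. The offset c is what lets every count below go by
   induction on h, one coordinate at a time. *)
Fixpoint box_count (a : nat) (w : nat -> nat) (h L c : nat) : nat :=
  if h is h'.+1 then
    \sum_(x < L) box_count a (fun i => w i.+1) h' L (c + w 0 * x)
  else a %| c.

Lemma box_count_tuple a w h L c :
  box_count a w h L c =
  #|[set x : h.-tuple 'I_L | a %| c + \sum_(i < h) w i * tnth x i]|.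
Proof.
elim: h w c => [|h IH] w c /=.
  have [d|d] := boolP (a %| c).
    rewrite (_ : [set _ | _] = setT) ?cardsT ?card_tuple //.
    by apply/setP => x; rewrite !inE big_ord0 addn0.
  apply/esym/eqP; rewrite cards_eq0; apply/eqP/setP => x.
  by rewrite !inE big_ord0 addn0 (negPf d).
rewrite -sum1dep_card.
rewrite (reindex (fun y : 'I_L * h.-tuple 'I_L => [tuple of y.1 :: y.2])) /=; last first.
  exists (fun t : h.+1.-tuple 'I_L => (thead t, [tuple of behead t])).
    by move=> [x t] _ /=; congr pair; apply/val_inj.
  by move=> t _ /=; rewrite [RHS]tuple_eta.
under eq_bigr => x _ do rewrite IH -sum1dep_card.
rewrite pair_big_dep /=; apply: eq_bigl => -[x t] /=.
rewrite big_ord_recl tnth0 addnA; congr (_ %| _ + _).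
by apply: eq_bigr => i _; rewrite tnthS.
Qed.

Lemma box_count_mod a w h L c c' :
  c = c' %[mod a] -> box_count a w h L c = box_count a w h L c'.
Proof.
elim: h w c c' => [|h IH] w c c' e /=; first by rewrite /dvdn e.
by apply: eq_bigr => x _; apply: IH; rewrite -modnDml e modnDml.
Qed.

Lemma eqn_mod_lin a c w x y : 0 < a -> coprime w a -> x < a -> y < a ->
  c + w * x = c + w * y %[mod a] -> x = y.
Proof.
move=> a0 cw xa ya /eqP; rewrite eqn_modDl.
wlog le : x y xa ya / x <= y.
  move=> H e; case/orP: (leq_total x y) => l; first exact: H.
  by apply/esym/H => //; rewrite eq_sym.
rewrite eq_sym eqn_mod_dvd ?leq_mul2l ?le ?orbT // -mulnBr.
rewrite Gauss_dvdr 1?coprime_sym // => d.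
have : y - x = 0; last by lia.
by apply/eqP; move: d; apply: contraTT; rewrite -lt0n => l; rewrite gtnNdvd //; lia.
Qed.

Lemma sum_residues a w c (f : nat -> nat) : 0 < a -> coprime w a ->
  (forall x y, x = y %[mod a] -> f x = f y) ->
  \sum_(x < a) f (c + w * x) = \sum_(x < a) f x.
Proof.
move=> a0 cw fP.
pose g (x : 'I_a) : 'I_a := Ordinal (ltn_pmod (c + w * x) a0).
have gI : injective g.
  move=> x y [e]; apply/val_inj => /=.
  exact: (eqn_mod_lin a0 cw (ltn_ord x) (ltn_ord y) e).
rewrite [RHS](reindex_inj gI) /=; apply: eq_bigr => x _; apply: fP.
by rewrite modn_mod.
Qed.

(** Each point of the box is counted for exactly one residue c. *)
Lemma sum_box_count a w h L : 0 < a ->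
  \sum_(c < a) box_count a w h L c = L ^ h.
Proof.
move=> a0; elim: h w => [|h IH] w /=.
  case: a a0 => // a _; rewrite big_ord_recl dvdn0 big1 // => i _.
  by rewrite gtnNdvd //= /bump /= add1n ltnS.
rewrite exchange_big /= expnS.
rewrite (eq_bigr (fun=> L ^ h)) ?sum_nat_const ?card_ord // => x _.
rewrite -(IH (fun i => w i.+1)).
rewrite -(@sum_residues a 1 (w 0 * x) (box_count a (fun i => w i.+1) h L)) //.
- by apply: eq_bigr => i _; rewrite mul1n addnC.
- exact: coprime1n.
- by move=> c c' e; apply: box_count_mod.
Qed.

Lemma sum_blocks a w c q L (f : nat -> nat) : 0 < a -> coprime w a ->
  (forall x y, x = y %[mod a] -> f x = f y) ->
  \sum_(x < L + q * a) f (c + w * x) =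
  \sum_(x < L) f (c + w * x) + q * \sum_(x < a) f x.
Proof.
move=> a0 cw fP; elim: q => [|q IH]; first by rewrite !mul0n !addn0.
rewrite mulSn (addnC a) addnA big_split_ord /= IH mulSn -addnA; congr addn.
rewrite addnC; congr addn; rewrite -[RHS](@sum_residues a w (c + w * (L + q * a))) //.
by apply: eq_bigr => x _; rewrite mulnDr addnA.
Qed.

(** Among the points with a coordinate outside [0, L), exactly one in a is counted:
   such a coordinate runs over q complete residue systems, so the linear form is
   equidistributed modulo a. *)
Lemma box_count_blocks a w h L q c : 0 < a -> (forall i, coprime (w i) a) ->
  a * box_count a w h (L + q * a) c + L ^ h =
  a * box_count a w h L c + (L + q * a) ^ h.
Proof.
move=> a0; elim: h w c => [|h IH] w c cw //=.
set M := L + q * a; pose w' i := w i.+1.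
have bmod : forall x y, x = y %[mod a] ->
  box_count a w' h L x = box_count a w' h L y by move=> x y; apply: box_count_mod.
have e : a * (\sum_(x < M) box_count a w' h M (c + w 0 * x)) + M * L ^ h =
     a * (\sum_(x < M) box_count a w' h L (c + w 0 * x)) + M * M ^ h.
  have cs k : M * k = \sum_(x < M) k by rewrite sum_nat_const card_ord.
  rewrite !big_distrr /= (cs (L ^ h)) (cs (M ^ h)) -!big_split /=.
  by apply: eq_bigr => x _; apply: (IH w') => i; apply: cw.
move: e; rewrite {4}/M (sum_blocks _ q L a0 (cw 0) bmod) sum_box_count // !expnS.
rewrite -/w'; move: (\sum_(x < M) _) (\sum_(x < L) _) (M ^ h) (L ^ h) => A B C D.
by rewrite {1 3}/M; lia.
Qed.

Lemma box_count_full a w h c : 0 < a -> coprime (w 0) a ->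
  box_count a w h.+1 a c = a ^ h.
Proof.
move=> a0 cw /=; rewrite (@sum_residues a (w 0) c (box_count a _ h a)) //.
  exact: sum_box_count.
by move=> x y; apply: box_count_mod.
Qed.

(** The last coordinate is determined by the others, since it runs over distinct
   residues. *)
Lemma box_count_le a w h L c : L <= a -> 0 < a ->
  (forall i, coprime (w i) a) -> box_count a w h.+1 L c <= L ^ h.
Proof.
move=> La a0; elim: h w c => [|h IH] w c cw.
  rewrite /= -[L ^ 0]/(0 ^ 0) -(sum_box_count w 0 0 a0) /=.
  rewrite -(@sum_residues a (w 0) c (fun c => a %| c)) //; last first.
    by move=> x y e; rewrite /dvdn e.
  have -> : \sum_(x < a) (a %| c + w 0 * x) =
            \sum_(x < L + (a - L)) (a %| c + w 0 * x) by rewrite subnKC.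
  by rewrite big_split_ord leq_addr.
rewrite [X in X <= _]/=.
apply: leq_trans (_ : \sum_(x < L) L ^ h <= _).
  by apply: leq_sum => x _; apply: (IH (fun i => w i.+1)) => i; apply: cw.
by rewrite sum_nat_const card_ord expnS.
Qed.

Lemma box_count_gt0 a w h L : 0 < L -> 0 < box_count a w h L 0.
Proof.
move=> L0; elim: h w => [|h IH] w /=; first by rewrite dvdn0.
case: L L0 IH => // L _ IH; rewrite big_ord_recl /= muln0 addn0.
by rewrite addn_gt0 IH.
Qed.

(** Replace each coordinate x by m - x. *)
Lemma box_count_reflect a m w h c c' : (forall i, w i = 1 %[mod a]) ->
  a %| c + c' + m * h ->
  box_count a w h m.+1 c = box_count a w h m.+1 c'.
Proof.
elim: h w c c' => [|h IH] w c c' w1 /=.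
  rewrite muln0 addn0 => d; congr nat_of_bool.
  by apply/idP/idP => e; [rewrite -(dvdn_addr _ e)|rewrite -(dvdn_addl _ e)].
move=> d; rewrite (reindex_inj rev_ord_inj) /=; apply: eq_bigr => x _.
apply: IH => [i|]; first exact: w1.
have xm : x <= m by rewrite -ltnS.
have -> : c + w 0 * (m.+1 - x.+1) + (c' + w 0 * x) + m * h = c + c' + m * h + w 0 * m.
  rewrite subSS mulnBr; have : w 0 * x <= w 0 * m by rewrite leq_mul2l xm orbT.
  by move: (w 0 * x) (w 0 * m) (m * h) => u v t; lia.
rewrite /dvdn -modnDmr -modnMml w1 modnMml mul1n modnDmr.
by move: d; rewrite /dvdn mulnS (addnC m) addnA.
Qed.

(** The multiples of m fall into the residues 0 and m modulo 2 m. *)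
Lemma box_count_half m w h L c : 0 < m ->
  box_count m w h L c = box_count (2 * m) w h L c + box_count (2 * m) w h L (c + m).
Proof.
move=> m0; elim: h w c => [|h IH] w c /=; last first.
  rewrite -big_split /=; apply: eq_bigr => x _; rewrite IH; congr addn.
  by apply: box_count_mod; rewrite addnAC.
case: (boolP (m %| c)) => [/dvdnP[k ->]|n].
  rewrite dvdn_pmul2r // -mulSnr dvdn_pmul2r // !dvdn2 /=.
  by case: (odd k).
have n2 d : m %| d = false -> 2 * m %| d = false.
  by move=> e; apply/negP => /(dvdn_trans (dvdn_mull _ (dvdnn m))); rewrite e.
by rewrite !n2 ?dvdn_addl ?(negPf n).
Qed.

End BoxCount.

Lemma PoszX (n h : nat) : (n ^ h)%N%:Z = n%:Z ^+ h.
Proof. by rewrite -!natz natrX. Qed.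

(** Here [0, a - 1) is a complete residue system without the class of - 1. Removing
   that class in each coordinate in turn is an inclusion-exclusion whose last
   term is the point with all coordinates - 1. *)
Lemma box_count_pred a w h c : (0 < a)%N -> (forall i, coprime (w i) a) ->
  (a * box_count a w h a.-1 c)%:Z =
  a.-1%:Z ^+ h - (-1) ^+ h
  + a%:Z * (-1) ^+ h * (a %| c + a.-1 * \sum_(i < h) w i)%:Z.
Proof.
move=> a0; elim: h w c => [|h IH] w c cw.
  by rewrite /= big_ord0 muln0 addn0 !expr0 subrr add0r mulr1.
have e : (\sum_(x < a.-1) box_count a (fun i => w i.+1) h a.-1 (c + w 0 * x) +
   box_count a (fun i => w i.+1) h a.-1 (c + w 0 * a.-1) = a.-1 ^ h)%N.
  have -> : (\sum_(x < a.-1) box_count a (fun i => w i.+1) h a.-1 (c + w 0 * x) +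
   box_count a (fun i => w i.+1) h a.-1 (c + w 0 * a.-1) =
   \sum_(x < a.-1.+1) box_count a (fun i => w i.+1) h a.-1 (c + w 0 * x))%N.
    by rewrite big_ord_recr.
  rewrite prednK // (@sum_residues a _ _ (box_count a _ h a.-1)) ?sum_box_count //.
  by move=> x y; apply: box_count_mod.
have e1 : a%:Z * (box_count a w h.+1 a.-1 c)%:Z
   + (a * box_count a (fun i => w i.+1) h a.-1 (c + w 0 * a.-1))%:Z = a%:Z * a.-1%:Z ^+ h.
  by rewrite PoszM -mulrDr -PoszD /= e -PoszX.
move: e1; rewrite IH => [|i]; last exact: cw.
rewrite big_ord_recl /= mulnDr addnA (mulnC _ (w 0)) PoszM !exprS.
set b := (_ %| _)%:Z; have -> : (a%:Z = a.-1%:Z + 1 :> int) by lia.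
move=> e1; apply: (addIr (a.-1%:Z ^+ h - (-1) ^+ h + (a.-1%:Z + 1) * (-1) ^+ h * b)).
by rewrite e1; ring.
Qed.

(** * Orbits of multiplication by p that stay below n/2 *)

Section HalfOrbitCount.
Local Open Scope nat_scope.

Lemma num_solE p n h s :
  num_sol p n h s = box_count (alpha p n h) (fun i => p ^ i) h s.+1 0.
Proof.
rewrite box_count_tuple /num_sol; apply: eq_card => x.
by rewrite !inE add0n mod0n.
Qed.

Lemma alpha_mul p n h : 0 < p -> is_order_mod n p h -> n * alpha p n h = p ^ h - 1.
Proof.
move=> p0 [h0 e _]; rewrite /alpha mulnC divnK // -eqn_mod_dvd ?expn_gt0 ?p0 //.
exact/eqP.
Qed.

Lemma digits_inj p h (x y : nat -> nat) :
  (forall i, x i < p) -> (forall i, y i < p) ->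
  \sum_(i < h) p ^ i * x i = \sum_(i < h) p ^ i * y i ->
  forall i, i < h -> x i = y i.
Proof.
elim: h x y => [|h IH] x y xp yp //.
rewrite !big_ord_recl /= !expn0 !mul1n.
have E z : \sum_(i < h) p ^ bump 0 i * z (bump 0 i) = p * \sum_(i < h) p ^ i * z i.+1.
  by rewrite big_distrr /=; apply: eq_bigr => i _; rewrite /bump add1n expnS mulnA.
rewrite !E => e.
have p0 : 0 < p by apply: leq_trans (xp 0).
have e0 : x 0 = y 0.
  have := congr1 (fun z => z %% p) e.
  by rewrite !(addnC (_ 0)) !(mulnC p) !modnMDl !modn_small.
move: e; rewrite e0 => /addnI/eqP; rewrite eqn_pmul2l // => /eqP e [|i] // ih.
exact: (IH (fun i => x i.+1) (fun i => y i.+1)).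
Qed.

Lemma odd_halfE p : odd p -> p = 2 * ((p - 1) %/ 2) + 1.
Proof.
move=> p_odd; have e := odd_double_half p; rewrite p_odd add1n in e.
by rewrite -e subn1 /= -muln2 mulnK // mulnC addn1.
Qed.

Lemma div_lt_half p c d : odd p -> 2 * c <= d -> 0 < d -> (p * c) %/ d <= (p - 1) %/ 2.
Proof.
move=> p_odd cd d0; rewrite -ltnS ltn_divLR // {1}(odd_halfE p_odd).
move: ((p - 1) %/ 2) => t.
have : t * (2 * c) <= t * d by rewrite leq_mul2l cd orbT.
by rewrite mulnCA; nia.
Qed.

(** The exponents i of the differentials x^(i-1) dx / y, 0 < i < n/2, on whose span
   the Cartier operator acts bijectively. Since p^h = 1 modulo n, the exponents
   m < h reach the whole orbit of i. *)
Definition half_orbit (p n h : nat) : {set 'I_n} :=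
  [set i : 'I_n | (0 < i) && [forall m : 'I_h, 2 * ((p ^ m * i) %% n) < n]].

Section HalfOrbit.
Variables (p n h a : nat).
Hypotheses (p1 : 1 < p) (p_odd : odd p) (n0 : 0 < n) (h0 : 0 < h).
Hypothesis na : n * a = p ^ h - 1.
Let r := (p - 1) %/ 2.

Let pE : p = 2 * r + 1.
Proof. exact: odd_halfE. Qed.

Let ph : p ^ h = n * a + 1.
Proof. by rewrite na subnK // expn_gt0; lia. Qed.

Let a0 : 0 < a.
Proof.
have : 0 < n * a by rewrite na subn_gt0 -{1}(expn0 p) ltn_exp2l.
by rewrite muln_gt0 => /andP[].
Qed.

Let value (x : nat -> nat) := \sum_(i < h) p ^ i * x i.

Lemma value_bound x : (forall i, x i <= r) -> 2 * value x <= n * a.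
Proof.
have <- : 2 * (\sum_(i < h) p ^ i * r) = n * a.
  rewrite na subn1 predn_exp -big_distrl /= mulnC -mulnA mulnC; congr (_ * _).
  by have := pE; lia.
by move=> xr; rewrite leq_mul2l /=; apply: leq_sum => i _; rewrite leq_mul2l xr orbT.
Qed.

(** As p^h = 1 modulo p^h - 1 = n a, multiplying by p rotates the digits in base p. *)
Lemma value_rotate m x : (forall i, x i <= r) ->
  exists2 y, (forall i, y i <= r) & p ^ m * value x = value y %[mod n * a].
Proof.
move=> xr; elim: m => [|m [y yr e]]; first by exists x; rewrite ?mul1n.
exists (fun i => if i is i'.+1 then y i' else y h.-1).
  by case=> [|i]; apply: yr.
rewrite expnS -mulnA -modnMmr e modnMmr /value.
case: (h) h0 ph => // h' _ ph'; rewrite big_ord_recr big_ord_recl /= mul1n.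
rewrite mulnDr mulnA -expnS ph' mulnDl mul1n addnC -addnA.
rewrite (mulnC (n * a)) modnMDl.
congr ((_ + _) %% _); rewrite big_distrr /=; apply: eq_bigr => i _.
by rewrite /bump add1n expnS mulnA.
Qed.

(** If the digits of a i are at most (p-1)/2, then so are those of its rotations
   a (p^m i mod n), which are therefore at most (p^h-1)/2. Conversely the digits
   of a i, from the top one down, are the quotients of p (p^m i mod n) by n. *)
Lemma half_value (i : 'I_n) :
  (exists2 x, (forall j, x j <= r) & value x = a * i) <->
  (forall m, 2 * ((p ^ m * i) %% n) <= n).
Proof.
split=> [[x xr xi] m|H].
  have [y yr e] := value_rotate m xr.
  have yb := value_bound yr.
  have na0 : 0 < n * a by rewrite muln_gt0 n0.
  move: e; rewrite (modn_small (_ : value y < n * a)); last by lia.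
  rewrite xi mulnCA mulnC -muln_modl => e.
  by rewrite -(leq_pmul2r a0) -mulnA e.
pose c m := (p ^ m * i) %% n; pose e m := (p * c m) %/ n.
have er m : e m <= r by rewrite div_lt_half // H.
have step m : p * c m = e m * n + c m.+1.
  rewrite {1}(divn_eq (p * c m) n) /e; congr addn.
  by rewrite /c modnMmr mulnA expnS.
have tele m : p ^ m * i = (\sum_(j < m) p ^ (m - j.+1) * e j) * n + c m.
  elim: m => [|m IH].
    by rewrite big_ord0 mul0n add0n /c mul1n modn_small.
  rewrite expnS -mulnA IH mulnDr step big_ord_recr /= subnn expn0 mul1n mulnDl.
  rewrite -addnA; congr addn; rewrite mulnA; congr muln.
  rewrite big_distrr /=; apply: eq_bigr => j _.
  by rewrite mulnA -expnS subSn.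
exists (fun j => e (h - j.+1)) => // ; apply/eqP.
rewrite -(eqn_pmul2r n0); apply/eqP.
have := tele h; have -> : c h = i.
  by rewrite /c ph mulnDl mul1n -mulnA (mulnC n) modnMDl modn_small.
rewrite ph mulnDl mul1n => /addIn; rewrite -mulnA (mulnC n) => ->; congr muln.
rewrite /value (reindex_inj rev_ord_inj) /=; apply: eq_bigr => j _.
by congr (_ * e _); rewrite subnSK // subKn // ltnW.
Qed.

Lemma half_orbit_mod (i : 'I_n) : i \in half_orbit p n h ->
  forall m, 0 < (p ^ m * i) %% n /\ 2 * ((p ^ m * i) %% n) < n.
Proof.
rewrite inE => /andP[i0 /forallP H] m.
have phk k j : (p ^ (k * h) * j) = j %[mod n].
  elim: k => [|k IH]; first by rewrite mul1n.
  rewrite mulSn expnD -mulnA -modnMmr IH modnMmr ph mulnDl mul1n -mulnA (mulnC n).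
  by rewrite modnMDl.
have red : p ^ m * i = p ^ (m %% h) * i %[mod n].
  by rewrite {1}(divn_eq m h) expnD -mulnA phk.
split; last by rewrite red; apply: (H (Ordinal (ltn_pmod m h0))).
rewrite lt0n; apply/negP => /eqP e.
have := phk m i; rewrite -(subnK (leq_pmulr m h0)) expnD -mulnA -modnMmr e muln0 mod0n.
by rewrite modn_small // => e0; rewrite -e0 in i0.
Qed.

Lemma mod_half u i d : odd u -> 2 * i = d -> u * i = i %[mod d].
Proof.
move=> ou <-; rewrite -(odd_double_half u) ou mulnDl mul1n addnC -muln2 -mulnA.
by rewrite modnMDl.
Qed.

(** Multiplication by p, which is odd, fixes n/2. So an orbit that meets n/2 is
   constant, and off 0 and n/2 the bound by n/2 is strict along the orbit. *)
Lemma half_orbitE (i : 'I_n) :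
  (forall m, 2 * ((p ^ m * i) %% n) <= n) <->
  [|| i == 0 :> nat, 2 * i == n | i \in half_orbit p n h].
Proof.
split=> [H|].
  have [//|i0] := eqVneq (i : nat) 0; have [//|i2] /= := eqVneq (2 * i) n.
  rewrite inE lt0n i0; apply/forallP => m; rewrite ltn_neqAle H andbT.
  set j := (p ^ m * i) %% n; apply: contra_neq i2 => e.
  suff -> : i = j :> nat by [].
  have pj k : p ^ k * j = j %[mod n].
    by apply: mod_half; rewrite ?oddX ?p_odd ?orbT.
  have jn : j < n by apply: ltn_pmod.
  rewrite -(modn_small jn) -(pj (h - m)).
  rewrite /j modnMmr mulnA -expnD subnK 1?ltnW //.
  by rewrite ph mulnDl mul1n -mulnA (mulnC n) modnMDl modn_small.
case/or3P=> [/eqP->|/eqP e|iG] m; first by rewrite muln0 mod0n.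
  rewrite mod_half ?oddX ?p_odd ?orbT // modn_small ?e //; lia.
by have [_ /ltnW] := half_orbit_mod iG m.
Qed.

(** An exponent i corresponds to the tuple of digits of a i. The tuples that come
   from 0 and from n/2, if n is even, are the two that do not count. *)
Lemma card_half_orbit :
  #|half_orbit p n h| + 1 + ~~ odd n = box_count a (fun i => p ^ i) h r.+1 0.
Proof.
rewrite box_count_tuple; set S := [set _ | _].
pose vt (x : h.-tuple 'I_r.+1) := \sum_(i < h) p ^ i * tnth x i.
pose ext (x : h.-tuple 'I_r.+1) (i : nat) : nat := nth ord0 x i.
have extr x i : ext x i <= r by rewrite -ltnS ltn_ord.
have vtE x : vt x = value (ext x).
  by rewrite /vt /value; apply: eq_bigr => i _; rewrite (tnth_nth ord0).
have vt_lt x : vt x %/ a < n.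
  rewrite ltn_divLR // vtE; have := value_bound (extr x).
  have : 0 < n * a by rewrite muln_gt0 n0.
  by lia.
pose f x : 'I_n := Ordinal (vt_lt x).
have SE x : x \in S -> vt x = a * f x.
  by rewrite inE add0n => d; rewrite /= mulnC divnK.
have fI : {in S &, injective f}.
  move=> x y xS yS e; have := SE x xS; rewrite e -(SE y yS) !vtE => e'.
  have rp : r < p by have := pE; lia.
  apply/eq_from_tnth => i; rewrite !(tnth_nth ord0); apply/val_inj.
  apply: (digits_inj _ _ e') => // j; exact: leq_ltn_trans rp.
rewrite -(card_in_imset fI).
have -> : f @: S = [set i : 'I_n | [|| i == 0 :> nat, 2 * i == n | i \in half_orbit p n h]].
  apply/setP => i; rewrite inE; apply/imsetP/idP => [[x xS ->]|/half_orbitE/half_value[x xr xi]].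
    by apply/half_orbitE/half_value; exists (ext x); rewrite // -vtE SE.
  pose t : h.-tuple 'I_r.+1 := [tuple inord (x j) | j < h].
  have vti : vt t = a * i.
    by rewrite -xi; apply: eq_bigr => j _; rewrite tnth_mktuple inordK // ltnS.
  have tS : t \in S by rewrite inE add0n -/(vt t) vti dvdn_mulr.
  exists t => //; apply/val_inj/eqP. rewrite -(eqn_pmul2l a0).
  by rewrite -(SE t tS) vti.
rewrite -[RHS]sum1dep_card.
rewrite (bigID (fun i : 'I_n => i \in half_orbit p n h)) /= -addnA; congr addn.
  rewrite sum1dep_card; apply: eq_card => i; rewrite !inE.
  by case: (_ && _); rewrite ?orbT ?andbF.
have G0 (i : 'I_n) : i == 0 :> nat -> i \notin half_orbit p n h.
  by move=> /eqP e; rewrite inE e.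
have G2 (i : 'I_n) : 2 * i == n -> i \notin half_orbit p n h.
  move=> /eqP e; rewrite inE negb_and; apply/orP; right; apply/forallPn.
  by exists (Ordinal h0); rewrite /= mul1n modn_small // e ltnn.
rewrite (bigD1 (Ordinal n0)) /=; last by rewrite G0.
congr addn; rewrite sum1dep_card; have [on|en] := boolP (odd n).
  apply/esym/eqP; rewrite cards_eq0; apply/eqP/setP => i; rewrite !inE.
  apply/negP => /andP[/andP[/or3P[/eqP e|/eqP e|->]//]].
    by rewrite -val_eqE /= e.
  by have := oddM 2 i; rewrite e on.
have n2 : n./2 < n by rewrite -divn2 ltn_Pdiv.
have n2E : 2 * n./2 = n by rewrite mul2n -[RHS]odd_double_half (negPf en).
apply/esym/eqP/cards1P; exists (Ordinal n2); apply/setP => i; rewrite in_set1 inE.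
apply/idP/eqP => [/andP[/andP[/or3P[/eqP e|/eqP e|->]//]]|->].
    by rewrite -val_eqE /= e.
  by move=> _ _; apply/val_inj/eqP; rewrite -(eqn_pmul2l (isT : 0 < 2)) e /= n2E.
have e2 : 2 * Ordinal n2 == n by rewrite /= n2E.
rewrite (G2 _ e2) e2 orbT -val_eqE /= -lt0n.
by have := n0; have := n2E; lia.
Qed.

End HalfOrbit.

End HalfOrbitCount.

(** * The values of delta_n *)

Section Delta.
Local Open Scope nat_scope.
Variables (p n h s : nat).
Hypotheses (p_prime : prime p) (p_odd : odd p) (n0 : 0 < n).
Hypothesis h_order : is_order_mod n p h.
Let a := alpha p n h.
Hypothesis s_lt : s < a.
Hypothesis s_mod : s = (p - 1) %/ 2 %[mod a].
Let w i := p ^ i.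

Let p1 : 1 < p := prime_gt1 p_prime.

Let h0 : 0 < h. Proof. by have [] := h_order. Qed.

Let a0 : 0 < a. Proof. exact: leq_ltn_trans s_lt. Qed.

Let na : n * a = p ^ h - 1.
Proof. by rewrite alpha_mul // ltnW. Qed.

Let ph : p ^ h = n * a + 1.
Proof. by rewrite na subnK // expn_gt0 ltnW. Qed.

Let cw i : coprime (w i) a.
Proof.
apply: coprimeXl; rewrite -(@coprime_pexpl h) // ph addn1.
exact/coprime_dvdr/coprimeSn/dvdn_mull.
Qed.

Let numE : num_sol p n h s = box_count a w h s.+1 0.
Proof. exact: num_solE. Qed.

Lemma num_sol_bounds : 1 <= num_sol p n h s <= s.+1 ^ (h - 1).
Proof.
rewrite numE box_count_gt0 //=; case: (h) h0 => // h' _.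
by rewrite subn1; apply: box_count_le.
Qed.

Let pE : p = 2 * ((p - 1) %/ 2) + 1.
Proof. exact: odd_halfE. Qed.

(** The box of side (p+1)/2 exceeds that of side s + 1 by a multiple of alpha. *)
Lemma num_solM :
  a * num_sol p n h s + ((p - 1) %/ 2).+1 ^ h =
  a * (#|half_orbit p n h| + 1 + ~~ odd n) + s.+1 ^ h.
Proof.
rewrite (card_half_orbit p1 p_odd n0 h0 na) numE.
have -> : ((p - 1) %/ 2).+1 = s.+1 + ((p - 1) %/ 2) %/ a * a.
  by rewrite {1}(divn_eq ((p - 1) %/ 2) a) -s_mod modn_small // addnC addSn.
by rewrite -(box_count_blocks h s.+1 _ 0 a0 cw).
Qed.

Lemma half_orbit_formula :
  (#|half_orbit p n h|%:R = n%:R / (p%:R ^+ h - 1)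
      * (((p%:R + 1) / 2%:R) ^+ h - (delta_ p n h s)%:~R) :> rat)%R.
Proof.
have aR : (a%:R != 0 :> rat)%R by rewrite pnatr_eq0 -lt0n.
have nR : (n%:R != 0 :> rat)%R by rewrite pnatr_eq0 -lt0n.
have -> : (p%:R ^+ h - 1 = n%:R * a%:R :> rat)%R by rewrite -natrX ph natrD natrM addrK.
have -> : ((p%:R + 1) / 2%:R = ((p - 1) %/ 2).+1%:R :> rat)%R.
  move: ((p - 1) %/ 2) pE => u ->.
  by rewrite natrD natrM -addn1 natrD; field.
have := congr1 (fun z => z%:R%R : rat) num_solM.
rewrite /delta_ -/a !(natrD, natrM, natrX) rmorphB rmorphM /= rmorphB /=.
rewrite -!pmulrn natrX.
have -> : ((if odd n then 1 else 2 : int)%:~R = 1 + (~~ odd n)%:R :> rat)%R.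
  by case: (odd n); rewrite ?addr0.
move: (#|_|%:R)%R ((~~ _)%:R)%R (num_sol _ _ _ _)%:R%R => G b N.
move: (_ ^+ h)%R (_ ^+ h)%R => S R e.
have -> : (R = a%:R * (G + 1 + b) + S - a%:R * N)%R by rewrite -e; ring.
by field; rewrite nR aR.
Qed.

Local Open Scope ring_scope.

(** Here s = 0, so that 0 is the only solution. The evenness of n comes from
   n alpha = (p - 1)(1 + p + ... + p^(h-1)). *)
Lemma delta_div_pred : (a %| (p - 1) %/ 2)%N ->
  ~~ odd n /\ delta_ p n h s = a%:Z + 1.
Proof.
move=> d; have s0 : s = 0%N by move: s_mod; rewrite (modn_small s_lt) (eqP d).
have en : ~~ odd n.
  have /dvdnP[k kE] := d.
  have : (n * a = (2 * k * a) * \sum_(i < h) p ^ i)%N.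
    rewrite na subn1 predn_exp; congr muln; rewrite -mulnA -kE.
    by rewrite {1}pE addn1.
  rewrite mulnAC => /eqP; rewrite eqn_pmul2r // => /eqP ->.
  by rewrite -mulnA oddM.
split=> //; rewrite /delta_ (negPf en) -/a.
have -> : num_sol p n h s = 1%N.
  by apply/eqP; rewrite eqn_leq andbC; have := num_sol_bounds; rewrite s0 exp1n.
by rewrite s0 exp1n; ring.
Qed.

(** Here s = alpha - 1: each coordinate runs over a complete residue system. *)
Lemma delta_div_succ : (a %| (p + 1) %/ 2)%N ->
  delta_ p n h s = if odd n then a%:Z else 2 * a%:Z.
Proof.
move=> d; have sE : s.+1 = a.
  have : (a %| s.+1)%N.
    rewrite /dvdn -addn1 -modnDml s_mod modnDml addn1.
    suff <- : ((p + 1) %/ 2 = ((p - 1) %/ 2).+1)%N by [].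
    by rewrite {1}pE -addnA -mulnSr mulKn.
  move=> /dvdn_leq => /(_ isT) l; apply/eqP; rewrite eqn_leq l andbT; exact: s_lt.
rewrite /delta_ -/a numE sE; case: (h) h0 => // h' _.
rewrite box_count_full // expnS PoszM.
by case: (odd n); ring.
Qed.

(** Here s = alpha - 2, and the point with all coordinates - 1 is a solution if and
   only if alpha divides 1 + p + ... + p^(h-1) = n alpha / (p - 1). *)
Lemma delta_div_add3 : (a %| (p + 3) %/ 2)%N -> (1 < a)%N ->
  delta_ p n h s = (if odd n then a%:Z else 2 * a%:Z)
    + (-1) ^+ h * (1 - a%:Z * (p - 1 %| n)%N%:Z).
Proof.
move=> d a1; have sE : s.+1 = a.-1.
  have : (a %| s.+2)%N.
    rewrite /dvdn -addn2 -modnDml s_mod modnDml addn2.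
    suff <- : ((p + 3) %/ 2 = ((p - 1) %/ 2).+2)%N by [].
    by rewrite {1}pE -addnA (_ : (1 + 3 = 2 * 2)%N) // -mulnDr mulKn // addn2.
  move=> /dvdnP[[|[|k]]]; rewrite ?mul0n ?mul1n //; first by case: (a) => // b [].
  by have := s_lt; lia.
rewrite /delta_ -/a numE sE mulrBr -(PoszM a (box_count _ _ _ _ _)) box_count_pred // add0n PoszX.
have -> : (a %| a.-1 * \sum_(i < h) w i)%N = (p - 1 %| n)%N.
  rewrite Gauss_dvdr ?coprimenP // -(@dvdn_pmul2l (p - 1)) ?subn_gt0 //.
  rewrite {2}subn1 -predn_exp -subn1 -na dvdn_pmul2r //.
by case: (odd n); ring.
Qed.

Lemma delta_add3_ndvd : (a %| (p + 3) %/ 2)%N -> ~~ (p - 1 %| n)%N ->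
  delta_ p n h s =
  if odd n then a%:Z + (-1) ^+ h else 2 * a%:Z + (-1) ^+ h.
Proof.
move=> d nd; have a1 : (1 < a)%N.
  rewrite ltn_neqAle a0 andbT; apply: contraNneq nd => a1.
  by move: na; rewrite -a1 muln1 => ->; rewrite !subn1 predn_exp dvdn_mulr.
rewrite delta_div_add3 // (negPf nd) mulr0 subr0 mulr1.
by case: (odd n).
Qed.

Lemma delta_add3_dvd : (a %| (p + 3) %/ 2)%N -> (p - 1 %| n)%N ->
  ~~ odd n /\ delta_ p n h s = 2 * a%:Z + (-1) ^+ h * (1 - a%:Z).
Proof.
move=> d dn; have en : ~~ odd n.
  by rewrite -dvdn2; apply: dvdn_trans dn; rewrite pE addnK dvdn_mulr.
split=> //; case: (ltngtP a 1) => [|a1|a1]; first by rewrite ltnNge a0.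
  by rewrite delta_div_add3 // (negPf en) dn mulr1.
have s0 : s = 0%N by move: s_lt; rewrite a1; case: (s).
rewrite /delta_ -/a a1 (negPf en).
have -> : num_sol p n h s = 1%N.
  by apply/eqP; rewrite eqn_leq andbC; have := num_sol_bounds; rewrite s0 exp1n.
by rewrite s0 exp1n subrr mulr0.
Qed.

(** Write alpha = 2 m. Then s = m and p = 1 modulo alpha. As h is odd, reflecting the
   box [0, m]^h exchanges the residues 0 and m modulo alpha; modulo m that box is
   a complete residue system in each coordinate, with 0 repeated. *)
Lemma delta_odd : odd n -> (a %| p - 1)%N ->
  odd h /\ (delta_ p n h s)%:~R = (a%:R + 2%:R) / 2%:R :> rat.
Proof.
move=> on /dvdnP[d dE].
have nE : n = (d * \sum_(i < h) p ^ i)%N.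
  apply/eqP; rewrite -(eqn_pmul2r a0) na subn1 predn_exp -subn1 dE.
  by rewrite mulnAC.
have oS : odd (\sum_(i < h) p ^ i)%N = odd h.
  elim: (h) => [|h' IH]; first by rewrite big_ord0.
  by rewrite big_ord_recr oddD IH oddX p_odd orbT addbT.
move: on; rewrite {1}nE oddM oS => /andP[od oh]; split=> //.
set m := a./2; have aE : a = (2 * m)%N.
  have : ~~ odd a.
    have : ~~ odd (d * a) by rewrite -dE oddB // ?p_odd // ltnW.
    by rewrite oddM od.
  by move=> ea; rewrite mul2n -[LHS]odd_double_half (negPf ea).
have m0 : (0 < m)%N by move: a0; rewrite aE muln_gt0.
have sm : s = m.
  rewrite -(modn_small s_lt) s_mod dE {1}aE mulnCA mulKn //.
  rewrite -(odd_double_half d) od mulnDl mul1n -mul2n mulnAC -aE addnC mulnC modnMDl.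
  by rewrite modn_small // aE; lia.
have w1 i : w i = 1 %[mod a].
  rewrite /w -modnXm (_ : p = 1 %[mod a]) ?modnXm ?exp1n //.
  by rewrite -{1}(subnK (ltnW p1)) dE modnMDl.
have on : odd n by rewrite nE oddM oS od.
have B0 : (2 * num_sol p n h s * m + 1 = s.+1 ^ h + m)%N.
  rewrite numE sm; have := box_count_half w h m.+1 0 m0.
  rewrite -aE add0n -(@box_count_reflect a m w h 0 m w1); last first.
    rewrite add0n -mulnS -(odd_double_half h) oh add1n -doubleS -mul2n.
    by rewrite mulnCA mulnA -aE dvdn_mulr.
  have cm i : coprime (w i) m by apply: coprime_dvdr (cw i); rewrite aE dvdn_mull.
  have := @box_count_blocks m w h 1 1 0 m0 cm.
  rewrite mul1n add1n => e1 e2; move: e1.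
  have -> : box_count m w h 1 0 = 1%N.
    case: (h) h0 => // h' _; apply/eqP; rewrite eqn_leq box_count_gt0 // andbT.
    by have := @box_count_le m w h' 1 0 m0 m0 cm; rewrite exp1n.
  rewrite exp1n e2 muln1; move: (box_count _ _ _ _ _) (_ ^ h)%N => N X.
  by rewrite mulnDr mulnAC -mulnA => e; lia.
have B1 : (2 * m%:R * (num_sol p n h s)%:R = s.+1%:R ^+ h + m%:R - 1 :> rat).
  have := congr1 (fun z => z%:R : rat) B0.
  by rewrite !(natrD, natrM) natrX mulrAC => <-; rewrite addrK.
rewrite /delta_ -/a on rmorphB rmorphM /= rmorphB /= aE -!pmulrn natrX natrM.
move: B1; rewrite mulrBr mulr1 => -> .
by field.
Qed.

End Delta.

(** * Finite elementary abelian groups *)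

Section Elementary.
Variables (p : nat) (U : zmodType).
Hypotheses (p_prime : prime p) (Up : forall u : U, u *+ p = 0).

Lemma mulrn_modp (u : U) m q : q = p -> u *+ (m %% q) = u *+ m.
Proof. by move=> ->; rewrite [in RHS](divn_eq m p) mulrnDr mulnC mulrnA Up mul0rn add0r. Qed.

Lemma mulrn_FpD (u : U) (c d : 'F_p) : u *+ (c + d)%R = u *+ c + u *+ d.
Proof. by rewrite -mulrnDr; apply/mulrn_modp/Fp_cast. Qed.

Lemma mulrn_FpM (u : U) (c d : 'F_p) : u *+ (c * d)%R = u *+ c *+ d.
Proof. by rewrite -mulrnA; apply/mulrn_modp/Fp_cast. Qed.

Lemma extend_independent r (f : 'rV['F_p]_r -> U) (u : U) :
  zmod_morphism f -> injective f -> (forall v, f v <> u) ->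
  exists2 f' : 'rV['F_p]_(1 + r) -> U, zmod_morphism f' & injective f'.
Proof.
move=> fB fI fu.
have f0 : f 0 = 0 by have := fB 0 0; rewrite !subrr.
have fN v : f (- v) = - f v by have := fB 0 v; rewrite f0 !sub0r.
have fD v w : f (v + w) = f v + f w by rewrite -{1}(opprK w) fB fN opprK.
have fM v m : f (v *+ m) = f v *+ m.
  by elim: m => [|m IH]; rewrite ?mulr0n // !mulrS fD IH.
pose f' (v : 'rV['F_p]_(1 + r)) := f (rsubmx v) + u *+ (lsubmx v 0 0 : 'F_p).
have f'D v w : f' (v + w) = f' v + f' w.
  by rewrite /f' !linearD /= fD mxE mulrn_FpD addrACA.
have f'0 : f' 0 = 0 by rewrite /f' !linear0 mxE f0 mulr0n addr0.
have f'B : zmod_morphism f'.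
  move=> v w; apply: (addIr (f' w)).
  by rewrite -f'D !subrK.
exists f' => // v w e; apply/eqP; rewrite -subr_eq0; apply/eqP.
have {e} : f' (v - w) = 0 by rewrite f'B e subrr.
move: (v - w) => {v w} v; rewrite /f'.
have [c0|c0] := eqVneq (lsubmx v 0 0) 0.
  rewrite c0 mulr0n addr0 => e; have lv : rsubmx v = 0 by apply: fI; rewrite e f0.
  rewrite -[v]hsubmxK lv; have -> : lsubmx v = 0; last by rewrite row_mx0.
  by apply/matrixP => i j; rewrite !ord1 c0 mxE.
move=> e; have := congr1 (fun z => z *+ (lsubmx v 0 0)^-1%R) e.
rewrite mul0rn mulrnDl -mulrn_FpM divff // /= modn_small ?Fp_cast ?prime_gt1 // mulr1n.
move=> /eqP; rewrite addrC addr_eq0 -fM -fN => /eqP e'.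
by case: (fu _ (esym e')).
Qed.

(** A finite elementary abelian p-group of order p ^ g is the space of rows of
   length g: an injective additive map from a space of rows that misses some
   element extends to rows with one more entry, so a maximal one is onto. *)
Lemma elementary_rV (T : eqType) (e : U -> T) (l : seq T) g :
  injective e -> uniq l -> (forall t, t \in l <-> exists u, e u = t) ->
  size l = (p ^ g)%N -> exists theta : {additive U -> 'rV['F_p]_g}, bijective theta.
Proof.
move=> eI lU lE ls.
have card_le r (f : 'rV['F_p]_r -> U) : injective f ->
    (p ^ r <= p ^ g)%N /\ ((p ^ r = p ^ g)%N -> forall u, exists v, f v = u).
  move=> fI; have mU : uniq [seq e (f v) | v : 'rV['F_p]_r].
    by rewrite map_inj_uniq ?enum_uniq //; apply: inj_comp.
  have ms : size [seq e (f v) | v : 'rV['F_p]_r] = (p ^ r)%N.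
    by rewrite size_map -cardE card_mx card_Fp // mul1n.
  have sub : {subset [seq e (f v) | v : 'rV['F_p]_r] <= l}.
    by move=> t /imageP[v _ ->]; apply/lE; exists (f v).
  split=> [|er u]; first by rewrite -ms -ls uniq_leq_size.
  have [_ mE] := uniq_min_size mU sub (eq_leq (etrans ls (esym (etrans ms er)))).
  have : e u \in l by apply/lE; exists u.
  by rewrite -mE => /imageP[v _ /eI]; exists v.
have [r [f [fB fI fS]]] : exists r (f : 'rV['F_p]_r -> U),
    [/\ zmod_morphism f, injective f & forall u, exists v, f v = u].
  have start : exists2 f : 'rV['F_p]_0 -> U, zmod_morphism f & injective f.
    by exists (fun=> 0) => [v w|v w _]; rewrite ?subr0 // !thinmx0.
  apply: contrapT => none.
  suff grow r : exists2 f : 'rV['F_p]_r -> U, zmod_morphism f & injective f.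
    have [f _ /card_le[]] := grow g.+1.
    by rewrite leqNgt ltn_exp2l ?prime_gt1 // leqnn.
  elim: r => // r [f fB fI].
  have [u fu] : exists u, forall v, f v <> u.
    apply: contrapT => H; apply: none; exists r, f; split=> // u.
    by apply: contrapT => Hu; apply: H; exists u => v fv; apply: Hu; exists v.
  exact: (extend_independent fB fI fu).
have er : r = g.
  apply/eqP; rewrite -(eqn_exp2l _ _ (prime_gt1 p_prime)).
  rewrite eqn_leq (card_le _ _ fI).1 /= -ls.
  have -> : (p ^ r)%N = size [seq e (f v) | v : 'rV['F_p]_r].
    by rewrite size_map -cardE card_mx card_Fp // mul1n.
  apply: uniq_leq_size => // t /lE[u <-]; have [v <-] := fS u.
  exact: image_f.
subst r; have [g' gE] := choice fS.
have g'B : zmod_morphism g' by move=> u v; apply: fI; rewrite fB !gE.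
pose G := GRing.isZmodMorphism.Build _ _ g' g'B.
pose theta : {additive U -> 'rV['F_p]_g} := HB.pack g' G.
exists theta; exists f => [u|v]; first exact: gE.
by apply: fI; apply: gE.
Qed.

End Elementary.

(** * Monomial Frobenius systems *)

Section Frobenius.
Variables (p : nat) (k : closedFieldType).
Hypothesis charp : p \in [pchar k].

Let p_prime : prime p := pcharf_prime charp.

(** The polynomial X^(p^m) - b X is separable, its derivative being - b. *)
Lemma frobenius_roots m (b : k) : (0 < m)%N -> b != 0 ->
  exists s : seq k, [/\ uniq s, size s = (p ^ m)%N &
    forall z, (z \in s) = (z ^+ (p ^ m) == b * z)].
Proof.
move=> m0 b0; set q := (p ^ m)%N.
have q1 : (1 < q)%N by rewrite -(expn0 p) ltn_exp2l ?prime_gt1.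
pose P : {poly k} := 'X^q - b *: 'X.
have sP : size P = q.+1.
  by rewrite size_polyDl size_polyXn // size_polyN size_scale // size_polyX ltnS.
have [s sE] := closed_field_poly_normal P.
have P0 : P != 0 by rewrite -size_poly_gt0 sP.
have l0 : lead_coef P != 0 by rewrite lead_coef_eq0.
have sepP : separable_poly P.
  rewrite unlock derivB derivXn derivZ derivX -mulr_natr natrX.
  have -> : p%:R = 0 :> {poly k}.
    by rewrite -polyC_natr (pcharf0 charp).
  rewrite expr0n eqn0Ngt m0 mulr0 sub0r coprimep_sym -scaleNr.
  by rewrite coprimepZl ?oppr_eq0 // coprime1p.
exists s; split.
- by rewrite -separable_prod_XsubC -(eqp_separable (eqp_scale _ l0)) -sE.
- by have := sP; rewrite sE size_scale // size_prod_XsubC => -[].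
- move=> z; rewrite -root_prod_XsubC -(rootZ _ _ l0) -sE rootE.
  by rewrite !hornerE subr_eq0.
Qed.

(** If sigma fixes i, the coordinate at i solves an equation of its own. Otherwise
   the one at sigma i is determined by the one at i and can be eliminated, which
   adds up the two exponents; this is why the exponents are allowed to vary. *)
Lemma frobenius_system (T : finType) (G : {set T}) (sigma : T -> T)
    (m : T -> nat) (b : T -> k) :
  {in G, forall i, sigma i \in G} -> {in G &, injective sigma} ->
  {in G, forall i, 0 < m i}%N -> {in G, forall i, b i != 0} ->
  exists l : seq {ffun T -> k},
    [/\ uniq l, size l = (p ^ \sum_(i in G) m i)%N & forall a : {ffun T -> k},
      a \in l <-> (forall i, i \notin G -> a i = 0) /\
                  {in G, forall i, a i ^+ (p ^ m i) = b i * a (sigma i)}].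
Proof.
have [N] := ubnP #|G|; elim: N => // N IH in G sigma m b *.
rewrite ltnS => GN sG sI m0 b0.
have [->|[i iG]] := set_0Vmem G.
  exists [:: [ffun=> 0]]; split=> // [|a]; first by rewrite big_set0.
  rewrite inE; split=> [/eqP->|[a0 _]]; first by split=> i; rewrite ?inE ?ffunE.
  by apply/eqP/ffunP => i; rewrite ffunE a0 ?inE.
have [j [jG ji]] : exists j, j \in G /\ (sigma i = j) by exists (sigma i); split; auto.
have Nj : (#|G :\ j| < N)%N by rewrite (cardsD1 j) jG in GN.
have [ij|ij] := eqVneq i j.
  rewrite -{j}ij in ji jG Nj *.
  have sD t : t \in G :\ i -> sigma t \in G :\ i.
    rewrite !inE => /andP[ti tG]; rewrite sG // andbT.
    by apply: contra_neq ti => e; apply: sI => //; rewrite e ji.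
  have [|||l [lU ls lE]] := IH _ sigma m b Nj sD.
  - by move=> t u /setD1P[_ tG] /setD1P[_ uG]; apply: sI.
  - by move=> t /setD1P[_ tG]; apply: m0.
  - by move=> t /setD1P[_ tG]; apply: b0.
  have [r [rU rs rE]] := frobenius_roots (m0 i iG) (b0 i iG).
  pose put (a : {ffun T -> k}) z := [ffun t => if t == i then z else a t].
  exists [seq put a z | a <- l, z <- r]; split.
  - rewrite allpairs_uniq // => -[a z] [a' z'] /= /allpairsP[[u v] /= [ul _ [-> ->]]].
    move=> /allpairsP[[u' v'] /= [ul' _ [-> ->]]] /ffunP e.
    have := e i; rewrite !ffunE eqxx => <-; congr pair; apply/ffunP => t.
    have [->|ti] := eqVneq t i.
      have [u0 _] := (lE u).1 ul; have [u0' _] := (lE u').1 ul'.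
      by rewrite u0 ?u0' // !inE eqxx.
    by have := e t; rewrite !ffunE (negPf ti).
  - by rewrite size_allpairs ls rs -expnD [in RHS](big_setD1 i) //= addnC.
  move=> a; split=> [/allpairsP[[a' z] /= [/lE[a0 aE] zr ->]]|[a0 aE]].
    split=> [t tG|t tG].
      rewrite ffunE; case: eqP => [e|_]; first by rewrite e iG in tG.
      by rewrite a0 // !inE negb_and tG orbT.
    rewrite !ffunE; have [->|ti] := eqVneq t i.
      by rewrite ji eqxx; apply/eqP; rewrite -rE.
    have tD : t \in G :\ i by rewrite !inE ti.
    have := sD t tD; rewrite !inE => /andP[/negPf-> _].
    exact: aE.
  apply/allpairsP; exists (put a 0, a i) => /=; split.
  - apply/lE; split=> [t|t tD].
      rewrite !inE negb_and negbK ffunE => /orP[->//|tG].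
      by case: eqP => // _; apply: a0.
    have := sD t tD; move: tD; rewrite !inE !ffunE => /andP[/negPf-> tG] /andP[/negPf-> _].
    exact: aE.
  - by rewrite rE aE // ji.
  - by apply/ffunP => t; rewrite !ffunE; case: eqP => // ->.
(* the coordinate at j = sigma i is determined by the one at i: drop it, and let
   sigma skip it *)
pose sigma' t := if t == i then sigma j else sigma t.
pose m' t := if t == i then (m i + m j)%N else m t.
pose b' t := if t == i then b i ^+ (p ^ m j) * b j else b t.
have sj t : t \in G -> sigma t = j -> t = i by move=> tG e; apply: sI => //; rewrite e ji.
have sD t : t \in G :\ j -> sigma' t \in G :\ j.
  rewrite !inE /sigma' => /andP[tj tG]; case: (eqVneq t i) => [e|ti]; rewrite sG // andbT.
    by apply: contra_neq ij => e'; rewrite (sj j).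
  by apply: contra_neq ti; apply: sj.
have [|||l [lU ls lE]] := IH _ sigma' m' b' Nj sD.
- move=> t u /setD1P[tj tG] /setD1P[uj uG]; rewrite /sigma'.
  case: (eqVneq t i) => [->|ti]; case: (eqVneq u i) => [->|ui] // e.
  + by have := sI _ _ jG uG e; move/eqP: uj => uj /esym.
  + by have := sI _ _ tG jG e; move/eqP: tj => tj.
  + exact: sI.
- move=> t /setD1P[_ tG]; rewrite /m'; case: eqP => _; last exact: m0.
  by rewrite addn_gt0 m0.
- move=> t /setD1P[_ tG]; rewrite /b'; case: (t =P i) => _; last exact: b0.
  by rewrite mulf_neq0 ?expf_neq0 ?b0.
pose put (a : {ffun T -> k}) :=
  [ffun t => if t == j then a i ^+ (p ^ m i) / b i else a t].
have putK (a : {ffun T -> k}) : (forall t, t \notin G :\ j -> a t = 0) ->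
    a = [ffun t => if t == j then 0 else put a t].
  move=> a0; apply/ffunP => t; rewrite !ffunE; case: eqP => // ->.
  by rewrite a0 // !inE eqxx.
exists [seq put a | a <- l]; split.
- rewrite map_inj_in_uniq // => a a' /lE[a0 _] /lE[a0' _] e.
  by rewrite (putK a) // (putK a') // e.
- rewrite size_map ls; congr (_ ^ _)%N.
  have iD : i \in G :\ j by rewrite !inE ij.
  rewrite (big_setD1 i) //= [in RHS](big_setD1 j) //= [in RHS](big_setD1 i) //=.
  rewrite /m' eqxx addnCA addnA; congr addn; apply: eq_bigr => t.
  by rewrite !inE => /andP[/negPf->].
move=> a; split=> [/mapP[a' /lE[a0 aE] ->]|[a0 aE]].
  split=> [t tG|t tG].
    rewrite ffunE; case: eqP => [e|_]; first by rewrite e jG in tG.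
    by rewrite a0 // !inE negb_and tG orbT.
  rewrite !ffunE; have [->|tj] := eqVneq t j.
    have iD : i \in G :\ j by rewrite !inE ij.
    have := aE i iD; rewrite /m' /b' /sigma' eqxx expnD exprM => e.
    rewrite expr_div_n e; case: eqP => [e'|_].
      by case/eqP: ij; rewrite (sj j).
    by rewrite -mulrA mulrC mulKf ?expf_neq0 ?b0.
  case: eqP => [/(sj t tG)->|e].
    by rewrite mulrC divfK ?b0.
  have tD : t \in G :\ j by rewrite !inE tj.
  have := aE t tD; rewrite /m' /b' /sigma'; case: eqP => // e'.
  by case: e; rewrite e' ji.
apply/mapP; exists [ffun t => if t == j then 0 else a t].
  apply/lE; split=> [t|t tD].
    rewrite !inE negb_and negbK ffunE => /orP[->//|tG].
    by case: eqP => // _; apply: a0.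
  have := sD t tD; move: tD; rewrite !inE !ffunE => /andP[/negPf-> tG] /andP[/negPf-> _].
  rewrite /m' /b' /sigma'; case: eqP => [->|_]; last exact: aE.
  by rewrite expnD exprM (aE i) // ji exprMn (aE j) // mulrA.
apply/ffunP => t; rewrite !ffunE; case: eqP => // ->.
rewrite (negPf ij) (aE i) // ji mulrC mulKf ?b0 //.
Qed.

End Frobenius.

(** * Derivations and Jacobson's formula *)

Definition derivation (K : fieldType) (D : K -> K) : Prop :=
  (forall f g, D (f + g) = D f + D g) /\ (forall f g, D (f * g) = D f * g + f * D g).

Section DerivationTheory.
Variables (K : fieldType) (D : K -> K).
Hypothesis derD : derivation D.

Lemma der_add f g : D (f + g) = D f + D g. Proof. by case: derD. Qed.
Lemma der_mul f g : D (f * g) = D f * g + f * D g. Proof. by case: derD. Qed.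
Lemma der0 : D 0 = 0.
Proof. by apply: (addIr (D 0)); rewrite -der_add !add0r. Qed.
Lemma der1 : D 1 = 0.
Proof.
have e := der_mul 1 1; rewrite !mulr1 mul1r in e.
by apply: (addIr (D 1)); rewrite add0r -e.
Qed.
Lemma der_sum I (r : seq I) (P : pred I) (F : I -> K) :
  D (\sum_(i <- r | P i) F i) = \sum_(i <- r | P i) D (F i).
Proof. exact: (big_morph D der_add der0). Qed.
Lemma der_expn f m : D (f ^+ m) = m%:R * f ^+ m.-1 * D f.
Proof.
elim: m => [|m IH]; first by rewrite der1 !mul0r.
rewrite exprS der_mul IH; case: m IH => [|m] _.
  by rewrite /= mulr1 mul0r mul0r mulr0 addr0 !mul1r.
by rewrite /= -natr1 exprS; ring.
Qed.
Lemma der_inv f : f != 0 -> D f^-1 = - D f / f ^+ 2.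
Proof.
move=> f0; have := der1; rewrite -(divff f0) der_mul => /eqP.
rewrite addrC addr_eq0 => /eqP e; apply: (mulfI f0); rewrite e.
by field.
Qed.
Lemma der_div f g : g != 0 -> D (f / g) = (D f * g - f * D g) / g ^+ 2.
Proof. by move=> g0; rewrite der_mul der_inv //; field. Qed.

Lemma iter_der_const c f m : D c = 0 -> iter m D (c * f) = c * iter m D f.
Proof. by move=> c0; elim: m => //= m ->; rewrite der_mul c0 mul0r add0r. Qed.

End DerivationTheory.

Section Jacobson.
Variables (p : nat) (k : closedFieldType) (K : fieldType).
Variables (phi : {rmorphism k -> K}) (D : K -> K).
Hypotheses (charp : p \in [pchar k]) (derD : derivation D).
Hypothesis Dphi : forall c, D (phi c) = 0.

Let p_prime : prime p := pcharf_prime charp.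
Let charK : p \in [pchar K].
Proof. by rewrite (fmorph_pchar phi). Qed.

Lemma poly0_of_const (q : {poly K}) : (forall c, q.[phi c] = 0) -> q = 0.
Proof.
move=> H; have sq : (0 < size q)%N || (size q == 0%N) by case: (size q).
have [s [sU ss _]] := frobenius_roots charp (ltn0Sn (size q)) (oner_neq0 k).
apply: (@roots_geq_poly_eq0 _ q (map phi s)).
- by apply/allP => _ /mapP[c _ ->]; apply/eqP.
- by rewrite map_inj_uniq //; apply: fmorph_inj.
- rewrite size_map ss; apply: leq_trans (leqnSn _) _.
  exact/ltnW/ltn_expl/prime_gt1.
Qed.

(** Its zeros are the functions with logarithmic derivative - u. *)
Definition twist u g := D g + u * g.

Lemma twist_add u g h : twist u (g + h) = twist u g + twist u h.
Proof. by rewrite /twist (der_add derD) mulrDr addrACA. Qed.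

Lemma twist0 u : twist u 0 = 0.
Proof. by rewrite /twist (der0 derD) mulr0 addr0. Qed.

Lemma twist_leibniz u v f g m : iter m (twist (u + v)) (f * g) =
  \sum_(i < m.+1) (iter (m - i) (twist u) f * iter i (twist v) g) *+ 'C(m, i).
Proof.
elim: m => [|m IH]; first by rewrite big_ord_recl big_ord0 addr0 mulr1n.
pose X i j := iter i (twist u) f * iter j (twist v) g.
have TX i j : twist (u + v) (X i j) = X i.+1 j + X i j.+1.
  by rewrite /X /= /twist (der_mul derD); ring.
have Tsum r (F : nat -> K) : twist (u + v) (\sum_(i < r) F i) = \sum_(i < r) twist (u + v) (F i).
  exact: (big_morph _ (twist_add _) (twist0 _)).
have Tn r z : twist (u + v) (z *+ r) = twist (u + v) z *+ r.
  by elim: r => [|r IHr]; rewrite ?mulr0n ?twist0 // !mulrS twist_add IHr.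
rewrite -[RHS]/(\sum_(i < m.+2) X (m.+1 - i)%N i *+ 'C(m.+1, i)).
rewrite iterS IH (Tsum _ (fun i => X (m - i)%N i *+ 'C(m, i))).
rewrite (eq_bigr (fun i : 'I_m.+1 => X (m.+1 - i)%N i *+ 'C(m, i) + X (m - i)%N i.+1 *+ 'C(m, i))).
  rewrite big_split /= [in RHS]big_ord_recl /= bin0 ?subn0.
  rewrite big_ord_recl /= bin0 ?subn0 -addrA; congr (_ + _).
  have -> : \sum_(i < m.+1) X (m.+1 - bump 0 i)%N (bump 0 i) *+ 'C(m.+1, bump 0 i) =
      \sum_(i < m.+1) X (m - i)%N i.+1 *+ 'C(m, i.+1) +
      \sum_(i < m.+1) X (m - i)%N i.+1 *+ 'C(m, i).
    by rewrite -big_split; apply: eq_bigr => i _ /=; rewrite /bump add1n subSS binS mulrnDr.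
  congr (_ + _); rewrite [RHS]big_ord_recr /= bin_small // mulr0n addr0.
  by apply: eq_bigr => i _; rewrite /bump add1n subSS.
by move=> i _; rewrite Tn TX mulrnDl subSn // -ltnS.
Qed.

(** In characteristic p only the two extreme terms of the Leibniz rule remain. *)
Lemma twist_leibniz_p u v f g : iter p (twist (u + v)) (f * g) =
  iter p (twist u) f * g + f * iter p (twist v) g.
Proof.
rewrite twist_leibniz; case: p p_prime charK => // q q_prime charq.
rewrite big_ord_recl big_ord_recr /= bin0 /bump /= add1n ?subn0 subnn binn /=.
rewrite !mulr1n big1 ?add0r // => i _; rewrite -mulr_natr.
have /dvdnP[c ->] : (q.+1 %| 'C(q.+1, bump 0 i))%N.
  by rewrite prime_dvd_bin // /bump add1n /= ltnS.
by rewrite natrM (pcharf0 charq) !mulr0.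
Qed.

Definition twist_power u := iter p (twist u) 1.

Lemma twist_powerD u v : twist_power (u + v) = twist_power u + twist_power v.
Proof. by rewrite /twist_power -{1}[1]mulr1 twist_leibniz_p mulr1 mul1r. Qed.

Lemma iter_twist u g : iter p (twist u) g = iter p D g + g * twist_power u.
Proof.
rewrite -{1}(add0r u) -{1}(mulr1 g) twist_leibniz_p mulr1; congr (_ + _).
by apply: eq_iter => f; rewrite /twist mul0r addr0.
Qed.

(** The coefficient of t^r in (D + t u)^m applied to 1, for a constant t. *)
Fixpoint twist_coef u m r : K :=
  if m is m'.+1 then
    D (twist_coef u m' r) + (if r is r'.+1 then u * twist_coef u m' r' else 0)
  else (r == 0)%N%:R.

Lemma twist_coef_big u m r : (m < r)%N -> twist_coef u m r = 0.
Proof.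
elim: m r => [|m IH] [|r] //= mr.
by rewrite !IH ?(der0 derD) ?mulr0 ?addr0 // ltnW.
Qed.

Lemma twist_coef_diag u m : twist_coef u m m = u ^+ m.
Proof. by elim: m => [|m IH] //=; rewrite twist_coef_big // (der0 derD) add0r IH exprS. Qed.

Lemma twist_coef0 u m : twist_coef u m.+1 0 = 0.
Proof.
elim: m => [|m IH]; first by rewrite /= addr0 (der1 derD).
by rewrite [LHS]/= -/(twist_coef u m.+1 0) IH (der0 derD) addr0.
Qed.

Lemma twist_coef1 u m : twist_coef u m.+1 1 = iter m D u.
Proof.
elim: m => [|m IH]; first by rewrite /= (der0 derD) add0r mulr1.
by rewrite -[LHS]/(D (twist_coef u m.+1 1) + u * twist_coef u m.+1 0) IH twist_coef0 mulr0 addr0.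
Qed.

Lemma iter_twist_coef u c m :
  iter m (twist (phi c * u)) 1 = \sum_(r < m.+1) phi c ^+ r * twist_coef u m r.
Proof.
elim: m => [|m IH]; first by rewrite big_ord_recl big_ord0 addr0 mulr1.
have Dc r : D (phi c ^+ r) = 0 by rewrite -rmorphXn Dphi.
have -> : \sum_(r < m.+2) phi c ^+ r * twist_coef u m.+1 r =
    \sum_(r < m.+2) phi c ^+ r * D (twist_coef u m r) +
    \sum_(r < m.+2) phi c ^+ r * (if nat_of_ord r is r'.+1 then u * twist_coef u m r' else 0).
  by rewrite -big_split; apply: eq_bigr => r _ /=; rewrite mulrDr.
rewrite big_ord_recr /= twist_coef_big // (der0 derD) mulr0 addr0.
rewrite [X in _ = _ + X]big_ord_recl /= mulr0 add0r IH /twist (der_sum derD); congr (_ + _).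
  by apply: eq_bigr => r _; rewrite (der_mul derD) Dc mul0r add0r.
rewrite big_distrr; apply: eq_bigr => r _ /=.
by rewrite /bump add1n exprS; ring.
Qed.

(** Jacobson's formula. As a function of t, the power (D + t u)^p is additive by
   the Leibniz rule, so only the terms in t and in t^p survive. *)
Lemma twist_powerE u : twist_power u = u ^+ p + iter p.-1 D u.
Proof.
pose Q := \poly_(r < p.+1) twist_coef u p r.
have QE c : Q.[phi c] = twist_power (phi c * u).
  rewrite horner_poly /twist_power iter_twist_coef.
  by apply: eq_bigr => r _; rewrite mulrC.
have QD c : Q \Po ('X + (phi c)%:P) - Q - (Q.[phi c])%:P = 0.
  apply: poly0_of_const => d; rewrite !(hornerE, horner_comp).
  by rewrite -rmorphD !QE rmorphD mulrDl twist_powerD; ring.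
have Q' c : Q^`().[phi c] = Q^`().[0].
  have := congr1 (fun q => q^`().[0]) (QD c).
  rewrite !derivB deriv_comp derivC subr0 derivD derivX derivC addr0 mulr1.
  by rewrite deriv0 !(hornerE, horner_comp) => /eqP; rewrite subr_eq0 => /eqP.
have Q'C : Q^`() = (Q^`().[0])%:P.
  apply/eqP; rewrite -subr_eq0; apply/eqP/poly0_of_const => c.
  by rewrite !hornerE Q' subrr.
have q0 r : (1 < r < p)%N -> twist_coef u p r = 0.
  case: r => [|[|r]] //= rp; have := congr1 (fun q : {poly K} => q`_r.+1) Q'C.
  rewrite coef_deriv coefC coef_poly ltnS ltnW // => /eqP.
  rewrite -mulr_natr mulf_eq0 => /orP[/eqP //|].
  by rewrite -(dvdn_pcharf charK) => /dvdn_leq => /(_ isT); rewrite leqNgt rp.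
have -> : twist_power u = Q.[phi 1] by rewrite QE rmorph1 mul1r.
rewrite rmorph1 horner_poly; under eq_bigr do rewrite expr1n mulr1.
rewrite big_ord_recr /= twist_coef_diag addrC; congr (_ + _).
have sumE (F : nat -> K) : (forall r, (1 < r < p)%N -> F r = 0) ->
    \sum_(r < p) F r = F 0 + F 1.
  case: p (prime_gt1 p_prime) => [|[|q]] // _ F0.
  rewrite !big_ord_recl big1 ?addr0 => [|r _] //.
  by apply: F0; rewrite !lift0 /= !ltnS.
rewrite (sumE (twist_coef u p)) //.
by rewrite -(prednK (prime_gt0 p_prime)) twist_coef0 add0r twist_coef1.
Qed.

(** The hypothesis says that D - u kills 1 after p steps. The last nonzero iterate
   is the function f. *)
Lemma log_der_of_eq u : u ^+ p + iter p.-1 D u = 0 ->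
  exists2 f, f != 0 & D f = u * f.
Proof.
rewrite -twist_powerE => u0.
have : iter p (twist (- u)) 1 = 0.
  apply: (addIr (twist_power u)); rewrite -/(twist_power _) -twist_powerD addNr.
  rewrite add0r u0 /twist_power -(prednK (prime_gt0 p_prime)) iterSr.
  rewrite {2}/twist (der1 derD) mul0r addr0.
  by elim: (p.-1) => //= m ->; rewrite twist0.
elim: (p) => [/eqP|m IH]; first by rewrite oner_eq0.
have [/IH //|m0 /= e] := eqVneq (iter m (twist (- u)) 1) 0.
exists (iter m (twist (- u)) 1) => //; move: e => /eqP.
by rewrite /twist mulNr subr_eq0 => /eqP.
Qed.

(** D - u kills f, hence so does its p-th power, which is D^p minus the
   multiplication by the left-hand side. *)
Lemma eq_of_log_der u f : f != 0 -> D f = u * f -> iter p D f = 0 ->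
  u ^+ p + iter p.-1 D u = 0.
Proof.
move=> f0 Df Dpf; rewrite -twist_powerE.
have := iter_twist (- u) f; rewrite Dpf add0r.
rewrite -{1}(prednK (prime_gt0 p_prime)) iterSr {2}/twist Df mulNr subrr.
have -> m : iter m (twist (- u)) 0 = 0 by elim: m => //= m ->; rewrite twist0.
move=> /esym/eqP; rewrite mulf_eq0 (negPf f0) => /eqP e.
have := twist_powerD u (- u); rewrite e addr0 subrr => <-.
rewrite /twist_power -(prednK (prime_gt0 p_prime)) iterSr.
rewrite {2}/twist (der1 derD) mul0r addr0.
by elim: (p.-1) => //= m ->; rewrite twist0.
Qed.

End Jacobson.

(** * The function field of a smooth affine model *)

Section Eval.
Variables (k K : fieldType) (phi : {rmorphism k -> K}).

Definition pev (x : K) : {poly k} -> K := horner_eval x \o map_poly phi.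
HB.instance Definition _ x := GRing.RMorphism.copy (pev x) (horner_eval x \o map_poly phi).

Lemma pevC x c : pev x c%:P = phi c.
Proof. by rewrite /pev /= /horner_eval map_polyC hornerC. Qed.
Lemma pevX x : pev x 'X = x.
Proof. by rewrite /pev /= /horner_eval map_polyX hornerX. Qed.
Lemma pevXsubC x c : pev x ('X - c%:P) = x - phi c.
Proof. by rewrite rmorphB /= pevC pevX. Qed.

(** The roots of F are simple, so that the affine curve is smooth; that there is one
   makes y irrational over k(x). *)
Record model (F : {poly k}) (x y : K) : Prop := Model {
  model_transc : forall A, pev x A = 0 -> A = 0;
  model_eq : y ^+ 2 = pev x F;
  model_smooth : forall a, F.[a] = 0 -> F^`().[a] != 0;
  model_root : exists a, F.[a] = 0
}.

Definition aff x y (A B : {poly k}) : K := pev x A + pev x B * y.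

Lemma affE x y A B : aff x y A B = pev x A + pev x B * y.
Proof. by []. Qed.

(** Cross-multiplied, so that presentations can be compared without dividing. *)
Definition fracrep x y z (A B C : {poly k}) : Prop :=
  C != 0 /\ z * pev x C = aff x y A B.

Section Model.
Variables (F : {poly k}) (x y : K).
Hypothesis M : model F x y.

Let y2 : y ^+ 2 = pev x F := model_eq M.

Lemma pev_eq0 A : (pev x A == 0) = (A == 0).
Proof.
apply/eqP/eqP => [|->]; [exact: (model_transc M) | exact: rmorph0].
Qed.

Lemma pev_inj : injective (pev x).
Proof.
move=> A B e; apply/eqP; rewrite -subr_eq0 -pev_eq0 rmorphB /= e subrr //.
Qed.

Lemma model_simple_root a : F.[a] = 0 ->
  exists2 G, F = G * ('X - a%:P) & G.[a] != 0.
Proof.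
move=> Fa; have /factor_theorem[G FE] : root F a by apply/eqP.
exists G => //; have := model_smooth M Fa.
by rewrite FE derivM derivXsubC mulr1 !hornerE /= subrr mulr0 add0r.
Qed.

(** At a root of F, which is simple, A^2 has even multiplicity and B^2 F odd. *)
Lemma norm_eq0 A B : A ^+ 2 - B ^+ 2 * F = 0 -> A = 0 /\ B = 0.
Proof.
have [a Fa] := model_root M; have [G FE Ga] := model_simple_root Fa.
move=> /eqP; rewrite subr_eq0 => /eqP e.
suff B0 : B = 0.
  by split=> //; apply/eqP; rewrite -sqrf_eq0 e B0 expr0n mul0r.
apply/eqP/negP => /negP B0.
have G0 : G != 0 by apply: contraNneq Ga => ->; rewrite horner0.
have X0 : 'X - a%:P != 0 by rewrite polyXsubC_eq0.
have A0 : A != 0 by rewrite -sqrf_eq0 e !mulf_neq0 ?expf_neq0 // FE mulf_neq0.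
have := congr1 (mup a) e.
rewrite FE !expr2 !mupM ?mulf_neq0 // (mupNroot (q := G)) // add0n.
rewrite -['X - a%:P]expr1 mup_XsubCX eqxx !addnn => /(congr1 odd).
by rewrite oddD !odd_double.
Qed.

Lemma aff_inj A B A' B' : aff x y A B = aff x y A' B' -> A = A' /\ B = B'.
Proof.
move=> e; have [|/eqP + /eqP] := @norm_eq0 (A - A') (B - B'); last first.
  by rewrite !subr_eq0 => /eqP-> /eqP->.
apply: pev_inj; rewrite rmorph0 rmorphB rmorphXn rmorphM rmorphXn /= -y2 -exprMn.
rewrite subr_sqr; have -> : pev x (A - A') + pev x (B - B') * y = 0.
  by rewrite !rmorphB /= mulrBl -addrACA -opprD -/(aff _ _ _ _) e subrr.
by rewrite mulr0.
Qed.

Lemma aff_eq0 A B : aff x y A B = 0 -> A = 0 /\ B = 0.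
Proof. by move=> e; apply: aff_inj; rewrite e /aff !rmorph0 mul0r addr0. Qed.

Lemma affD A B A' B' : aff x y A B + aff x y A' B' = aff x y (A + A') (B + B').
Proof. by rewrite /aff !rmorphD; ring. Qed.

Lemma affN A B : - aff x y A B = aff x y (- A) (- B).
Proof. by rewrite /aff !rmorphN; ring. Qed.

Lemma affM A B A' B' :
  aff x y A B * aff x y A' B' = aff x y (A * A' + B * B' * F) (A * B' + B * A').
Proof. by rewrite /aff !(rmorphD, rmorphM) /= -y2; ring. Qed.

Lemma aff_pev A : pev x A = aff x y A 0.
Proof. by rewrite /aff rmorph0 mul0r addr0. Qed.

Lemma aff_y : y = aff x y 0 1.
Proof. by rewrite /aff rmorph0 rmorph1 mul1r add0r. Qed.

Lemma aff_norm A B : aff x y A B * aff x y A (- B) = pev x (A ^+ 2 - B ^+ 2 * F).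
Proof. by rewrite affM aff_pev; congr aff; ring. Qed.

Lemma fracrep_uniq z A B C A' B' C' : fracrep x y z A B C -> fracrep x y z A' B' C' ->
  A * C' = A' * C /\ B * C' = B' * C.
Proof.
move=> [_ e] [_ e']; apply: aff_inj.
have affZ U V W : aff x y (U * W) (V * W) = aff x y U V * pev x W.
  by rewrite /aff !rmorphM; ring.
by rewrite !affZ -e -e' mulrAC.
Qed.

Lemma fracrepD z A B C z' A' B' C' : fracrep x y z A B C -> fracrep x y z' A' B' C' ->
  fracrep x y (z + z') (A * C' + A' * C) (B * C' + B' * C) (C * C').
Proof.
move=> [C0 e] [C'0 e']; split; first exact: mulf_neq0.
have -> : aff x y (A * C' + A' * C) (B * C' + B' * C) =
   aff x y A B * pev x C' + aff x y A' B' * pev x C.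
  by rewrite /aff !(rmorphD, rmorphM); ring.
by rewrite -e -e' rmorphM; ring.
Qed.

Lemma fracrepN z A B C : fracrep x y z A B C -> fracrep x y (- z) (- A) (- B) C.
Proof. by move=> [C0 e]; split; rewrite // mulNr e affN. Qed.

Lemma fracrepM z A B C z' A' B' C' : fracrep x y z A B C -> fracrep x y z' A' B' C' ->
  fracrep x y (z * z') (A * A' + B * B' * F) (A * B' + B * A') (C * C').
Proof.
move=> [C0 e] [C'0 e']; split; first exact: mulf_neq0.
by rewrite -affM -e -e' rmorphM /=; ring.
Qed.

Lemma fracrepV z A B C : z != 0 -> fracrep x y z A B C ->
  fracrep x y z^-1 (C * A) (- (C * B)) (A ^+ 2 - B ^+ 2 * F).
Proof.
move=> z0 [C0 e]; split.
  apply/eqP => /norm_eq0[A0 B0]; move: e; rewrite A0 B0 -aff_pev rmorph0 => /eqP.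
  by rewrite mulf_eq0 (negPf z0) pev_eq0 (negPf C0).
rewrite -aff_norm -e; have -> : aff x y (C * A) (- (C * B)) = pev x C * aff x y A (- B).
  by rewrite /aff !rmorphN !rmorphM; ring.
by rewrite !mulrA mulVf // mul1r.
Qed.

Lemma fracrep_aff A B : fracrep x y (aff x y A B) A B 1.
Proof. by split; rewrite ?oner_neq0 // rmorph1 mulr1. Qed.

(** The elements that have a presentation form a subfield. *)
Lemma fracrep_gen (x' y' : K) :
  (forall z : K, exists u v : {poly {poly k}},
    let ev (w : {poly {poly k}}) := (map_poly (map_poly phi) w).[x', y'] in
    ev v != 0 /\ z = ev u / ev v) ->
  (exists A B C, fracrep x y x' A B C) -> (exists A B C, fracrep x y y' A B C) ->
  forall z, exists A B C, fracrep x y z A B C.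
Proof.
move=> gen Rx Ry.
pose S z := exists A B C, fracrep x y z A B C.
have SD z w : S z -> S w -> S (z + w).
  by move=> [A [B [C H]]] [A' [B' [C' H']]]; have := fracrepD H H'; do 3 eexists; eauto.
have SM z w : S z -> S w -> S (z * w).
  by move=> [A [B [C H]]] [A' [B' [C' H']]]; have := fracrepM H H'; do 3 eexists; eauto.
have SC A : S (pev x A) by exists A, 0, 1; rewrite aff_pev; apply: fracrep_aff.
have S0 : S 0 by rewrite -(rmorph0 (pev x)); apply: SC.
have SP (t : K) (q : {poly K}) : S t -> (forall i, S q`_i) -> S q.[t].
  move=> St; elim/poly_ind: q => [|q c IH] Sq; first by rewrite horner0.
  rewrite hornerMXaddC; apply: SD; last by have := Sq 0%N; rewrite coefD coefMX coefC add0r.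
  apply: SM => //; apply: IH => i; have := Sq i.+1.
  by rewrite coefD coefMX coefC addr0.
have Sev (w : {poly {poly k}}) : S (map_poly (map_poly phi) w).[x', y'].
  elim/poly_ind: w => [|w c IH]; first by rewrite rmorph0 !horner0.
  rewrite rmorphD rmorphM /= map_polyX map_polyC /= !hornerE.
  apply: SD; first exact: SM.
  by apply: SP => // i; rewrite coef_map; have := SC (c`_i)%:P; rewrite pevC.
move=> z; have [u [v [v0 ->]]] := gen z; apply: SM => //.
by have [A [B [C H]]] := Sev v; have := fracrepV v0 H; do 3 eexists; eauto.
Qed.

(** ** The hyperelliptic involution and the derivation d/dx *)

Hypothesis two_neq0 : 2%:R != 0 :> k.
Hypothesis gen : forall z, exists A B C, fracrep x y z A B C.

Let K2 : 2%:R != 0 :> K.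
Proof. by rewrite -(rmorph_nat phi) fmorph_eq0. Qed.

Lemma model_y_neq0 : y != 0.
Proof.
apply/eqP => y0; have [] := @aff_eq0 0 1; first by rewrite -aff_y.
by move=> _ /eqP; rewrite oner_eq0.
Qed.

Lemma fracrep_choice : exists R : K -> {poly k} * {poly k} * {poly k},
  forall z, fracrep x y z (R z).1.1 (R z).1.2 (R z).2.
Proof.
have H z : exists r : {poly k} * {poly k} * {poly k}, fracrep x y z r.1.1 r.1.2 r.2.
  by have [A [B [C R]]] := gen z; exists (A, B, C).
by have [R RP] := choice H; exists R.
Qed.

Lemma involution_exists : exists s : {rmorphism K -> K},
  (forall A, s (pev x A) = pev x A) /\ s y = - y.
Proof.
have [R RP] := fracrep_choice.
pose s z := aff x y (R z).1.1 (- (R z).1.2) / pev x (R z).2.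
have sE z A B C : fracrep x y z A B C -> s z = aff x y A (- B) / pev x C.
  move=> H; have [e1 e2] := fracrep_uniq (RP z) H.
  have [C0 _] := H; have [C'0 _] := RP z.
  apply/eqP; rewrite eqr_div ?pev_eq0 // /aff !mulrDl; apply/eqP.
  rewrite -rmorphM e1 rmorphM; congr (_ + _).
  by rewrite mulrAC -rmorphM mulNr e2 -mulNr rmorphM mulrAC.
have sB : zmod_morphism s.
  move=> z w; have [A [B [C H]]] := gen z; have [A' [B' [C' H']]] := gen w.
  rewrite (sE _ _ _ _ H) (sE _ _ _ _ H') (sE _ _ _ _ (fracrepD H (fracrepN H'))).
  have [C0 _] := H; have [C'0 _] := H'.
  rewrite /aff !(rmorphD, rmorphM, rmorphN) /=; field.
  by rewrite !pev_eq0 C0 C'0.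
have sM : monoid_morphism s.
  split; first by rewrite (sE _ 1 0 1) -?aff_pev ?oppr0 -?aff_pev ?rmorph1 ?divr1 //;
    split; rewrite ?oner_neq0 // rmorph1 mulr1 -aff_pev rmorph1.
  move=> z w; have [A [B [C H]]] := gen z; have [A' [B' [C' H']]] := gen w.
  rewrite (sE _ _ _ _ H) (sE _ _ _ _ H') (sE _ _ _ _ (fracrepM H H')).
  have [C0 _] := H; have [C'0 _] := H'.
  rewrite /aff !(rmorphD, rmorphM, rmorphN) /= -y2; field.
  by rewrite !pev_eq0 C0 C'0.
pose Z := GRing.isZmodMorphism.Build _ _ s sB.
pose N := GRing.isMonoidMorphism.Build _ _ s sM.
pose t : {rmorphism K -> K} := HB.pack s Z N.
exists t; split=> [A|].
  rewrite -[LHS]/(s _) aff_pev (sE _ _ _ _ (fracrep_aff A 0)).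
  by rewrite oppr0 rmorph1 divr1.
rewrite -[LHS]/(s y) {1}aff_y (sE _ _ _ _ (fracrep_aff 0 1)).
by rewrite rmorph1 divr1 /aff rmorph0 add0r rmorphN rmorph1 mulN1r.
Qed.

Lemma derivation_exists : exists2 D : K -> K, derivation D &
  (forall A, D (pev x A) = pev x A^`()) /\ D y = pev x F^`() / (2%:R * y).
Proof.
have [R RP] := fracrep_choice.
pose y1 := pev x F^`() / (2%:R * y).
have F'E : pev x F^`() = 2%:R * y * y1.
  by rewrite /y1 mulrC divfK // mulf_neq0 // model_y_neq0.
pose d A B := aff x y A^`() B^`() + pev x B * y1.
pose D z := (d (R z).1.1 (R z).1.2 - z * pev x (R z).2^`()) / pev x (R z).2.
have dZ A B C : d (A * C) (B * C) = d A B * pev x C + aff x y A B * pev x C^`().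
  by rewrite /d /aff !derivM !(rmorphD, rmorphM) /=; ring.
have DE z A B C : fracrep x y z A B C -> D z = (d A B - z * pev x C^`()) / pev x C.
  move=> H; have [e1 e2] := fracrep_uniq (RP z) H.
  have [C0 e] := H; have [C'0 e'] := RP z; have := congr2 d e1 e2.
  rewrite !dZ -e -e' => e3; apply/eqP; rewrite eqr_div ?pev_eq0 //; apply/eqP.
  rewrite /D mulrBl; move: e3 => /(canRL (addrK _)) ->; ring.
(* by DE, the quotient rule gives the same value for every presentation *)
exists D.
  split=> z w; have [A [B [C H]]] := gen z; have [A' [B' [C' H']]] := gen w;
    have [C0 e] := H; have [C'0 e'] := H'; have CK := C0; have C'K := C'0;
    rewrite -pev_eq0 in CK; rewrite -pev_eq0 in C'K;
    rewrite (DE _ _ _ _ H) (DE _ _ _ _ H').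
    rewrite (DE _ _ _ _ (fracrepD H H')) /d /aff.
    rewrite !(derivD, derivM) !(rmorphD, rmorphM) /=.
    have -> : z = aff x y A B / pev x C by rewrite -e mulfK.
    have -> : w = aff x y A' B' / pev x C' by rewrite -e' mulfK.
    by rewrite /aff; field; rewrite CK C'K.
  rewrite (DE _ _ _ _ (fracrepM H H')) /d /aff.
  rewrite !(derivD, derivM) !(rmorphD, rmorphM) /= F'E -y2.
  have -> : z = aff x y A B / pev x C by rewrite -e mulfK.
  have -> : w = aff x y A' B' / pev x C' by rewrite -e' mulfK.
  by rewrite /aff; field; rewrite CK C'K.
have Daff A B : D (aff x y A B) = d A B.
  rewrite (DE _ _ _ _ (fracrep_aff A B)).
  by rewrite -[1]/(1%:P) derivC rmorph0 mulr0 subr0 rmorph1 divr1.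
split=> [A|]; first by rewrite aff_pev Daff /d /aff deriv0 !rmorph0 !mul0r !addr0.
rewrite [LHS](_ : _ = D (aff x y 0 1)); last by rewrite -aff_y.
rewrite Daff /d /aff -[1]/(1%:P) deriv0 derivC !rmorph0 mul0r add0r add0r.
by rewrite rmorph1 mul1r.
Qed.

End Model.
End Eval.

(** * Valuations *)

Section Valuation.
Variables (k K : fieldType) (phi : {rmorphism k -> K}).
Implicit Types (P Q : place phi) (f g z : K).

Lemma place_ext P Q : (forall z, P z = Q z) -> P = Q.
Proof.
case: P Q => [o o0 oM oD oc ou] [o' o0' oM' oD' oc' ou'] /= /funext e.
by subst o'; congr Place; apply: Prop_irrelevance.
Qed.

Lemma ordN P f : P (- f) = P f.
Proof.
have [->|f0] := eqVneq f 0; first by rewrite oppr0.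
have e : P (- 1) = 0.
  have : P (- 1) + P (- 1) = 0.
    by rewrite -ordM ?oppr_eq0 ?oner_neq0 // mulrNN mulr1 place1.
  by lia.
by rewrite -mulN1r ordM ?oppr_eq0 ?oner_neq0 // e add0r.
Qed.

Lemma ordX P f m : f != 0 -> P (f ^+ m) = m%:Z * P f.
Proof.
move=> f0; elim: m => [|m IH]; first by rewrite expr0 place1 mul0r.
by rewrite exprS ordM ?expf_neq0 // IH; lia.
Qed.

Lemma ordXz P f (m : int) : f != 0 -> P (f ^ m) = m * P f.
Proof.
move=> f0; case: m => m; first by rewrite -exprnP ordX.
by rewrite NegzE -exprnN placeV ?expf_neq0 // ordX //; lia.
Qed.

Definition integral P z := 0 <= P z.

Lemma integralD P f g : integral P f -> integral P g -> integral P (f + g).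
Proof.
rewrite /integral; have [->|f0] := eqVneq f 0; first by rewrite add0r.
have [->|g0] := eqVneq g 0; first by rewrite addr0.
have [->|fg0] := eqVneq (f + g) 0; first by rewrite Defs.ord0.
by move=> Pf Pg; apply: le_trans (ordD P f0 g0 fg0); rewrite le_min Pf.
Qed.

Lemma integralM P f g : integral P f -> integral P g -> integral P (f * g).
Proof.
rewrite /integral; have [->|f0] := eqVneq f 0; first by rewrite mul0r Defs.ord0.
have [->|g0] := eqVneq g 0; first by rewrite mulr0 Defs.ord0.
by rewrite ordM //; apply: addr_ge0.
Qed.

Lemma integralN P f : integral P (- f) = integral P f.
Proof. by rewrite /integral ordN. Qed.

Lemma integral_const P c : integral P (phi c).
Proof. by rewrite /integral ord_const. Qed.

Lemma integral_pev P x A : integral P x -> integral P (pev phi x A).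
Proof.
move=> xi; elim/poly_ind: A => [|A c IH]; first by rewrite rmorph0 /integral Defs.ord0.
rewrite rmorphD rmorphM /= pevX pevC; apply: integralD; last exact: integral_const.
exact: integralM.
Qed.

Lemma integral_aff P x y A B : integral P x -> integral P y ->
  integral P (aff phi x y A B).
Proof.
by move=> xi yi; apply: integralD; rewrite ?integral_pev // integralM ?integral_pev.
Qed.

(** Membership in the maximal ideal of P; the value 0 that a place takes at 0
   is the reason for the special case. *)
Definition vanishing P z := (z == 0) || (0 < P z).

Lemma vanishingW P z : vanishing P z -> integral P z.
Proof. by case/orP=> [/eqP->|/ltW //]; rewrite /integral Defs.ord0. Qed.

Lemma vanishingD P f g : vanishing P f -> vanishing P g -> vanishing P (f + g).
Proof.
have [->|f0] := eqVneq f 0; first by rewrite add0r.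
have [->|g0] := eqVneq g 0; first by rewrite addr0.
rewrite /vanishing (negPf f0) (negPf g0) /=; case: eqVneq => //= fg0 Pf Pg.
by apply: lt_le_trans (ordD P f0 g0 fg0); rewrite lt_min Pf.
Qed.

Lemma vanishingM P f g : integral P f -> vanishing P g -> vanishing P (f * g).
Proof.
rewrite /vanishing /integral mulf_eq0.
case: (eqVneq f 0) => //= f0; case: (eqVneq g 0) => //= g0.
by rewrite ordM //; lia.
Qed.

Lemma vanishingN P f : vanishing P (- f) = vanishing P f.
Proof. by rewrite /vanishing ordN oppr_eq0. Qed.

Lemma vanishing_const P c : vanishing P (phi c) = (c == 0).
Proof. by rewrite /vanishing ord_const fmorph_eq0 ltxx orbF. Qed.

Lemma ord_unit P c f : c != 0 -> vanishing P (f - phi c) -> P f = 0.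
Proof.
move=> c0 v; have fi : integral P f.
  by rewrite -(subrK (phi c) f) integralD ?integral_const // vanishingW.
have [//|Pf] : P f = 0 \/ 0 < P f by move: fi; rewrite /integral; lia.
have : vanishing P (f - (f - phi c)).
  by rewrite vanishingD ?vanishingN // /vanishing Pf orbT.
by rewrite subKr vanishing_const (negPf c0).
Qed.

Lemma vanishing_pev P x a A : vanishing P (x - phi a) ->
  vanishing P (pev phi x A - phi A.[a]).
Proof.
move=> v; have xi : integral P x.
  by rewrite -(subrK (phi a) x) integralD ?integral_const // vanishingW.
have /factor_theorem[Q e] : root (A - A.[a]%:P) a by rewrite rootE !hornerE subrr.
rewrite -(pevC phi x) -rmorphB /= e rmorphM /= pevXsubC.
by rewrite vanishingM // integral_pev.
Qed.

End Valuation.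

(** * Points and places *)

Section Point.
Variables (k : closedFieldType) (K : fieldType) (phi : {rmorphism k -> K}).
Variables (F : {poly k}) (x y : K).
Hypothesis M : model phi F x y.
Hypothesis two_neq0 : 2%:R != 0 :> k.
Hypothesis gen : forall z, exists A B C, fracrep phi x y z A B C.
Implicit Types P Q : place phi.

Local Notation pev := (pev phi x).
Local Notation aff := (aff phi x y).

Let y2 : y ^+ 2 = pev F := model_eq M.

Lemma x_neq_const a : x - phi a != 0.
Proof. by rewrite -pevXsubC (pev_eq0 M) polyXsubC_eq0. Qed.

Lemma y_neq_const b : y - phi b != 0.
Proof.
apply/eqP => e; have [] := @aff_eq0 _ _ _ _ _ _ M (- b%:P) 1.
  by rewrite ?affE rmorphN /= pevC rmorph1 mul1r addrC.
by move=> _ /eqP; rewrite oner_eq0.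
Qed.

(** P lies over the point (a, b) of the affine curve. *)
Definition centered P a b := vanishing P (x - phi a) && vanishing P (y - phi b).

Section At.
Variables a b : k.
Hypothesis ab : b ^+ 2 = F.[a].

Let val (A B : {poly k}) := A.[a] + B.[a] * b.

Let valM A B A' B' : val (A * A' + B * B' * F) (A * B' + B * A') = val A B * val A' B'.
Proof. by rewrite /val !hornerE -ab; ring. Qed.

Lemma centered_integral P A B : centered P a b -> integral P (aff A B).
Proof.
case/andP=> vx vy; apply: integral_aff.
  by rewrite -(subrK (phi a) x) integralD ?integral_const // vanishingW.
by rewrite -(subrK (phi b) y) integralD ?integral_const // vanishingW.
Qed.

Lemma centered_aff P A B : centered P a b -> vanishing P (aff A B - phi (val A B)).
Proof.
move=> c; have /andP[vx vy] := c.
have -> : aff A B - phi (val A B) =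
    (pev A - phi A.[a]) + (y * (pev B - phi B.[a]) + phi B.[a] * (y - phi b)).
  by rewrite ?affE /val rmorphD rmorphM /=; ring.
apply: vanishingD; first exact: vanishing_pev.
apply: vanishingD; last by apply: vanishingM => //; apply: integral_const.
apply: vanishingM; last exact: vanishing_pev.
by rewrite [y](aff_y phi x y) centered_integral.
Qed.

Lemma centered_unit P A B : centered P a b -> val A B != 0 -> P (aff A B) = 0.
Proof. by move=> c v; apply: ord_unit v _; apply: centered_aff. Qed.

(** Units of the local ring at (a, b), as quotients of two regular functions that do
   not vanish there. *)
Definition unit_at w := exists A B A' B',
  [/\ val A B != 0, val A' B' != 0 & w * aff A' B' = aff A B].

Lemma aff_neq0 A B : val A B != 0 -> aff A B != 0.
Proof.
apply: contraNneq => /(aff_eq0 M)[-> ->].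
by rewrite /val !horner0 mul0r addr0.
Qed.

Lemma unit_at_neq0 w : unit_at w -> w != 0.
Proof.
move=> [A [B [A' [B' [v v' e]]]]]; apply: contraNneq (aff_neq0 v) => w0.
by rewrite -e w0 mul0r.
Qed.

Lemma unit_at_aff A B : val A B != 0 -> unit_at (aff A B).
Proof.
move=> v; exists A, B, 1, 0; split=> //.
  by rewrite /val hornerC horner0 mul0r addr0 oner_neq0.
by rewrite -aff_pev rmorph1 mulr1.
Qed.

Lemma unit_at_pev A : A.[a] != 0 -> unit_at (pev A).
Proof.
by move=> v; rewrite (aff_pev phi x y); apply: unit_at_aff; rewrite /val horner0 mul0r addr0.
Qed.

Lemma unit_atM w z : unit_at w -> unit_at z -> unit_at (w * z).
Proof.
move=> [A [B [C [D [v v' e]]]]] [A' [B' [C' [D' [u u' e']]]]].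
exists (A * A' + B * B' * F), (A * B' + B * A'), (C * C' + D * D' * F), (C * D' + D * C').
by rewrite !valM !mulf_neq0 //; split=> //; rewrite -!(affM M) -e -e'; ring.
Qed.

Lemma unit_atV w : unit_at w -> unit_at w^-1.
Proof.
move=> wu; have w0 := unit_at_neq0 wu.
move: wu => [A [B [A' [B' [v v' e]]]]]; exists A', B', A, B; split=> //.
by rewrite -e mulKf.
Qed.

Lemma unit_atX w m : unit_at w -> unit_at (w ^+ m).
Proof.
move=> wu; elim: m => [|m IH]; last by rewrite exprS; apply: unit_atM.
by rewrite expr0 -(rmorph1 pev); apply: unit_at_pev; rewrite hornerC oner_neq0.
Qed.

Lemma centered_unit_at P w : centered P a b -> unit_at w -> P w = 0.
Proof.
move=> c wu; have w0 := unit_at_neq0 wu; move: wu => [A [B [A' [B' [v v' e]]]]].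
have := centered_unit c v; rewrite -e ordM ?aff_neq0 //.
by rewrite (centered_unit c v') addr0.
Qed.

(** A uniformizer at the point: where b vanishes the curve is tangent to the
   fibre of x. *)
Definition param := if b == 0 then y else x - phi a.

Lemma param_neq0 : param != 0.
Proof.
by rewrite /param; case: ifP => _; [exact: (model_y_neq0 M) | exact: x_neq_const].
Qed.

Lemma param_aff : exists A B, param = aff A B /\ val A B = 0.
Proof.
rewrite /param; case: eqP => [b0|_].
  by exists 0, 1; rewrite -aff_y /val b0 mulr0 horner0 addr0.
exists ('X - a%:P), 0; rewrite -aff_pev pevXsubC /val; split=> //.
by rewrite !hornerE subrr.
Qed.

Definition decomposed z := exists (m : int) w, unit_at w /\ z = param ^ m * w.

Lemma decomposedM z w : decomposed z -> decomposed w -> decomposed (z * w).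
Proof.
move=> [m [u [uu ->]]] [m' [u' [uu' ->]]]; exists (m + m'), (u * u').
split; first exact: unit_atM.
by rewrite expfzDr ?param_neq0 //; ring.
Qed.

Lemma decomposedV z : decomposed z -> decomposed z^-1.
Proof.
move=> [m [u [uu ->]]]; exists (- m), u^-1; split; first exact: unit_atV.
by rewrite invfM -invr_expz.
Qed.

Lemma decomposed_unit w : unit_at w -> decomposed w.
Proof. by exists 0, w; rewrite expr0z mul1r. Qed.

Lemma ramified_fibre : b = 0 -> exists2 G, F = G * ('X - a%:P) & G.[a] != 0.
Proof. by move=> b0; apply: (model_simple_root M); rewrite -ab b0 expr0n. Qed.

(** Where b = 0, x - a = y^2 / G(x) with G(a) <> 0. *)
Lemma fibre_param : exists2 w, unit_at w &
  x - phi a = param ^+ (if b == 0 then 2%N else 1%N) * w.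
Proof.
rewrite /param; case: eqP => [b0|_]; last first.
  by exists 1; rewrite ?expr1 ?mulr1 // -(expr0 1); apply: (unit_atX 0);
     rewrite -(rmorph1 pev); apply: unit_at_pev; rewrite hornerC oner_neq0.
have [G FE Ga] := ramified_fibre b0; exists (pev G)^-1.
  exact/unit_atV/unit_at_pev.
rewrite y2 FE rmorphM /= pevXsubC mulrAC mulfV ?mul1r //.
exact/unit_at_neq0/unit_at_pev.
Qed.

Lemma decomposed_fibre : decomposed (x - phi a).
Proof.
by have [w wu ->] := fibre_param; eexists (Posz _), w; split.
Qed.

Lemma decomposed_pev A : A != 0 -> decomposed (pev A).
Proof.
move=> A0; have [m [Q Qa ->]] := multiplicity_XsubC A a.
move: Qa; rewrite A0 /= => Qa; rewrite rmorphM rmorphXn /= pevXsubC.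
apply: decomposedM; first exact/decomposed_unit/unit_at_pev.
elim: m => [|m IH]; last by rewrite exprS; apply: decomposedM decomposed_fibre IH.
rewrite expr0 -(rmorph1 pev); apply/decomposed_unit/unit_at_pev.
by rewrite hornerC oner_neq0.
Qed.

(** Divide by x - a while both A and B vanish at a. If f = A(x) + B(x) y still
   vanishes at the point, then either its conjugate does not, and f is the
   quotient of the norm by it, or b = 0, and f / y is a unit. *)
Lemma decomposed_aff A B : aff A B != 0 -> decomposed (aff A B).
Proof.
have [N] := ubnP (size A + size B); elim: N => // N IH in A B *.
rewrite ltnS => szN AB0.
have [/eqP v0|v0] := boolP (val A B == 0); last exact/decomposed_unit/unit_at_aff.
have [/eqP v1|v1] := boolP (val A (- B) == 0); last first.
  have AB'0 := aff_neq0 v1.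
  rewrite -(mulfK AB'0 (aff A B)); apply: decomposedM.
    rewrite (aff_norm M); apply: decomposed_pev.
    by rewrite -(pev_eq0 M) -(aff_norm M) mulf_neq0.
  exact/decomposedV/decomposed_unit/unit_at_aff.
have Aa : A.[a] = 0.
  apply/eqP; rewrite -(mulrI_eq0 _ (mulfI two_neq0)); apply/eqP.
  rewrite -[RHS](addr0 0) -{1}v0 -v1 /val hornerN; ring.
have /factor_theorem[A1 AE] : root A a by apply/eqP.
have Bb : B.[a] * b = 0 by move: v0; rewrite /val Aa add0r.
have [Ba|Ba] := eqVneq B.[a] 0.
  have /factor_theorem[B1 BE] : root B a by apply/eqP.
  have E : aff A B = (x - phi a) * aff A1 B1.
    by rewrite ?affE AE BE !rmorphM /= pevXsubC; ring.
  have AB10 : aff A1 B1 != 0 by apply: contraNneq AB0 => e; rewrite E e mulr0.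
  rewrite E; apply: decomposedM; first exact: decomposed_fibre.
  apply: IH => //; apply: leq_trans szN.
  have szM (C : {poly k}) : C != 0 -> size (C * ('X - a%:P)) = (size C).+1.
    by move=> C0; rewrite size_Mmonic ?monicXsubC // size_XsubC addn2.
  rewrite AE BE; have [A0|A0] := eqVneq A1 0.
    have B0 : B1 != 0 by apply: contraNneq AB10 => B0; rewrite A0 B0 -aff_pev rmorph0.
    by rewrite A0 mul0r szM // addnS.
  have [->|B0] := eqVneq B1 0; first by rewrite mul0r szM // addSn.
  by rewrite !szM // addSn addnS ltnW.
have b0 : b = 0 by apply/eqP; move/eqP: Bb; rewrite mulf_eq0 (negPf Ba).
have [G FE Ga] := ramified_fibre b0.
have G0 : pev G != 0 by apply/unit_at_neq0/unit_at_pev.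
have -> : aff A B = y / pev G * aff (B * G) A1.
  have xa : x - phi a = y ^+ 2 / pev G.
    by rewrite y2 FE rmorphM /= pevXsubC mulrAC mulfV // mul1r.
  by rewrite ?affE AE !rmorphM /= pevXsubC xa; field.
apply: decomposedM; last first.
  apply/decomposed_unit/unit_at_aff.
  by rewrite /val b0 mulr0 addr0 hornerM mulf_neq0.
apply: decomposedM; last exact/decomposed_unit/unit_atV/unit_at_pev.
exists 1, 1; rewrite mulr1 expr1z /param b0 eqxx; split=> //.
by rewrite -(rmorph1 pev); apply: unit_at_pev; rewrite hornerC oner_neq0.
Qed.

Lemma decomposed_all z : z != 0 -> decomposed z.
Proof.
move=> z0; have [A [B [C [C0 e]]]] := gen z.
have C0' : pev C != 0 by rewrite (pev_eq0 M).
rewrite -(mulfK C0' z) e; apply: decomposedM.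
  by apply: decomposed_aff; rewrite -e mulf_neq0.
exact/decomposedV/decomposed_pev.
Qed.

(** A negative power of the parameter times a unit is not regular: multiplying back
   and evaluating at the point would make the unit vanish. *)
Lemma aff_order A B (m : int) w : unit_at w -> aff A B = param ^ m * w -> 0 <= m.
Proof.
move=> [C [D [C' [D' [v v' e]]]]] E; case: m E => // m E.
have [T1 [T2 [tE tv]]] := param_aff.
have : exists U V, param ^+ m = aff U V.
  elim: (m) => [|m' [U [V e']]]; first by exists 1, 0; rewrite -aff_pev rmorph1.
  by rewrite exprS e' tE (affM M); do 2 eexists.
move=> [U [V UV]].
have E' : (aff A B * aff C' D') * (aff T1 T2 * aff U V) = aff C D.
  rewrite -UV -tE -exprS E -e NegzE -exprnN.
  by rewrite -mulrA mulrCA [RHS]mulrC; field; rewrite expf_neq0 ?param_neq0.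
move: E'; rewrite !(affM M) => /(aff_inj M)[eC eD].
by move: v; rewrite -eC -eD !valM tv mul0r mulr0 eqxx.
Qed.

Lemma decomposed_uniq (m m' : int) w w' : unit_at w -> unit_at w' ->
  param ^ m * w = param ^ m' * w' -> m = m'.
Proof.
suff H n n' u u' : unit_at u -> unit_at u' ->
    param ^ n * u = param ^ n' * u' -> n <= n' :> int.
  by move=> wu wu' e; apply/eqP; rewrite eq_le (H _ _ w w') // (H _ _ w' w).
move=> uu [A [B [A' [B' [v v' e]]]]] E.
have tu : u = param ^ (n' - n) * u'.
  by rewrite expfzDr ?param_neq0 // mulrAC -E mulrAC -expfzDr ?param_neq0 // addrN expr0z mul1r.
move: uu tu => [C [D [C' [D' [c c' e']]]]] tu.
rewrite -subr_ge0.
apply: (@aff_order (C * A' + D * B' * F) (C * B' + D * A') _ (aff A B * aff C' D')).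
  by apply: unit_atM; apply: unit_at_aff.
by rewrite -(affM M) -e -e' tu; ring.
Qed.

(** The exponent of the parameter is a valuation centered at the point. *)
Lemma place_at : exists P : place phi, centered P a b.
Proof.
have H z : exists m : int, (z = 0 /\ m = 0) \/
    (z != 0 /\ exists w, unit_at w /\ z = param ^ m * w).
  have [z0|z0] := eqVneq z 0; first by exists 0; left.
  by have [m mP] := decomposed_all z0; exists m; right.
have [o oP] := choice H.
have o0 : o 0 = 0 by case: (oP 0) => [[]//|[]]; rewrite eqxx.
have oE m w : unit_at w -> o (param ^ m * w) = m.
  move=> wu; case: (oP (param ^ m * w)) => [[/eqP]|[_ [w' [wu' e]]]].
    by rewrite mulf_eq0 (negPf (unit_at_neq0 wu)) orbF expfz_eq0 (negPf param_neq0) andbF.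
  exact: esym (decomposed_uniq wu wu' e).
have oM f g : f != 0 -> g != 0 -> o (f * g) = o f + o g.
  move=> f0 g0; have [m [w [wu fE]]] := decomposed_all f0.
  have [m' [w' [wu' gE]]] := decomposed_all g0.
  have -> : f * g = param ^ (m + m') * (w * w').
    by rewrite fE gE expfzDr ?param_neq0 //; ring.
  by rewrite fE gE !oE //; apply: unit_atM.
have oC c : o (phi c) = 0.
  have [->|c0] := eqVneq c 0; first by rewrite rmorph0.
  rewrite -(mul1r (phi c)) -(expr0z param) oE // -(pevC phi x).
  by apply: unit_at_pev; rewrite hornerC.
have oA f g : f != 0 -> g != 0 -> f + g != 0 -> Num.min (o f) (o g) <= o (f + g).
  wlog le : f g / o f <= o g.
    move=> W f0 g0 fg0; have [l|/ltW l] := leP (o f) (o g).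
      by have := W f g l f0 g0 fg0; rewrite (min_idPl l).
    by have := W g f l g0 f0; rewrite addrC (min_idPl l); apply.
  move=> f0 g0 fg0; rewrite (min_idPl le).
  have [m [w [wu fE]]] := decomposed_all f0.
  have [m' [w' [wu' gE]]] := decomposed_all g0.
  move: le; rewrite fE gE !oE // => le.
  have [j m'E] : exists j : nat, m' = m + j%:Z by exists `|m' - m|%N; lia.
  have [A [B [A' [B' [v v' e]]]]] := wu; have [C [E [C' [E' [u u' e']]]]] := wu'.
  have [T1 [T2 [tE _]]] := param_aff.
  have [U [V UV]] : exists U V, param ^+ j = aff U V.
    elim: (j) => [|j' [U [V UV]]]; first by exists 1, 0; rewrite -aff_pev rmorph1.
    by rewrite exprS UV tE (affM M); do 2 eexists.
  pose d := aff A' B' * aff C' E'.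
  have du : unit_at d by apply: unit_atM; apply: unit_at_aff.
  have [X [Y XY]] : exists X Y, (w + param ^+ j * w') * d = aff X Y.
    have -> : (w + param ^+ j * w') * d = (w * aff A' B') * aff C' E' +
        param ^+ j * ((w' * aff C' E') * aff A' B') by rewrite /d; ring.
    by rewrite e e' UV !(affM M) affD; do 2 eexists.
  have sE : param ^ m * w + param ^ m' * w' = param ^ m * (w + param ^+ j * w').
    by rewrite m'E expfzDr ?param_neq0 // -exprnP; ring.
  have s0 : w + param ^+ j * w' != 0.
    by apply: contraNneq fg0 => e0; rewrite fE gE sE e0 mulr0.
  have [i [r [ru rE]]] := decomposed_all s0.
  have i0 : 0 <= i.
    apply: (@aff_order X Y i (r * d)); first exact: unit_atM.
    by rewrite -XY rE -mulrA.
  rewrite sE rE mulrA -expfzDr ?param_neq0 // oE //.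
  by rewrite lerDl.
have oU : exists2 t, t != 0 & o t = 1.
  exists param; first exact: param_neq0.
  rewrite -[X in o X]mulr1 -{1}(expr1z param) oE //.
  by rewrite -(rmorph1 pev); apply: unit_at_pev; rewrite hornerC oner_neq0.
pose P := Place o0 oM oA oC oU.
have pos A B : val A B = 0 -> vanishing P (aff A B).
  move=> v; have [e|e] := eqVneq (aff A B) 0; first by rewrite e /vanishing eqxx.
  have [m [w [wu E]]] := decomposed_all e.
  rewrite /vanishing (negPf e) /= E oE // lt_neqAle (aff_order wu E) andbT.
  apply/eqP => m0; move: E; rewrite -m0 expr0z mul1r => E.
  move: wu => [C [B1 [C' [B' [u u' E']]]]]; move: E'; rewrite -E (affM M) => /(aff_inj M)[e1 e2].
  by move: u; rewrite -e1 -e2 valM v mul0r eqxx.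
exists P; apply/andP; split.
  by rewrite -pevXsubC (aff_pev phi x y); apply: pos; rewrite /val !hornerE subrr ?mul0r ?addr0.
rewrite (_ : y - phi b = aff (- b%:P) 1).
  by apply: pos; rewrite /val !hornerE ?mul1r addNr.
by rewrite ?affE rmorphN /= pevC rmorph1 mul1r addrC.
Qed.

Lemma centered_param P : centered P a b -> P param = 1.
Proof.
move=> c; have Pt : 0 < P param.
  move: c; rewrite /centered /vanishing.
  rewrite (negPf (x_neq_const a)) (negPf (y_neq_const b)) /= => /andP[].
  by rewrite /param; case: eqP => // ->; rewrite rmorph0 subr0.
have [s s0 Ps] := ord_uniformizer P.
have [m [w [wu sE]]] := decomposed_all s0; move: Ps.
rewrite sE ordM ?expfz_neq0 ?param_neq0 ?unit_at_neq0 // (centered_unit_at c wu).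
rewrite addr0 ordXz ?param_neq0 //; move: (P param) Pt => q q0 e.
by have [//|q2] : q = 1 \/ 2 <= q by [lia]; have [m0|m1] : m <= 0 \/ 1 <= m by [lia]; nia.
Qed.

Lemma centered_ord P (m : int) w : centered P a b -> unit_at w -> P (param ^ m * w) = m.
Proof.
move=> c wu; rewrite ordM ?expfz_neq0 ?param_neq0 ?unit_at_neq0 //.
by rewrite (centered_unit_at c wu) addr0 ordXz ?param_neq0 // centered_param // mulr1.
Qed.

Lemma centered_uniq P Q : centered P a b -> centered Q a b -> P = Q.
Proof.
move=> cP cQ; apply: place_ext => z.
have [->|z0] := eqVneq z 0; first by rewrite !Defs.ord0.
by have [m [w [wu ->]]] := decomposed_all z0; rewrite !centered_ord.
Qed.

Lemma centered_fibre P : centered P a b ->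
  P (x - phi a) = if b == 0 then 2 else 1.
Proof.
by move=> c; have [w wu ->] := fibre_param; rewrite exprnP centered_ord //; case: ifP.
Qed.

End At.

Lemma val_of_vanishing P a b A B : b ^+ 2 = F.[a] -> centered P a b ->
  vanishing P (aff A B) -> A.[a] + B.[a] * b = 0.
Proof.
move=> ab c v; apply/eqP; apply: contraLR v => v.
by rewrite /vanishing (centered_unit c v) ltxx orbF (aff_neq0 v).
Qed.

(** Over a the product of y - b and y + b vanishes. *)
Lemma centered_of_fibre P a b : b ^+ 2 = F.[a] -> vanishing P (x - phi a) ->
  centered P a b \/ centered P a (- b).
Proof.
move=> ab v; rewrite /centered v /= rmorphN opprK.
have : vanishing P ((y - phi b) * (y + phi b)).
  rewrite -subr_sqr y2 -rmorphXn ab; exact: vanishing_pev.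
have yi : integral P y.
  have xi : integral P x.
    by rewrite -(subrK (phi a) x) integralD ?integral_const // vanishingW.
  have := integral_pev F xi; rewrite -y2 /integral ordX ?(model_y_neq0 M) //; lia.
have y1 := y_neq_const b; have := y_neq_const (- b); rewrite rmorphN opprK => y2'.
rewrite /vanishing mulf_eq0 (negPf y1) (negPf y2') /= ordM //.
have i1 : integral P (y - phi b) by rewrite integralD ?integralN ?integral_const.
have i2 : integral P (y + phi b) by rewrite integralD ?integral_const.
move: i1 i2; rewrite /integral.
by move: (P (y - phi b)) (P (y + phi b)) => i j; clear; lia.
Qed.

Lemma sqrt_exists (c : k) : exists b : k, b ^+ 2 = c.
Proof.
have /closed_rootP[b] : size ('X^2 - c%:P : {poly k}) != 1%N.
  by rewrite size_polyDl ?size_polyXn // size_polyN size_polyC; case: (c != 0).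
by rewrite rootE !hornerE subr_eq0 => /eqP; exists b.
Qed.

(** If no x - a vanishes at P, every nonzero polynomial in x has order 0 at P, hence,
   taking norms, so has every function; but P has a uniformizer. *)
Lemma finite_place P : integral P x -> exists a, vanishing P (x - phi a).
Proof.
move=> xi; apply: contrapT => none.
have P0 a : P (x - phi a) = 0.
  have : integral P (x - phi a) by rewrite integralD ?integralN ?integral_const.
  rewrite /integral => i; apply/eqP; apply: contrapT => n; apply: none; exists a.
  by rewrite /vanishing orbC lt_neqAle i andbT eq_sym; move/negP: n => ->.
have Ppev A : A != 0 -> P (pev A) = 0.
  move=> A0; have [r ->] := closed_field_poly_normal A.
  have l0 : lead_coef A != 0 by rewrite lead_coef_eq0.
  rewrite -mul_polyC rmorphM /= pevC ordM ?fmorph_eq0 //; last first.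
    by rewrite (pev_eq0 M) monic_neq0 ?monic_prod_XsubC.
  rewrite ord_const add0r; elim: r => [|a r IH]; first by rewrite big_nil rmorph1 place1.
  rewrite big_cons rmorphM /= pevXsubC ordM ?x_neq_const ?P0 ?IH //.
  by rewrite (pev_eq0 M) monic_neq0 ?monic_prod_XsubC.
have [s s0 Ps] := ord_uniformizer P.
have [A [B [C [C0 e]]]] := gen s.
have C0' : pev C != 0 by rewrite (pev_eq0 M).
have AB0 : aff A B != 0 by rewrite -e mulf_neq0.
have AB0' : aff A (- B) != 0.
  apply: contraNneq AB0 => /(aff_eq0 M)[-> /eqP]; rewrite oppr_eq0 => /eqP->.
  by rewrite -aff_pev rmorph0.
have := Ppev (A ^+ 2 - B ^+ 2 * F); rewrite -(pev_eq0 M) -(aff_norm M).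
rewrite mulf_neq0 // => /(_ isT); rewrite ordM // -e ordM // Ps Ppev //.
have yi : integral P y.
  have := integral_pev F xi; rewrite -y2 /integral ordX ?(model_y_neq0 M) //; lia.
by have := integral_aff A (- B) xi yi; rewrite /integral; lia.
Qed.

Lemma centered_opp P a b : b != 0 -> centered P a b -> ~~ centered P a (- b).
Proof.
move=> b0 /andP[_ v]; apply/negP => /andP[_ v'].
have : vanishing P ((y - phi (- b)) - (y - phi b)).
  by rewrite vanishingD ?vanishingN.
have -> : y - phi (- b) - (y - phi b) = phi (2%:R * b).
  by rewrite rmorphN rmorphM rmorph_nat /=; ring.
by rewrite vanishing_const mulf_eq0 (negPf two_neq0) (negPf b0).
Qed.

(** Over a there are two points, or one where x - a has order 2. *)
Lemma fibre_divisor a : exists D : {freeg (place phi)}, deg D = 2 /\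
  forall P, coeff P D = Num.max 0 (P (x - phi a)).
Proof.
have [b ab] := sqrt_exists F.[a].
have ab' : (- b) ^+ 2 = F.[a] by rewrite sqrrN.
have [P1 c1] := place_at ab.
have fib P : ~~ vanishing P (x - phi a) -> Num.max 0 (P (x - phi a)) = 0.
  by rewrite /vanishing (negPf (x_neq_const a)) -leNgt => /max_idPl.
have [b0|b0] := eqVneq b 0.
  exists << (2 : int) *g P1 >>; split=> [|P]; first by rewrite degU.
  rewrite coeffU; have [e|ne] := eqVneq P1 P.
    by rewrite -e mulr1 (centered_fibre ab c1) b0 eqxx.
  rewrite mulr0 fib //; apply: contra_neqN ne => v.
  have c : centered P a b by case: (centered_of_fibre ab v); rewrite // b0 oppr0.
  exact: (centered_uniq ab c1 c).
have [P2 c2] := place_at ab'.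
have P12 : P1 != P2.
  by apply: contraTneq c2 => <-; apply: centered_opp.
exists (<< P1 >> + << P2 >>); split=> [|P]; first by rewrite degD !degU.
rewrite coeffD !coeffU !mul1r.
have [e|n1] := eqVneq P1 P.
  rewrite -e eq_sym (negPf P12) addr0 (centered_fibre ab c1) (negPf b0).
  by [].
have [e|n2] := eqVneq P2 P.
  rewrite -e add0r (centered_fibre ab' c2) oppr_eq0 (negPf b0).
  by [].
rewrite fib ?addr0 //; apply/negP => v.
have [c|c] := centered_of_fibre ab v.
  by move: n1; rewrite (centered_uniq ab c1 c) eqxx.
by move: n2; rewrite (centered_uniq ab' c2 c) eqxx.
Qed.

(** When x - a divides the denominator, the numerator A(x) + B(x) y vanishes at all
   points over a, to order 2 if there is only one, and so x - a divides A and B. *)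
Lemma integral_closure z : (forall P, integral P x -> integral P z) ->
  exists A B, z = aff A B.
Proof.
move=> zi; have [A [B [C [C0 e]]]] := gen z.
have [N] := ubnP (size C); elim: N => // N IH in A B C C0 e *; rewrite ltnS => sC.
have [s1|s1] := eqVneq (size C) 1%N.
  have /eqP/size_poly1P[c c0 CE] := s1.
  exists (c^-1%:P * A), (c^-1%:P * B).
  have c0' : phi c != 0 by rewrite fmorph_eq0.
  rewrite -(mulfK c0' z) -(pevC phi x) -CE e CE pevC ?affE !rmorphM /= pevC fmorphV.
  by ring.
have /closed_rootP[a Ca] := s1; have /factor_theorem[C1 CE] := Ca.
have C10 : C1 != 0 by apply: contraNneq C0 => C1z; rewrite CE C1z mul0r.
have [b ab] := sqrt_exists F.[a].
have ab' : (- b) ^+ 2 = F.[a] by rewrite sqrrN.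
have [P1 c1] := place_at ab; have [P2 c2] := place_at ab'.
have xint P c d : centered P c d -> integral P x.
  by move=> /andP[v _]; rewrite -(subrK (phi c) x) integralD ?integral_const // vanishingW.
pose w := z * pev C1.
have wE : w * (x - phi a) = aff A B.
  by rewrite -e CE rmorphM /= pevXsubC mulrA.
have wi P c d : centered P c d -> integral P w.
  by move=> cc; rewrite integralM ?zi ?integral_pev // (xint _ _ _ cc).
have van P d : centered P a d -> vanishing P (aff A B).
  by move=> cc; rewrite -wE vanishingM ?(wi _ _ _ cc) //; case/andP: cc.
have v1 := val_of_vanishing ab c1 (van _ _ c1).
have v2 := val_of_vanishing ab' c2 (van _ _ c2).
have Aa : A.[a] = 0.
  apply/eqP; rewrite -(mulrI_eq0 _ (mulfI two_neq0)); apply/eqP.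
  by rewrite -[RHS](addr0 0) -{1}v1 -v2; ring.
have /factor_theorem[A1 AE] : root A a by apply/eqP.
have Ba : B.[a] = 0.
  have [b0|b0] := eqVneq b 0; last first.
    by apply/eqP; move/eqP: v1; rewrite Aa add0r mulf_eq0 (negPf b0) orbF.
  have [G FE Ga] := ramified_fibre ab b0.
  have Gu : unit_at a b (pev G) by apply: unit_at_pev.
  have G0 := unit_at_neq0 Gu.
  have : vanishing P1 ((w - pev A1) * (pev G)^-1 * y).
    apply: vanishingM; last first.
      by case/andP: c1 => _; rewrite b0 rmorph0 subr0.
    apply: integralM; last by rewrite /integral (centered_unit_at c1) //; apply: unit_atV.
    by rewrite integralD ?integralN ?(wi _ _ _ c1) // integral_pev // (xint _ _ _ c1).
  have -> : (w - pev A1) * (pev G)^-1 * y = aff B 0.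
    apply: (mulIf (model_y_neq0 M)).
    transitivity ((w - pev A1) * (y ^+ 2 / pev G)); first by field.
    rewrite y2 FE rmorphM /= pevXsubC mulrAC mulfV // mul1r mulrBl wE AE.
    by rewrite -aff_pev ?affE rmorphM /= pevXsubC; ring.
  by move=> /(val_of_vanishing ab c1); rewrite horner0 mul0r addr0.
have /factor_theorem[B1 BE] : root B a by apply/eqP.
apply: (IH A1 B1 C1 C10).
  apply: (mulIf (x_neq_const a)); rewrite -/w wE AE BE ?affE !rmorphM /= pevXsubC.
  by ring.
by move: sC; rewrite CE size_Mmonic ?monicXsubC // size_XsubC addn2.
Qed.

(** ** The vector field y d/dx and logarithmic derivatives *)
Section VectorField.
Variable D : K -> K.
Hypothesis derD : derivation D.
Hypothesis Dpev : forall A, D (pev A) = pev A^`().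
Hypothesis Dy : D y = pev F^`() / (2%:R * y).

Let K2 : 2%:R != 0 :> K.
Proof. by rewrite -(rmorph_nat phi) fmorph_eq0. Qed.

Let yDy : y * D y = pev (2%:R^-1%:P * F^`()).
Proof.
rewrite Dy rmorphM /= pevC fmorphV rmorph_nat; field.
by rewrite K2 (model_y_neq0 M).
Qed.

(** Because y dy/dx = F'(x) / 2. *)
Lemma vfield_aff A B : exists A' B', y * D (aff A B) = aff A' B'.
Proof.
exists (B^`() * F + B * (2%:R^-1%:P * F^`())), A^`().
have -> : aff (B^`() * F + B * (2%:R^-1%:P * F^`())) A^`() =
    pev B^`() * y ^+ 2 + pev B * (y * D y) + pev A^`() * y.
  by rewrite yDy y2 ?affE rmorphD /= (rmorphM _ B) (rmorphM _ B^`()).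
by rewrite ?affE (der_add derD) (der_mul derD) !Dpev; ring.
Qed.

Lemma log_der_mul f g : f != 0 -> g != 0 -> D (f * g) / (f * g) = D f / f + D g / g.
Proof. by move=> f0 g0; rewrite (der_mul derD); field; rewrite f0 g0. Qed.

Lemma log_der_expz f (m : int) : f != 0 -> D (f ^ m) / f ^ m = m%:~R * (D f / f).
Proof.
move=> f0; have H n : D (f ^+ n) / f ^+ n = n%:R * (D f / f).
  elim: n => [|n IH]; first by rewrite (der1 derD) mul0r mul0r.
  by rewrite exprS log_der_mul ?expf_neq0 // IH -nat1r; ring.
case: m => m; first by rewrite -exprnP H.
rewrite NegzE -exprnN (der_inv derD) ?expf_neq0 // mulrNz [RHS]mulNr -pmulrn -H.
by move: (f ^+ m.+1) (expf_neq0 m.+1 f0) => u u0; field; rewrite u0 oner_neq0.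
Qed.

Lemma log_vfield_unit P a b w : centered P a b -> unit_at a b w ->
  integral P (y * (D w / w)).
Proof.
move=> c wu; have w0 := unit_at_neq0 wu.
have [A [B [A' [B' [v v' e]]]]] := wu.
have H U V : U.[a] + V.[a] * b != 0 -> integral P (y * (D (aff U V) / aff U V)).
  move=> u; rewrite mulrA; have [U' [V' ->]] := vfield_aff U V.
  apply: integralM; first exact: (centered_integral _ _ c).
  by rewrite /integral placeV ?(aff_neq0 u) // (centered_unit c u) oppr0.
have -> : y * (D w / w) = y * (D (aff A B) / aff A B) - y * (D (aff A' B') / aff A' B').
  by rewrite -e log_der_mul ?(aff_neq0 v') //; ring.
by rewrite integralD ?integralN ?H.
Qed.

(** The vector field y d/dx vanishes nowhere on the affine curve. *)
Lemma log_vfield_param P a b : b ^+ 2 = F.[a] -> centered P a b ->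
  D (param a b) != 0 /\ P (y * (D (param a b) / param a b)) = -1.
Proof.
move=> ab c; have t0 := param_neq0 a b; have y0 := model_y_neq0 M.
have : P (y * D (param a b)) = 0 /\ y * D (param a b) != 0.
  rewrite /param; case: eqP => [b0|/eqP b0].
    have u : unit_at a b (pev (2%:R^-1%:P * F^`())).
      apply: unit_at_pev; rewrite hornerM hornerC mulf_neq0 ?invr_eq0 //.
      by apply: (model_smooth M); rewrite -ab b0 expr0n.
    by rewrite yDy (unit_at_neq0 u) (centered_unit_at c u).
  have u : unit_at a b y.
    by rewrite {1}(aff_y phi x y); apply: unit_at_aff; rewrite horner0 hornerC mul1r add0r.
  rewrite -pevXsubC Dpev derivXsubC rmorph1 mulr1.
  by rewrite (unit_at_neq0 u) (centered_unit_at c u).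
move=> [Py yD0]; split; first by apply: contraNneq yD0 => ->; rewrite mulr0.
by rewrite mulrA ordM ?invr_eq0 // Py add0r placeV // (centered_param ab c).
Qed.

(** In characteristic p, the form dx / y has neither zeros nor poles on the
   affine curve, and df / f has at most simple poles, with residue ord f. *)
Lemma log_vfield_integral P f : integral P x -> f != 0 ->
  integral P (y * (D f / f)) <-> (P f)%:~R = 0 :> k.
Proof.
move=> xi f0; have [a v] := finite_place xi.
have [b0 ab0] := sqrt_exists F.[a].
have [b ab c] : exists2 b, b ^+ 2 = F.[a] & centered P a b.
  by have [c|c] := centered_of_fibre ab0 v; [exists b0|exists (- b0)]; rewrite ?sqrrN.
have [m [w [wu fE]]] := decomposed_all ab f0.
have [Dt0 Pt] := log_vfield_param ab c.
have t0 := param_neq0 a b; have w0 := unit_at_neq0 wu.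
have mE : P f = m by rewrite fE (centered_ord ab m c wu).
have -> : y * (D f / f) = m%:~R * (y * (D (param a b) / param a b)) + y * (D w / w).
  by rewrite fE log_der_mul ?expfz_neq0 // log_der_expz //; ring.
rewrite mE; have wi := log_vfield_unit c wu; split=> [i|m0]; last first.
  by rewrite -(rmorph_int phi) m0 rmorph0 mul0r add0r.
apply/eqP; apply: contraT => m0.
have : integral P (m%:~R * (y * (D (param a b) / param a b))).
  by rewrite -[X in integral P X](addrK (y * (D w / w))) integralD ?integralN.
rewrite /integral -(rmorph_int phi) ordM ?fmorph_eq0 //.
  by rewrite ord_const Pt.
by rewrite !mulf_neq0 ?invr_eq0 ?(model_y_neq0 M).
Qed.

End VectorField.
End Point.

(** * The curve y^2 = x^n + 1 *)

Section Misc.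
Variables (k K : fieldType) (phi : {rmorphism k -> K}).

Lemma ord_add_lt (P : place phi) f g : f != 0 -> g != 0 -> P f < P g -> P (f + g) = P f.
Proof.
move=> f0 g0 lt; have fg0 : f + g != 0.
  by apply: contraTneq lt => /eqP; rewrite addr_eq0 => /eqP->; rewrite ordN ltxx.
have l1 := ordD P f0 g0 fg0.
have := @ordD _ _ _ P (f + g) (- g) fg0; rewrite oppr_eq0 addrK ordN => /(_ g0 f0).
by move: l1 lt; move: (P f) (P g) (P (f + g)) => i j l; clear; lia.
Qed.

Lemma ord_pev_pole (P : place phi) x A : P x < 0 -> A != 0 ->
  P (pev phi x A) = (size A).-1%:Z * P x.
Proof.
move=> Px; have x0 : x != 0 by apply: contraTneq Px => ->; rewrite Defs.ord0 ltxx.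
elim/poly_ind: A => [|A c IH]; first by rewrite eqxx.
have [->|A0] := eqVneq A 0.
  rewrite mul0r add0r polyC_eq0 => c0.
  by rewrite pevC ord_const size_polyC c0 mul0r.
move=> _; rewrite rmorphD rmorphM /= pevX pevC size_MXaddC (negPf A0) /=.
have sA : (0 < size A)%N by rewrite size_poly_gt0.
have A0' : pev phi x A != 0.
  apply/eqP => e; move: (IH A0); rewrite e Defs.ord0 => /esym/eqP.
  rewrite mulf_eq0 (lt_eqF Px) orbF => /eqP s1.
  have /eqP/size_poly1P[d d0 AE] : size A = 1%N by lia.
  by move/eqP: e; rewrite AE pevC fmorph_eq0 (negPf d0).
have PA : P (pev phi x A * x) = (size A)%:Z * P x.
  by rewrite ordM // IH //; case: (size A) sA => // m _ /=; rewrite intS; ring.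
have [->|c0] := eqVneq c 0; first by rewrite rmorph0 addr0.
rewrite ord_add_lt ?mulf_neq0 ?fmorph_eq0 // PA ord_const.
by rewrite nmulr_llt0 // ltz_nat.
Qed.

Lemma der_pev (D : K -> K) t A : derivation D -> (forall c, D (phi c) = 0) ->
  D (pev phi t A) = pev phi t A^`() * D t.
Proof.
move=> dD Dc; elim/poly_ind: A => [|A c IH].
  by rewrite deriv0 !rmorph0 mul0r (der0 dD).
rewrite derivD derivM derivX derivC addr0 mulr1 !rmorphD !rmorphM /= pevX pevC.
by rewrite (der_add dD) (der_mul dD) IH Dc; ring.
Qed.

Lemma conj_place (s : {rmorphism K -> K}) (P : place phi) :
  (forall c, s (phi c) = phi c) -> involutive s ->
  exists Q : place phi, forall z, Q z = P (s z).
Proof.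
move=> sc ss.
have o0 : P (s 0) = 0 by rewrite rmorph0 Defs.ord0.
have oM f g : f != 0 -> g != 0 -> P (s (f * g)) = P (s f) + P (s g).
  by move=> f0 g0; rewrite rmorphM ordM ?fmorph_eq0.
have oD f g : f != 0 -> g != 0 -> f + g != 0 ->
    Num.min (P (s f)) (P (s g)) <= P (s (f + g)).
  by move=> f0 g0 fg0; rewrite rmorphD ordD -?rmorphD ?fmorph_eq0.
have oC c : P (s (phi c)) = 0 by rewrite sc ord_const.
have oU : exists2 t, t != 0 & P (s t) = 1.
  by have [t t0 Pt] := ord_uniformizer P; exists (s t); rewrite ?fmorph_eq0 // ss.
by exists (Place o0 oM oD oC oU).
Qed.

End Misc.

Definition genus n := (n.-1)./2.

Lemma genusE n : (0 < n)%N -> n = ((genus n).+1.*2 - odd n)%N.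
Proof.
rewrite /genus; case: n => // m _ /=; rewrite -{1}(odd_double_half m).
by case: (odd m) => /=; lia.
Qed.

Section Curve.
Variables (k : closedFieldType) (K : fieldType) (phi : {rmorphism k -> K}).
Variables (n : nat) (x y : K).
Hypothesis n0 : (0 < n)%N.
Hypotheses (two_neq0 : 2%:R != 0 :> k) (n_neq0 : n%:R != 0 :> k).
Hypothesis C : function_field_C phi n x y.
Implicit Types P Q : place phi.

Local Notation g := (genus n).

Definition affine_poly : {poly k} := 'X^n + 1.
(** In the coordinates 1/x and y / x^(g+1) the curve has another smooth affine model,
   whose points over 0 are the points at infinity. *)
Definition infinity_poly : {poly k} :=
  if odd n then 'X^(n.+1) + 'X else 'X^n + 1.

Local Notation X := (x^-1).
Local Notation Y := (y / x ^+ g.+1).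

Lemma transc_pev t : ~ algebraicOver phi t -> forall A, pev phi t A = 0 -> A = 0.
Proof.
move=> nt A e; apply: contrapT => A0; apply: nt; exists A; first exact/eqP.
by rewrite rootE; apply/eqP.
Qed.

Lemma x_neq0 : x != 0.
Proof.
apply/eqP => x0; apply: (C_transcendental C); rewrite x0; exact: algebraic0.
Qed.

Lemma affine_poly_size : size affine_poly = n.+1.
Proof. by rewrite size_polyDl size_polyXn // size_poly1 ltnS. Qed.

Lemma affine_poly_root : exists a, affine_poly.[a] = 0.
Proof.
have /closed_rootP[a /eqP Fa] : size affine_poly != 1%N.
  by rewrite affine_poly_size eqSS -lt0n.
by exists a.
Qed.

Lemma affine_poly_smooth a : affine_poly.[a] = 0 -> affine_poly^`().[a] != 0.
Proof.
rewrite /affine_poly derivD derivXn -[1]/(1%:P) derivC addr0 !hornerE hornerMn hornerXn.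
move=> /eqP; rewrite addr_eq0 => /eqP an; rewrite -mulr_natr mulf_neq0 //.
rewrite expf_neq0 //; apply: contra_eqN an => /eqP->.
by rewrite expr0n eqn0Ngt n0 eq_sym oppr_eq0 oner_neq0.
Qed.

Lemma affine_model : model phi affine_poly x y.
Proof.
split.
- exact: transc_pev (C_transcendental C).
- by rewrite (C_equation C) rmorphD rmorphXn /= pevX rmorph1.
- exact: affine_poly_smooth.
- exact: affine_poly_root.
Qed.

Lemma affine_gen z : exists A B E, fracrep phi x y z A B E.
Proof.
apply: (fracrep_gen affine_model (C_generated C)).
  by exists 'X, 0, 1; split; rewrite ?oner_neq0 // rmorph1 mulr1 -aff_pev pevX.
exists 0, 1, 1; split; rewrite ?oner_neq0 // rmorph1 mulr1.
exact: aff_y.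
Qed.

Lemma infinity_model : model phi infinity_poly X Y.
Proof.
have x0 := x_neq0.
split.
- apply: transc_pev => /algebraic_inv; rewrite invrK; exact: (C_transcendental C).
- rewrite expr_div_n (C_equation C) -exprM muln2 /infinity_poly.
  have := genusE n0; case: (odd n) => nE.
    have -> : g.+1.*2 = n.+1 by lia.
    rewrite rmorphD rmorphXn /= pevX !exprS exprVn; field.
    by rewrite x0 expf_neq0.
  have -> : g.+1.*2 = n by lia.
  rewrite rmorphD rmorphXn /= pevX rmorph1 exprVn; field.
  by rewrite expf_neq0.
- rewrite /infinity_poly; case: (odd n); last exact: affine_poly_smooth.
  move=> a; rewrite derivD derivXn derivX !hornerE hornerMn hornerXn /= => Fa.
  have [a0|a0] := eqVneq a 0.
    by rewrite a0 expr0n eqn0Ngt n0 mul0rn add0r oner_neq0.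
  have an : a ^+ n = - 1.
    apply/eqP; rewrite -addr_eq0 -(mulrI_eq0 _ (mulfI a0)) mulrDr -exprS mulr1.
    exact/eqP.
  by rewrite an mulrSr mulNrn addrNK oppr_eq0.
- rewrite /infinity_poly; case: (odd n); last exact: affine_poly_root.
  by exists 0; rewrite !hornerE expr0n.
Qed.

Lemma infinity_gen z : exists A B E, fracrep phi X Y z A B E.
Proof.
have x0 := x_neq0.
apply: (fracrep_gen infinity_model (C_generated C)).
  exists 1, 0, 'X; split; rewrite ?polyX_eq0 // pevX mulfV //.
  by rewrite -aff_pev rmorph1.
exists 0, 1, 'X^(g.+1); split; first by rewrite expf_neq0 ?polyX_eq0.
by rewrite -aff_y rmorphXn /= pevX exprVn.
Qed.

Lemma place_cover P : integral P x \/ integral P X.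
Proof. by rewrite /integral placeV ?x_neq0 // oppr_ge0; apply/orP/le_total. Qed.

Lemma infinite_place : exists P, P x < 0.
Proof.
have [b ab] := sqrt_exists infinity_poly.[0].
have [P c] := place_at infinity_model two_neq0 infinity_gen ab.
exists P; case/andP: c => + _; rewrite rmorph0 subr0 /vanishing invr_eq0 (negPf x_neq0) /=.
by rewrite placeV ?x_neq0 // oppr_gt0.
Qed.

Lemma curve_involution : exists s : {rmorphism K -> K},
  [/\ forall A, s (pev phi x A) = pev phi x A, s y = - y, involutive s &
      forall P, exists Q, forall z, Q z = P (s z)].
Proof.
have [s [sA sy]] := involution_exists affine_model affine_gen.
have ss : involutive s.
  move=> z; have [A [B [E [E0 e]]]] := affine_gen z.
  have E0' : pev phi x E != 0 by rewrite (pev_eq0 affine_model).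
  apply: (mulIf E0'); rewrite e -{1}(sA E) -{1}(sA E) -!rmorphM /= e.
  by rewrite /aff !rmorphD !rmorphM /= sy !sA rmorphN sy opprK.
exists s; split=> // P; apply: conj_place ss => c.
by rewrite -(pevC phi x) sA.
Qed.

(** The sum 2 A(x) and the difference 2 B(x) y of w = A(x) + B(x) y and its conjugate
   have no larger poles than x^(d-1). If B is not 0, then B(x) y has a larger one,
   since y^2 has n times the poles of x. *)
Lemma bounded_pole w d : (d.*2 < n.+2)%N -> w != 0 ->
  (forall P, integral P x -> integral P w) ->
  (forall P, P x < 0 -> (d%:Z - 1) * P x <= P w) ->
  exists2 A : {poly k}, (size A <= d)%N & w = pev phi x A.
Proof.
move=> dn w0 wi wp.
have [A [B wE]] := integral_closure affine_model two_neq0 affine_gen wi.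
have [s [sA sy ss conj]] := curve_involution.
have [P Px] := infinite_place; have [Q QE] := conj P.
have Qx : Q x < 0 by rewrite QE -(pevX phi x) sA pevX.
have sw : s w = aff phi x y A (- B).
  by rewrite wE /aff rmorphD rmorphM /= sy !sA rmorphN; ring.
have Pw := wp P Px.
have Psw : (d%:Z - 1) * P x <= P (s w).
  by have := wp Q Qx; rewrite !QE -{1}(pevX phi x) sA pevX.
have sw0 : s w != 0 by rewrite fmorph_eq0.
have K2 : phi 2%:R != 0 by rewrite fmorph_eq0.
have y0 := model_y_neq0 affine_model.
have bound z z' : z != 0 -> w + z != 0 -> P z = P (s w) -> w + z = phi 2%:R * z' ->
    (d%:Z - 1) * P x <= P z'.
  move=> z0 wz0 Pz e; have := ordD P w0 z0 wz0.
  have z'0 : z' != 0 by apply: contraNneq wz0 => z'0; rewrite e z'0 mulr0.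
  rewrite e ordM // ord_const add0r Pz; apply: le_trans.
  by rewrite le_min Pw Psw.
have Py : 2 * P y = n%:Z * P x.
  rewrite -[2]/(2%:Z) -ordX // (model_eq affine_model) ord_pev_pole //.
    by rewrite affine_poly_size.
  by rewrite -size_poly_gt0 affine_poly_size.
have B0 : B = 0.
  apply: contrapT => /eqP B0.
  have B0' : pev phi x B != 0 by rewrite (pev_eq0 affine_model).
  have := @bound (- s w) (pev phi x B * y).
  rewrite oppr_eq0 ordN => /(_ sw0).
  have e : w - s w = phi 2%:R * (pev phi x B * y).
    by rewrite sw wE /aff rmorphN rmorph_nat /=; ring.
  rewrite e mulf_neq0 ?mulf_neq0 // => /(_ isT erefl erefl).
  rewrite ordM // ord_pev_pole //; move: (size B).-1 => m.
  by move: (P y) (P x) Px Py dn => i j; clear; nia.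
have wA : w = pev phi x A by rewrite wE B0 -aff_pev.
exists A => //; have A0 : A != 0 by rewrite -(pev_eq0 affine_model) -wA.
have := wp P Px; rewrite wA ord_pev_pole // ler_nM2r //.
have : (0 < size A)%N by rewrite size_poly_gt0.
by case: (size A) => [|m] //= _; clear; lia.
Qed.

(** Such a function is bounded at infinity, hence a polynomial in x of degree 0. *)
Lemma ord_zero_const f : f != 0 -> (forall P, P f = 0) -> exists c, f = phi c.
Proof.
move=> f0 Pf; have [//|P _|P _|A sA ->] := @bounded_pole f 1 _ f0.
- by rewrite /integral Pf.
- by rewrite subrr mul0r Pf.
by exists A`_0; rewrite (size1_polyC sA) pevC coefC.
Qed.

(** ** Principal divisors have degree 0 *)

Definition has_divisor (f : K) := exists D : {freeg (place phi)}, deg D = 0 /\ is_div f D.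

Lemma has_divisorM f h : f != 0 -> h != 0 -> has_divisor f -> has_divisor h ->
  has_divisor (f * h).
Proof.
move=> f0 h0 [D [dD fD]] [E [dE hE]]; exists (D + E); split; first by rewrite degD dD dE.
by move=> P; rewrite coeffD fD hE ordM.
Qed.

Lemma has_divisorV f : f != 0 -> has_divisor f -> has_divisor f^-1.
Proof.
move=> f0 [D [dD fD]]; exists (- D); split; first by rewrite degN dD oppr0.
by move=> P; rewrite coeffN fD placeV.
Qed.

(** The zeros of 1/x on the model at infinity. *)
Lemma pole_divisor : exists D : {freeg (place phi)}, deg D = 2 /\
  forall P, coeff P D = Num.max 0 (- P x).
Proof.
have [D [dD DE]] := fibre_divisor infinity_model two_neq0 infinity_gen 0.
by exists D; split=> // P; rewrite DE rmorph0 subr0 placeV // x_neq0.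
Qed.

Lemma has_divisor_fibre a : has_divisor (x - phi a).
Proof.
have [D [dD DE]] := fibre_divisor affine_model two_neq0 affine_gen a.
have [E [dE EE]] := pole_divisor.
exists (D - E); split=> [|P]; first by rewrite degB dD dE subrr.
rewrite coeffB DE EE.
have xa := x_neq_const affine_model a.
have [Px|Px] := ltP (P x) 0.
  have -> : P (x - phi a) = P x.
    have [->|a0] := eqVneq a 0; first by rewrite rmorph0 subr0.
    by rewrite ord_add_lt ?oppr_eq0 ?fmorph_eq0 ?x_neq0 // ordN ord_const.
  by move: (P x) Px => i; clear; lia.
have : integral P (x - phi a) by rewrite integralD ?integralN ?integral_const.
by rewrite /integral; move: (P x) (P (x - phi a)) Px => i j; clear; lia.
Qed.

Lemma has_divisor_pev A : A != 0 -> has_divisor (pev phi x A).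
Proof.
move=> A0; have [r ->] := closed_field_poly_normal A.
have l0 : lead_coef A != 0 by rewrite lead_coef_eq0.
have r0 s : pev phi x (\prod_(z <- s) ('X - z%:P)) != 0.
  by rewrite (pev_eq0 affine_model) monic_neq0 ?monic_prod_XsubC.
rewrite -mul_polyC rmorphM /= pevC; apply: has_divisorM; rewrite ?fmorph_eq0 //.
  by exists 0; split=> [|P]; rewrite ?deg0 // coeff0 ord_const.
elim: r => [|a r IH].
  by rewrite big_nil rmorph1; exists 0; split=> [|P]; rewrite ?deg0 // coeff0 place1.
rewrite big_cons rmorphM /= pevXsubC; apply: has_divisorM => //.
  exact: (x_neq_const affine_model).
exact: has_divisor_fibre.
Qed.

Lemma coeff_sum_place (S : seq (place phi)) (f : place phi -> int) Q : uniq S ->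
  coeff Q (\sum_(P <- S) << f P *g P >>) = if Q \in S then f Q else 0.
Proof.
move=> uS; rewrite raddf_sum /=; under eq_bigr do rewrite coeffU.
case: ifP => QS.
  rewrite (bigD1_seq Q) //= eqxx mulr1 big1 ?addr0 // => P /negPf->.
  by rewrite mulr0.
rewrite big_seq big1 // => P PS; case: eqP => [e|_]; last by rewrite mulr0.
by rewrite e QS in PS.
Qed.

Lemma deg_sum_place (S : seq (place phi)) (f : place phi -> int) :
  deg (\sum_(P <- S) << f P *g P >>) = \sum_(P <- S) f P.
Proof. by rewrite raddf_sum /=; apply: eq_bigr => P _; rewrite degU. Qed.

(** The involution turns the divisor of f into that of its conjugate without
   changing the degree, and the product of the two lies in k(x). *)
Lemma has_divisor_aff A B : aff phi x y A B != 0 -> has_divisor (aff phi x y A B).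
Proof.
set f := aff phi x y A B => f0.
have [s [sA sy ss conj]] := curve_involution.
have [c cE] := choice conj.
have cK : involutive c by move=> P; apply: place_ext => z; rewrite !cE ss.
have sf : s f = aff phi x y A (- B).
  by rewrite /f /aff rmorphD rmorphM /= sy !sA rmorphN; ring.
have sf0 : s f != 0 by rewrite fmorph_eq0.
have [D [dD DE]] : has_divisor (f * s f).
  rewrite sf (aff_norm affine_model); apply: has_divisor_pev.
  by rewrite -(pev_eq0 affine_model) -(aff_norm affine_model) -sf mulf_neq0.
have [E [_ EE]] := pole_divisor.
have [S0 S0E] : exists S0, S0 = dom D ++ dom E by exists (dom D ++ dom E).
pose S := undup (S0 ++ map c S0).
have uS : uniq S by apply: undup_uniq.
have mc P (r : seq (place phi)) : (P \in map c r) = (c P \in r).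
  by rewrite -{1}(cK P) mem_map //; apply: inv_inj.
have cS P : (c P \in S) = (P \in S).
  by rewrite !mem_undup !mem_cat !mc cK orbC.
have suppS P : P \notin S -> P f = 0.
  rewrite mem_undup mem_cat negb_or S0E mem_cat negb_or => /andP[/andP[nD nE] _].
  have : P f + P (s f) = 0 by rewrite -ordM // -DE coeff_outdom.
  have := coeff_outdom nE; rewrite EE => Px.
  have xi : integral P x.
    by move: Px; rewrite /integral; move: (P x) => i; clear; lia.
  have yi : integral P y.
    have := integral_pev (affine_poly) xi.
    rewrite -(model_eq affine_model) /integral ordX ?(model_y_neq0 affine_model) //.
    by move: (P y) => i; clear; lia.
  have := integral_aff A (- B) xi yi; rewrite -sf.
  have := integral_aff A B xi yi; rewrite -/f /integral.
  by move: (P f) (P (s f)) => i j; clear; lia.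
pose Df := \sum_(P <- S) << P f *g P >>.
pose Dsf := \sum_(P <- S) << P (s f) *g P >>.
have DfE Q : coeff Q Df = Q f.
  by rewrite coeff_sum_place //; case: ifPn => // /suppS.
have DsfE Q : coeff Q Dsf = Q (s f).
  rewrite coeff_sum_place //; case: ifPn => //; rewrite -cS => /suppS.
  by rewrite cE.
have DD : Df + Dsf = D.
  by apply/eqP/freeg_eqP => Q; rewrite coeffD DfE DsfE DE ordM.
have dE : deg Dsf = deg Df.
  rewrite !deg_sum_place.
  rewrite [RHS](perm_big (map c S)) /=; last first.
    apply: uniq_perm => //; first by rewrite map_inj_uniq //; exact: (inv_inj cK).
    by move=> P; rewrite mc cS.
  by rewrite big_map; apply: eq_bigr => P _; rewrite cE.
exists Df; split; last exact: DfE.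
by move: dD; rewrite -DD degD dE; move: (deg Df) => i; clear; lia.
Qed.

Lemma divisor_exists f : f != 0 -> has_divisor f.
Proof.
move=> f0; have [A [B [E [E0 e]]]] := affine_gen f.
have E0' : pev phi x E != 0 by rewrite (pev_eq0 affine_model).
rewrite -(mulfK E0' f) e; apply: has_divisorM; rewrite ?invr_eq0 -?e ?mulf_neq0 //.
  by rewrite e; apply: has_divisor_aff; rewrite -e mulf_neq0.
exact: has_divisorV (has_divisor_pev E0).
Qed.

(** ** Logarithmic differentials *)
Section Derivation.
Variable D : K -> K.
Hypothesis derD : derivation D.
Hypothesis Dpev : forall A, D (pev phi x A) = pev phi x A^`().
Hypothesis Dy : D y = pev phi x affine_poly^`() / (2%:R * y).

Let Dc c : D (phi c) = 0.
Proof. by rewrite -(pevC phi x) Dpev derivC rmorph0. Qed.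

Lemma log_der_affine P f : integral P x -> f != 0 ->
  integral P (y * (D f / f)) <-> (P f)%:~R = 0 :> k.
Proof. exact: (log_vfield_integral affine_model two_neq0 affine_gen derD Dpev Dy). Qed.

(** With X = 1/x and Y = y / x^(g+1), the vector field Y d/dX is
   - y x^(1-g) d/dx. *)
Lemma log_der_infinity P f : integral P X -> f != 0 ->
  integral P (Y * (x ^+ 2 * (D f / f))) <-> (P f)%:~R = 0 :> k.
Proof.
move=> Xi f0; pose D' z := - x ^+ 2 * D z; have x0 := x_neq0.
have derD' : derivation D'.
  by split=> u v; rewrite /D' ?(der_add derD) ?(der_mul derD); ring.
have D'c c : D' (phi c) = 0 by rewrite /D' Dc mulr0.
have Dx : D x = 1 by rewrite -{1}(pevX phi x) Dpev derivX rmorph1.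
have D'X : D' X = 1.
  by rewrite /D' (der_inv derD) // Dx; field.
have D'pev A : D' (pev phi X A) = pev phi X A^`().
  by rewrite (der_pev _ _ derD' D'c) D'X mulr1.
have Y0 := model_y_neq0 infinity_model.
have K2 : 2%:R != 0 :> K by rewrite -(rmorph_nat phi) fmorph_eq0.
have D'Y : D' Y = pev phi X infinity_poly^`() / (2%:R * Y).
  rewrite -D'pev -(model_eq infinity_model) (der_expn derD') expr1.
  by apply/esym; rewrite mulrC mulKf // mulf_neq0.
rewrite -(log_vfield_integral infinity_model two_neq0 infinity_gen derD' D'pev D'Y Xi f0).
have -> : Y * (D' f / f) = - (Y * (x ^+ 2 * (D f / f))) by rewrite /D'; ring.
by rewrite integralN.
Qed.

End Derivation.

End Curve.

(** * Constants of the derivation *)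

Section PthPowers.
Variables (p : nat) (k : closedFieldType).
Hypothesis charp : p \in [pchar k].
Let p_prime : prime p := pcharf_prime charp.

Lemma pth_root_exists (c : k) : exists d : k, d ^+ p = c.
Proof.
have p0 := prime_gt0 p_prime.
have /closed_rootP[d] : size ('X^p - c%:P : {poly k}) != 1%N.
  rewrite size_polyDl ?size_polyXn ?eqSS -?lt0n // size_polyN size_polyC ltnS.
  by apply: leq_trans p0; case: (c != 0).
by rewrite rootE !hornerE subr_eq0 => /eqP; exists d.
Qed.

Lemma frobenius_sum (R : comNzRingType) (chR : p \in [pchar R]) I (r : seq I) (f : I -> R) :
  (\sum_(i <- r) f i) ^+ p = \sum_(i <- r) f i ^+ p.
Proof. by rewrite -(pFrobenius_autE chR) rmorph_sum. Qed.

Lemma pchar_poly_mem : p \in [pchar {poly k}].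
Proof. exact: (rmorph_pchar polyC). Qed.

Lemma deriv0_pth_power (A : {poly k}) : A^`() = 0 -> exists Q, A = Q ^+ p.
Proof.
move=> A'; have [r rE] := choice pth_root_exists.
exists (\sum_(i < size A) (r A`_(p * i))%:P * 'X^i).
rewrite (frobenius_sum pchar_poly_mem); apply/polyP => m; rewrite coef_sum.
under eq_bigr do rewrite exprMn -rmorphXn /= rE -exprM coefCM coefXn.
have [/dvdnP[j ->]|nd] := boolP (p %| m)%N.
  have [js|js] := ltnP j (size A).
    rewrite (bigD1 (Ordinal js)) //= eqxx mulr1 big1 => [|i ij].
      by rewrite addr0 mulnC.
    rewrite eqn_pmul2r ?prime_gt0 // eq_sym.
    by move: ij; rewrite -val_eqE /= => /negPf->; rewrite mulr0.
  rewrite nth_default; last by rewrite (leq_trans js) // leq_pmulr ?prime_gt0.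
  rewrite big1 // => i _; rewrite eqn_pmul2r ?prime_gt0 // gtn_eqF ?mulr0 //.
  exact: leq_trans js.
rewrite big1 => [|i _]; last first.
  by case: eqP => [e|_]; [rewrite e dvdn_mull in nd|rewrite mulr0].
case: m nd => [|m nd]; first by rewrite dvdn0.
have := congr1 (fun q : {poly k} => q`_m) A'; rewrite coef_deriv coef0 => /eqP.
by rewrite -mulr_natr mulf_eq0 -(dvdn_pcharf charp) (negPf nd) orbF => /eqP.
Qed.

End PthPowers.

Section Constants.
Variables (p : nat) (k : closedFieldType) (K : fieldType) (phi : {rmorphism k -> K}).
Variables (F : {poly k}) (x y : K) (D : K -> K).
Hypotheses (charp : p \in [pchar k]) (p_odd : odd p).
Hypothesis M : model phi F x y.
Hypothesis gen : forall z, exists A B C, fracrep phi x y z A B C.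
Hypothesis derD : derivation D.
Hypothesis Dpev : forall A, D (pev phi x A) = pev phi x A^`().
Hypothesis Dy : D y = pev phi x F^`() / (2%:R * y).

Let p_prime : prime p := pcharf_prime charp.
Let charK : p \in [pchar K]. Proof. by rewrite (fmorph_pchar phi). Qed.
Let two_neq0 : 2%:R != 0 :> K.
Proof.
rewrite -(dvdn_pcharf charK); apply: contraL p_odd => /(dvdn_leq (isT : 0 < 2)%N).
by have := prime_gt1 p_prime; case: p => [|[|[|]]].
Qed.

Let Dc c : D (phi c) = 0.
Proof. by rewrite -(pevC phi x) Dpev derivC rmorph0. Qed.

Let DpM f h : iter p D (f * h) = iter p D f * h + f * iter p D h.
Proof.
have tw g : iter p (twist D 0) g = iter p D g.
  by apply: eq_iter => z; rewrite /twist mul0r addr0.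
by have := twist_leibniz_p phi charp derD 0 0 f h; rewrite addr0 !tw.
Qed.

Lemma iter_der_pev m A : iter m D (pev phi x A) = pev phi x A^`(m).
Proof. by elim: m => [|m IH]; rewrite ?derivn0 // derivnS /= IH Dpev. Qed.

(** By the Leibniz rule in characteristic p, D^p is a derivation; it kills k(x) and y. *)
Lemma iter_p_der0 z : iter p D z = 0.
Proof.
have Dp A : iter p D (pev phi x A) = 0.
  rewrite iter_der_pev nderivn_def -mulr_natr.
  have /dvdnP[c ->] : (p %| p`!)%N by rewrite dvdn_fact // prime_gt0 /=.
  by rewrite natrM (pcharf0 (pchar_poly_mem charp)) !mulr0 rmorph0.
have y0 := model_y_neq0 M.
have Dpy : iter p D y = 0.
  have := Dp F; rewrite -(model_eq M) expr2 DpM mulrC -mulr2n => /eqP.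
  by rewrite -mulr_natl mulf_eq0 (negPf two_neq0) mulf_eq0 (negPf y0) => /eqP.
have [A [B [C [C0 e]]]] := gen z.
have C0' : pev phi x C != 0 by rewrite (pev_eq0 M).
have := DpM z (pev phi x C); rewrite e Dp mulr0 addr0.
have -> : iter p D (aff phi x y A B) = 0.
  rewrite /aff; have DpD u v : iter p D (u + v) = iter p D u + iter p D v.
    by elim: (p) => //= m ->; rewrite (der_add derD).
  by rewrite DpD DpM Dpy !Dp mul0r mulr0 !addr0.
by move=> /esym/eqP; rewrite mulf_eq0 (negPf C0') orbF => /eqP.
Qed.

(** A polynomial with derivative 0 is a p-th power because k is perfect. The part
   B(x) y is reduced to polynomials by y = F(x)^((p+1)/2) / y^p. *)
Lemma der0_pth_power f : D f = 0 -> exists h, f = h ^+ p.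
Proof.
move=> Df; have [A [B [C [C0 e]]]] := gen f.
have C0' : pev phi x C != 0 by rewrite (pev_eq0 M).
have y0 := model_y_neq0 M.
pose A1 := A * C ^+ p.-1; pose B1 := B * C ^+ p.-1.
have e1 : f * pev phi x C ^+ p = aff phi x y A1 B1.
  rewrite -{1}(prednK (prime_gt0 p_prime)) exprS mulrA e /A1 /B1 /aff.
  by rewrite !rmorphM rmorphXn /=; ring.
have D1 : D (aff phi x y A1 B1) = 0.
  by rewrite -e1 (der_mul derD) Df mul0r (der_expn derD) (pcharf0 charK) !mul0r mulr0 addr0.
have [A1' B1'] : A1^`() = 0 /\ 2%:R * F * B1^`() + B1 * F^`() = 0.
  have : aff phi x y (2%:R * F * A1^`()) (2%:R * F * B1^`() + B1 * F^`()) = 0.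
    transitivity (2%:R * y ^+ 2 * D (aff phi x y A1 B1)); last by rewrite D1 mulr0.
    rewrite /aff (der_add derD) (der_mul derD) !Dpev Dy.
    rewrite rmorphD !rmorphM rmorph_nat /= -(model_eq M).
    by field; rewrite two_neq0 y0.
  move=> /(aff_eq0 M)[/eqP a0 ->]; split=> //; move: a0.
  have F0 : F != 0.
    apply: contraNneq y0 => F0; have := model_eq M.
    by rewrite F0 rmorph0 => /eqP; rewrite sqrf_eq0.
  rewrite mulf_eq0 mulf_eq0 (negPf F0) orbF => /orP[/eqP t|/eqP //].
  have /eqP := congr1 (pev phi x) t.
  by rewrite rmorph_nat rmorph0 (negPf two_neq0).
have [Q QE] := deriv0_pth_power charp A1'.
pose r := p./2; have pE : p = r.*2.+1 by rewrite -[LHS]odd_double_half p_odd.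
have p2 : p%:R = 0 :> {poly k} := pcharf0 (pchar_poly_mem charp).
have B2' : (B1 * F ^+ r.+1)^`() = 0.
  have [t tE] : exists t : {poly k}, t * 2%:R = 1.
    exists (2%:R^-1)%:P; rewrite -polyC_natr -rmorphM /= mulVf //.
    by rewrite -(fmorph_eq0 phi) rmorph_nat.
  have r2 : r.+1%:R * 2%:R = 1 :> {poly k}.
    by rewrite -natrM muln2 doubleS -pE -natr1 p2 add0r.
  rewrite derivM deriv_exp -mulr_natr exprS.
  have -> : B1^`() * (F * F ^+ r) + B1 * (F^`() * F ^+ r * r.+1%:R) =
    (2%:R * F * B1^`() + B1 * F^`()) * F ^+ r * r.+1%:R
    - F * F ^+ r * B1^`() * (r.+1%:R * 2%:R - 1) by ring.
  by rewrite B1' r2 subrr mulr0 !mul0r subr0.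
have [G GE] := deriv0_pth_power charp B2'.
exists ((pev phi x Q + pev phi x G / y) / pev phi x C).
have addp (u v : K) : (u + v) ^+ p = u ^+ p + v ^+ p.
  by rewrite -!(pFrobenius_autE charK) rmorphD.
have Cp0 : pev phi x C ^+ p != 0 by rewrite expf_neq0.
apply: (mulIf Cp0); rewrite e1 -exprMn divfK // addp expr_div_n -!rmorphXn /=.
rewrite -QE -GE /aff; congr (_ + _).
rewrite [pev phi x (B1 * _)]rmorphM /= [pev phi x (F ^+ _)]rmorphXn /= -(model_eq M).
rewrite -exprM mul2n doubleS -pE exprS; field.
by rewrite expf_neq0.
Qed.

End Constants.

(** * The Cartier equation in coordinates *)

Section CartierManin.
Variables (p n h : nat) (k : closedFieldType).
Hypotheses (charp : p \in [pchar k]) (p_odd : odd p) (n0 : (0 < n)%N).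
Hypothesis cnp : coprime n p.
Hypothesis h_order : is_order_mod n p h.

Let p_prime : prime p := pcharf_prime charp.
Local Notation r := ((p - 1) %/ 2)%N.
Local Notation g := (n.-1)./2.
Local Notation G := (half_orbit p n h).

Let pE : p = (2 * r + 1)%N.
Proof. exact: odd_halfE. Qed.

(** Indexed so that coef1 A i belongs to the differential x^(i-1) dx / y; there is none
   for i = 0. *)
Definition coef1 (A : {poly k}) i : k := if i is j.+1 then A`_j else 0.

(** The equation of logarithmic differentials for u = A(x) / y, multiplied by y^p:
   A(x) dx / y is fixed by the Cartier operator. *)
Definition cartier_fixed (A : {poly k}) : Prop :=
  (size A <= g)%N /\ A ^+ p + (A * ('X^n + 1) ^+ r)^`(p.-1) = 0.

Lemma coef_exp_p (A : {poly k}) m :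
  (A ^+ p)`_m = if (p %| m)%N then A`_(m %/ p) ^+ p else 0.
Proof.
rewrite -{1}[A]coefK poly_def (frobenius_sum (pchar_poly_mem charp)) coef_sum.
under eq_bigr do rewrite -mul_polyC exprMn -rmorphXn /= -exprM coefCM coefXn.
case: ifP => [/dvdnP[j ->]|nd]; last first.
  rewrite big1 // => i _; case: eqP => [e|_]; last by rewrite mulr0.
  by rewrite e dvdn_mull in nd.
have p0 := prime_gt0 p_prime; rewrite mulnK //.
have [js|js] := ltnP j (size A); last first.
  rewrite [in RHS]nth_default // expr0n eqn0Ngt p0 big1 // => i _.
  by rewrite eqn_pmul2r // gtn_eqF ?mulr0 // (leq_trans (ltn_ord i)).
rewrite (bigD1 (Ordinal js)) //= eqxx mulr1 big1 ?addr0 // => i ij.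
rewrite eqn_pmul2r // eq_sym.
by move: ij; rewrite -val_eqE /= => /negPf->; rewrite mulr0.
Qed.

(** Wilson's theorem when p divides m; otherwise one of the p - 1 consecutive factors
   is a multiple of p. *)
Lemma ffact_pred_char m :
  ((p.-1 + m) ^_ p.-1)%:R = (if (p %| m)%N then - 1 else 0 : k).
Proof.
have p0 := prime_gt0 p_prime; rewrite ffact_prod.
case: ifPn => [/dvdnP[j ->]|nd].
  have <- : (p.-1)`!%:R = - 1 :> k.
    have := Wilson (prime_gt1 p_prime); rewrite p_prime (dvdn_pcharf charp) -natr1.
    by rewrite addr_eq0 => /esym/eqP.
  rewrite -ffactnn ffact_prod !natr_prod; apply: eq_bigr => i _.
  rewrite addnC -addnBA; last exact: ltnW.
  by rewrite natrD natrM (pcharf0 charp) mulr0 add0r.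
have m0 : (0 < m)%N by case: m nd; rewrite ?dvdn0.
have ip : ((p.-1 + m) %% p < p.-1)%N.
  rewrite ltn_neqAle -ltnS prednK // ltn_mod p0 andbT; apply: contra nd => /eqP e.
  have := divn_eq (p.-1 + m) p; rewrite e addnC => /addIn ->.
  by rewrite dvdn_mull.
apply/eqP; rewrite -(dvdn_pcharf charp) (bigD1 (Ordinal ip)) //= dvdn_mulr //.
by rewrite {1}(divn_eq (p.-1 + m) p) addnK dvdn_mull.
Qed.

(** Since A has degree less than n, at most one term of the binomial expansion
   contributes to a given coefficient. *)
Lemma coef_affine_pow (A : {poly k}) J : (size A <= g)%N -> (0 < J)%N ->
  (A * ('X^n + 1) ^+ r)`_(p * J).-1 = 'C(r, (p * J) %/ n)%:R * coef1 A ((p * J) %% n).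
Proof.
move=> sA J0; have pJ0 : (0 < p * J)%N by rewrite muln_gt0 prime_gt0.
move: (p * J)%N pJ0 => N N0.
have gn : (g < n)%N by have := odd_double_half n.-1; lia.
rewrite addrC exprDn big_distrr coef_sum /=.
under eq_bigr => l _ do rewrite expr1n mul1r -exprM mulrnAr coefMn coefMXn -mulr_natl.
have small l : (l != N %/ n)%N -> (if (N.-1 < n * l)%N then 0 else A`_(N.-1 - n * l)) = 0.
  move=> ln; case: ltnP => // nl; rewrite nth_default //.
  apply: (leq_trans sA); rewrite leqNgt; apply: contra ln => lt; apply/eqP.
  have : N = (l * n + (N - n * l))%N by rewrite mulnC; lia.
  move=> ->; rewrite divnMDl // divn_small ?addn0 //; lia.
have main l : l = (N %/ n)%N ->
    (if (N.-1 < n * l)%N then 0 else A`_(N.-1 - n * l)) = coef1 A (N %% n).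
  move=> ->; have := divn_eq N n; rewrite mulnC; set q := (n * _)%N => e.
  case: (N %% n)%N e => [|m] e; first by rewrite e addn0 prednK ?leqnn //; lia.
  by rewrite e addnS /= ltnNge leq_addr /= addKn.
have [lr|lr] := ltnP (N %/ n) r.+1.
  rewrite (bigD1 (Ordinal lr)) //= main // big1 ?addr0 // => l ln.
  by rewrite small ?mulr0.
rewrite bin_small // mul0r big1 // => l _; rewrite small ?mulr0 //.
by rewrite neq_ltn (leq_trans (ltn_ord l)).
Qed.

Lemma cartier_fixedE (A : {poly k}) : (size A <= g)%N ->
  cartier_fixed A <->
  (forall J, (0 < J <= g)%N ->
     coef1 A J ^+ p = 'C(r, (p * J) %/ n)%:R * coef1 A ((p * J) %% n)).
Proof.
move=> sA; have p0 := prime_gt0 p_prime.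
have cE j : (A ^+ p + (A * ('X^n + 1) ^+ r)^`(p.-1))`_(p * j) =
    coef1 A j.+1 ^+ p - 'C(r, (p * j.+1) %/ n)%:R * coef1 A ((p * j.+1) %% n).
  rewrite coefD coef_exp_p dvdn_mulr // mulKn // coef_derivn -[X in _ + X]mulr_natr.
  rewrite ffact_pred_char dvdn_mulr // mulrN1; congr (_ - _).
  by rewrite -coef_affine_pow // mulnS; congr (_ `_ _); lia.
split=> [[_ e] [|j] // _|H].
  by have := cE j; rewrite e coef0 => /esym/eqP; rewrite subr_eq0 => /eqP.
split=> //; apply/polyP => m; rewrite coef0.
have [/dvdnP[j ->]|nd] := boolP (p %| m)%N; last first.
  rewrite coefD coef_exp_p coef_derivn -[X in _ + X]mulr_natr ffact_pred_char.
  by rewrite (negPf nd) mulr0 addr0.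
rewrite mulnC cE; have [jg|jg] := ltnP j g; first by rewrite H ?subrr.
rewrite /= nth_default ?(leq_trans sA) // expr0n eqn0Ngt p0 sub0r; apply/eqP.
rewrite oppr_eq0; apply/eqP.
have [lr|lr] := ltnP r ((p * j.+1) %/ n); first by rewrite bin_small ?mul0r.
case E : ((p * j.+1) %% n)%N => [|i]; rewrite ?mulr0 //=.
rewrite nth_default ?mulr0 // (leq_trans sA) //.
have := divn_eq (p * j.+1) n; rewrite E.
have nE : (n <= 2 * g.+1)%N by have := odd_double_half n.-1; lia.
(* for J = j + 1 > g, p J exceeds r n + g, the degree of the product plus one *)
move=> eN; rewrite leqNgt; apply/negP => ig.
have l1 : ((p * j.+1) %/ n * n <= r * (2 * g.+1))%N by apply: leq_mul.
have l2 : (p * g.+1 <= p * j.+1)%N by rewrite leq_mul2l ltnS jg orbT.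
have l3 : (p * g.+1 = r * (2 * g.+1) + g.+1)%N.
  by rewrite {1}pE mulnDl mul1n mulnAC mulnC.
move: l2; rewrite l3 eN => l2; have := leq_trans l2 (leq_add l1 (leqnn i.+1)).
by rewrite leq_add2l ltnS leqNgt ig.
Qed.

Let half_mod (i : 'I_n) : i \in G ->
  forall m, (0 < (p ^ m * i) %% n)%N /\ (2 * ((p ^ m * i) %% n) < n)%N.
Proof.
have [h0 _ _] := h_order.
apply: (half_orbit_mod (prime_gt1 p_prime) p_odd n0 h0).
exact: alpha_mul (prime_gt0 p_prime) h_order.
Qed.

Let gE m : (m <= g)%N = (2 * m < n)%N.
Proof. by have e := odd_double_half n.-1; apply/idP/idP; lia. Qed.

Definition mulp (i : 'I_n) : 'I_n := Ordinal (ltn_pmod (p * i) n0).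

Lemma mulp_orbit i : i \in G -> mulp i \in G.
Proof.
move=> /half_mod H; rewrite inE; have [i0 _] := H 1%N.
move: i0; rewrite expn1 /= => ->; apply/forallP => m.
by have [_] := H m.+1; rewrite modnMmr mulnA -expnSr.
Qed.

Lemma orbit_mulp (i : 'I_n) : (0 < i)%N -> (2 * i < n)%N -> mulp i \in G -> i \in G.
Proof.
move=> i0 i2 /half_mod H; rewrite inE i0; apply/forallP => -[[|m] mh] /=.
  by rewrite mul1n modn_small.
have [_] := H m; rewrite /= modnMmr mulnA -expnSr; exact.
Qed.

Lemma mulp_inj : injective mulp.
Proof.
move=> i j [e]; apply/val_inj.
have c : coprime p n by rewrite coprime_sym.
exact: (@eqn_mod_lin n 0 p i j n0 c (ltn_ord i) (ltn_ord j) e).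
Qed.

Definition hasse_coef (i : 'I_n) : k := 'C(r, (p * i) %/ n)%:R.

Lemma hasse_coef_neq0 (i : 'I_n) : (2 * i < n)%N -> hasse_coef i != 0.
Proof.
move=> i2; have l : ((p * i) %/ n <= r)%N.
  by apply: div_lt_half => //; apply: ltnW.
rewrite /hasse_coef -(dvdn_pcharf charp); apply/negP => d.
have : (p %| r`!)%N by rewrite -(bin_fact l) dvdn_mulr.
have : (r < p)%N by rewrite {2}pE; lia.
elim: (r) => [|m IH] mp; first by rewrite fact0 dvdn1 => /eqP e; move: p_prime; rewrite e.
rewrite factS Euclid_dvdM // gtnNdvd //=; apply: IH; exact: ltnW.
Qed.

Definition ext (a : {ffun 'I_n -> k}) i : k := if insub i is Some j then a j else 0.

Lemma ext_ord a (i : 'I_n) : ext a i = a i.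
Proof. by rewrite /ext valK. Qed.

Definition numerator (a : {ffun 'I_n -> k}) : {poly k} := \poly_(j < g) ext a j.+1.

Lemma coef1_numerator (a : {ffun 'I_n -> k}) : (forall i, i \notin G -> a i = 0) ->
  forall i, coef1 (numerator a) i = ext a i.
Proof.
move=> a0 [|i] /=.
  rewrite -[0%N]/(val (Ordinal n0)) ext_ord a0 // inE //.
rewrite coef_poly; case: ltnP => // ig; rewrite /ext; case: insubP => // j _ je.
rewrite a0 //; apply/negP => /half_mod/(_ 0%N)[_].
by rewrite mul1n modn_small // je -gE leqNgt ltnS ig.
Qed.

(** The Hasse-Witt matrix of the curve is monomial. Up to nonzero factors it permutes
   the indices whose orbits stay in [1, g], and it is nilpotent on the others. *)
Lemma cartier_fixed_enum : exists l : seq {poly k},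
  [/\ uniq l, size l = (p ^ #|G|)%N & forall A, A \in l <-> cartier_fixed A].
Proof.
have G2 (i : 'I_n) : i \in G -> (0 < i <= g)%N.
  by move=> /half_mod/(_ 0%N); rewrite mul1n modn_small // gE => -[-> ->].
have [|||i /G2/andP[_]|l [lU ls lE]] := @frobenius_system p k charp _ G mulp (fun=> 1%N) hasse_coef.
- by move=> i; apply: mulp_orbit.
- by move=> i j _ _; apply: mulp_inj.
- by [].
- by rewrite gE; apply: hasse_coef_neq0.
exists [seq numerator a | a <- l]; split.
- rewrite map_inj_in_uniq // => a b /lE[a0 _] /lE[b0 _] e; apply/ffunP => i.
  by rewrite -!ext_ord -!coef1_numerator // e.
- by rewrite size_map ls sum1_card.
move=> A; split=> [/mapP[a /lE[a0 aE] ->]|fA].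
  have sA : (size (numerator a) <= g)%N by apply: size_poly.
  apply/(cartier_fixedE sA) => J /andP[J0 Jg].
  have J2 : (2 * J < n)%N by rewrite -gE.
  have Jn : (J < n)%N by lia.
  rewrite !coef1_numerator // -[J]/(val (Ordinal Jn)) -[((p * _) %% n)%N]/(val (mulp (Ordinal Jn))).
  rewrite !ext_ord; have [JG|JG] := boolP (Ordinal Jn \in G).
    by rewrite -(aE _ JG) expn1.
  rewrite a0 // expr0n eqn0Ngt prime_gt0 // a0 ?mulr0 //.
  by apply: contra JG; apply: orbit_mulp.
have [sA _] := fA; have /(cartier_fixedE sA) H := fA.
have high i : (g < i)%N -> coef1 A i = 0.
  by case: i => // i ig /=; rewrite nth_default // (leq_trans sA).
have chain m i : (i < n)%N -> coef1 A ((p ^ m * i) %% n) = 0 -> coef1 A i = 0.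
  elim: m i => [|m IH] i ltin; first by rewrite mul1n modn_small.
  have [i0|i0] := posnP i; first by rewrite i0.
  have [ig|ig] := leqP i g; last by rewrite (high i).
  rewrite expnSr -mulnA -modnMmr => /IH; rewrite ltn_pmod // => /(_ isT) e.
  have /eqP : coef1 A i ^+ p = 0 by rewrite H ?i0 // e mulr0.
  by rewrite expf_eq0 => /andP[_ /eqP].
have out (i : 'I_n) : i \notin G -> coef1 A i = 0.
  have [i0|i0] := posnP i; first by rewrite i0.
  rewrite inE i0 /= => /forallPn[m]; rewrite -gE -ltnNge => /high.
  exact: chain.
pose a : {ffun 'I_n -> k} := [ffun i : 'I_n => coef1 A i].
have al : a \in l.
  apply/lE; split=> [i iG|i iG]; first by rewrite ffunE out.
  by rewrite !ffunE expn1 H ?G2.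
apply/mapP; exists a => //; apply/polyP => j; rewrite coef_poly.
case: ltnP => jg; last by rewrite nth_default // (leq_trans sA).
have jn : (j.+1 < n)%N by move: jg; rewrite gE; lia.
by rewrite -[j.+1]/(val (Ordinal jn)) ext_ord ffunE.
Qed.

End CartierManin.

(** * The p-torsion of the Jacobian *)

Section DivisorClass.
Local Open Scope quotient_scope.
Variables (k K : fieldType) (phi : {rmorphism k -> K}).

Definition divisor_class (E : divisor0 phi) : jacobian phi :=
  \pi_(Quotient.quot (@principal k K phi)) E.

Lemma divisor_class_surj c : exists E, divisor_class E = c.
Proof. by exists (repr c); apply: reprK. Qed.

Lemma divisor_classB : zmod_morphism divisor_class.
Proof. by move=> E E'; apply: raddfB. Qed.

Lemma divisor_class_eq0 E : divisor_class E = 0 <-> E \in @principal k K phi.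
Proof.
rewrite -[E in E \in _]subr0 Quotient.idealrBE; split=> [e|/eqP e].
  by apply/eqP; rewrite -/(divisor_class E) e /divisor_class raddf0.
by rewrite /divisor_class e raddf0.
Qed.

Lemma divisor_classM E m : divisor_class (E *+ m) = divisor_class E *+ m.
Proof. by rewrite /divisor_class raddfMn. Qed.

Lemma div0_valMn (E : divisor0 phi) m : div0_val (E *+ m) = div0_val E *+ m.
Proof. exact: (raddfMn (val : divisor0 phi -> {freeg (place phi)})). Qed.

End DivisorClass.

Section PTorsion.
Variables (p n h : nat) (k : closedFieldType) (K : fieldType).
Variables (phi : {rmorphism k -> K}) (x y : K).
Hypotheses (charp : p \in [pchar k]) (p_odd : odd p) (n0 : (0 < n)%N).
Hypotheses (cnp : coprime n p) (h_order : is_order_mod n p h).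
Hypothesis C : function_field_C phi n x y.

Let p_prime : prime p := pcharf_prime charp.
Let charK : p \in [pchar K]. Proof. by rewrite (fmorph_pchar phi). Qed.

Let two_neq0 : 2%:R != 0 :> k.
Proof.
rewrite -(dvdn_pcharf charp); apply: contraL p_odd => /(dvdn_leq (isT : 0 < 2)%N).
by have := prime_gt1 p_prime; case: p => [|[|[|]]].
Qed.

Let n_neq0 : n%:R != 0 :> k.
Proof. by rewrite -(dvdn_pcharf charp) -prime_coprime // coprime_sym. Qed.

Let M := affine_model n0 n_neq0 C.
Let gen := affine_gen n0 n_neq0 C.
Let x0 := x_neq0 C.
Let y0 := model_y_neq0 M.
Local Notation F := (affine_poly k n).
Local Notation g := (genus n).
Local Notation r := ((p - 1) %/ 2)%N.

Section Derivation.
Variable D : K -> K.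
Hypothesis derD : derivation D.
Hypothesis Dpev : forall A, D (pev phi x A) = pev phi x A^`().
Hypothesis Dy : D y = pev phi x F^`() / (2%:R * y).

Let Dc c : D (phi c) = 0.
Proof. by rewrite -(pevC phi x) Dpev derivC rmorph0. Qed.

Lemma ord_pchar (P : place phi) f : (P f)%:~R = 0 :> k <-> exists i, P f = i * p%:Z.
Proof.
split=> [e|[i ->]]; last by rewrite rmorphM /= -pmulrn (pcharf0 charp) mulr0.
have : (p %| `|P f|)%N.
  rewrite (dvdn_pcharf charp); apply/eqP.
  by case: (P f) e => m; rewrite /= ?NegzE ?mulrNz -?pmulrn // => /eqP; rewrite oppr_eq0 => /eqP.
case/dvdnP=> m mE; exists (Num.sg (P f) * m%:Z).
by rewrite -mulrA -PoszM -mE abszE; apply: numEsg.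
Qed.

(** The residues ord f of df / f vanish in k, so that df / f has no poles. The
   factor of dx / y is then regular on the affine curve, and the model at infinity
   bounds its poles there: it is a polynomial A(x) with deg A < g. *)
Lemma log_der_regular f : f != 0 -> (forall P : place phi, (P f)%:~R = 0 :> k) ->
  exists2 A : {poly k}, (size A <= g)%N & D f / f = pev phi x A / y.
Proof.
move=> f0 H; have [Df0|Df0] := eqVneq (D f) 0.
  by exists 0; rewrite ?size_poly0 // Df0 rmorph0 !mul0r.
pose w := y * (D f / f).
have w0 : w != 0 by rewrite !mulf_neq0 ?invr_eq0.
have gn := genusE n0.
have [||P Px|A sA wE] := @bounded_pole k K phi n x y n0 two_neq0 n_neq0 C w g _ w0.
- by move: gn; case: (odd n); lia.
- by move=> P xi; apply/(log_der_affine n0 two_neq0 n_neq0 C derD Dpev Dy xi f0).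
- have Xi : integral P x^-1 by rewrite /integral placeV // oppr_ge0 ltW.
  have := (log_der_infinity n0 two_neq0 n_neq0 C derD Dpev Xi f0).2 (H P).
  have -> : y / x ^+ g.+1 * (x ^+ 2 * (D f / f)) = w * x ^+ 2 / x ^+ g.+1.
    by rewrite /w; ring.
  rewrite /integral ordM ?mulf_neq0 ?invr_eq0 ?expf_neq0 // ordM ?expf_neq0 //.
  rewrite placeV ?expf_neq0 // !ordX //.
  by move: (P w) (P x) => i j; rewrite intS; nia.
exists A => //; rewrite -wE /w; field.
by rewrite f0 y0.
Qed.

Lemma regular_log_der f (A : {poly k}) : f != 0 -> (size A <= g)%N ->
  D f / f = pev phi x A / y -> forall P : place phi, (P f)%:~R = 0 :> k.
Proof.
move=> f0 sA e P; have [xi|Xi] := place_cover C P.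
  apply/(log_der_affine n0 two_neq0 n_neq0 C derD Dpev Dy xi f0).
  by rewrite e mulrCA mulfV // mulr1 integral_pev.
have [xi|Px] := leP 0 (P x).
  apply/(log_der_affine n0 two_neq0 n_neq0 C derD Dpev Dy xi f0).
  by rewrite e mulrCA mulfV // mulr1 integral_pev.
apply/(log_der_infinity n0 two_neq0 n_neq0 C derD Dpev Xi f0).
rewrite e; have [->|A0] := eqVneq A 0.
  by rewrite rmorph0 !(mul0r, mulr0) /integral Defs.ord0.
have A0' : pev phi x A != 0 by rewrite (pev_eq0 M).
have -> : y / x ^+ g.+1 * (x ^+ 2 * (pev phi x A / y)) = pev phi x A * x ^+ 2 / x ^+ g.+1.
  by field; rewrite y0 expf_neq0.
rewrite /integral ordM ?mulf_neq0 ?invr_eq0 ?expf_neq0 // ordM ?expf_neq0 //.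
rewrite placeV ?expf_neq0 // !ordX // ord_pev_pole //.
have : (0 < size A)%N by rewrite size_poly_gt0.
by move: (P x) Px (size A) sA => i i0 m; rewrite intS; nia.
Qed.

(** y^p is constant and y^(p-1) = F(x)^r, so the equation of logarithmic
   differentials becomes one between polynomials. *)
Lemma cartier_fixed_diff (A : {poly k}) :
  (pev phi x A / y) ^+ p + iter p.-1 D (pev phi x A / y) = 0 <->
  A ^+ p + (A * F ^+ r)^`(p.-1) = 0.
Proof.
have pE := odd_halfE p_odd; have yp0 : y ^+ p != 0 by rewrite expf_neq0.
have Dyp : D (y ^+ p)^-1 = 0.
  by rewrite (der_inv derD) // (der_expn derD) (pcharf0 charK) !mul0r oppr0 mul0r.
have uE : pev phi x A / y = (y ^+ p)^-1 * pev phi x (A * F ^+ r).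
  have -> : y ^+ p = y ^+ (2 * r) * y by rewrite {1}pE addn1 exprSr.
  rewrite rmorphM rmorphXn /= -(model_eq M) -exprM.
  by move: (y ^+ _) (expf_neq0 (2 * r) y0) => t t0; field; rewrite t0 y0.
rewrite {2}uE (iter_der_const derD) // (iter_der_pev Dpev).
rewrite exprMn exprVn mulrC -rmorphXn.
rewrite -mulrDr -rmorphD /=; split=> [/eqP|->]; last by rewrite rmorph0 mulr0.
by rewrite mulf_eq0 invr_eq0 (negPf yp0) (pev_eq0 M) => /eqP.
Qed.

(** A relation, because E and f have to be chosen: class_log_derB and class_log_der0
   show that u depends on c alone. *)
Definition class_log_der (c : jacobian phi) (u : K) : Prop :=
  exists E f, [/\ divisor_class E = c, f != 0,
    is_div f (div0_val E *+ p) & D f / f = u].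

Lemma class_log_derB c u c' u' : class_log_der c u -> class_log_der c' u' ->
  class_log_der (c - c') (u - u').
Proof.
move=> [E [f [<- f0 fE <-]]] [E' [f' [<- f'0 f'E <-]]].
exists (E - E'), (f / f'); split.
- exact: divisor_classB.
- by rewrite mulf_neq0 ?invr_eq0.
- by move=> P; rewrite div0_valB mulrnBl coeffB fE f'E ordM ?invr_eq0 // placeV.
- by rewrite (der_div derD) //; field; rewrite f0 f'0.
Qed.

Lemma class_log_der_total c : c *+ p = 0 -> exists u, class_log_der c u.
Proof.
have [E <-] := divisor_class_surj c.
rewrite -divisor_classM => /divisor_class_eq0; rewrite inE => /asboolP[f f0 fE].
by exists (D f / f), E, f; split=> // P; rewrite -div0_valMn fE.
Qed.

(** If E is the divisor of q, then f / q^p has no zeros or poles and is constant. *)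
Lemma class_log_der0 u : class_log_der 0 u -> u = 0.
Proof.
move=> [E [f [/divisor_class_eq0 + f0 fE <-]]]; rewrite inE => /asboolP[q q0 qE].
have qp0 : q ^+ p != 0 by rewrite expf_neq0.
have [|P|c cE] := @ord_zero_const k K phi n x y n0 two_neq0 n_neq0 C (f / q ^+ p).
- by rewrite mulf_neq0 ?invr_eq0.
- rewrite ordM ?invr_eq0 // placeV // ordX // -fE -qE coeffMn.
  by rewrite -mulr_natl natz subrr.
have -> : f = phi c * q ^+ p by rewrite -cE divfK.
rewrite (der_mul derD) Dc (der_expn derD) (pcharf0 charK).
by rewrite !(mul0r, mulr0, addr0).
Qed.

(** If f has derivative 0 it is a p-th power q^p, and E is the divisor of q. *)
Lemma class_log_der_inj c : class_log_der c 0 -> c = 0.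
Proof.
move=> [E [f [<- f0 fE /eqP]]]; rewrite mulf_eq0 invr_eq0 (negPf f0) orbF => /eqP Df.
have [q qE] := der0_pth_power charp p_odd M gen derD Dpev Dy Df.
have q0 : q != 0.
  by apply: contraNneq f0 => q0; rewrite qE q0 expr0n eqn0Ngt prime_gt0.
apply/divisor_class_eq0; rewrite inE; apply/asboolP; exists q => // P.
have := fE P; rewrite qE ordX // coeffMn -mulr_natl natz.
by apply: mulfI; rewrite eqz_nat -lt0n prime_gt0.
Qed.

Lemma class_log_der_cartier c u : class_log_der c u ->
  exists2 A, cartier_fixed p n A & u = pev phi x A / y.
Proof.
move=> [E [f [_ f0 fE <-]]].
have H (P : place phi) : (P f)%:~R = 0 :> k.
  apply/ord_pchar; exists (coeff P (div0_val E)).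
  by rewrite -fE coeffMn -mulr_natr natz.
have [A sA e] := log_der_regular f0 H; exists A => //; split=> //.
apply/cartier_fixed_diff; rewrite -e; apply: (eq_of_log_der charp derD Dc f0).
  by rewrite divfK.
exact: (iter_p_der0 charp p_odd M gen derD Dpev).
Qed.

(** A solution of Cartier's equation is a logarithmic derivative df / f. As df / f is
   regular, p divides the divisor of f, and the quotient has degree 0 since
   principal divisors do. *)
Lemma cartier_class A : cartier_fixed p n A ->
  exists2 c, c *+ p = 0 & class_log_der c (pev phi x A / y).
Proof.
move=> [sA /cartier_fixed_diff/(log_der_of_eq charp derD Dc)[f f0 Df]].
have lf : D f / f = pev phi x A / y by rewrite Df mulfK.
have H := regular_log_der f0 sA lf.
have [Z [dZ ZE]] := divisor_exists n0 two_neq0 n_neq0 C f0.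
have [q qE] : exists q : place phi -> int, forall P : place phi, P f = q P * p%:Z.
  have H' (P : place phi) : exists i, P f = i * p%:Z by apply/ord_pchar.
  by have [q qE] := choice H'; exists q.
pose E := \sum_(P <- dom Z) << q P *g P >> : {freeg (place phi)}.
have EE : E *+ p = Z.
  apply/eqP/freeg_eqP => P; rewrite coeffMn coeff_sum_place ?uniq_dom //.
  have := ZE P; rewrite qE -mulr_natr natz; case: ifP => [_ ->//|].
  by rewrite mem_dom => /negbFE/eqP -> _; rewrite mul0r.
have E0 : E \in @Defs.deg0 k K phi.
  rewrite inE; have := degMn p E; rewrite EE dZ => /esym/eqP.
  by rewrite -mulr_natr mulf_eq0 natz eqz_nat (gtn_eqF (prime_gt0 p_prime)) orbF.
exists (divisor_class (Divisor0 E0)).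
  rewrite -divisor_classM; apply/divisor_class_eq0; rewrite inE; apply/asboolP.
  by exists f => // P; rewrite div0_valMn /= EE.
exists (Divisor0 E0), f; split=> // P.
by rewrite /= EE.
Qed.

End Derivation.

(** The map c |-> df / f is an isomorphism from J[p] onto the solutions of Cartier's
   equation, whose number is known. *)
Lemma p_rank_half_orbit : has_p_rank phi p #|half_orbit p n h|.
Proof.
have [D derD [Dpev Dy]] := derivation_exists M two_neq0 gen.
have tors (c : jac_torsion phi p) : (c : jacobian phi) *+ p = 0.
  by case: c => c /= ct; apply/eqP.
have H (c : jac_torsion phi p) :
    exists A, cartier_fixed p n A /\ class_log_der D c (pev phi x A / y).
  have [u cu] := class_log_der_total D (tors c).
  have [A fA uE] := class_log_der_cartier derD Dpev Dy cu.
  by exists A; split=> //; rewrite -uE.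
have [e eP] := choice H.
have eI : injective e.
  move=> c c' ec; apply/val_inj/eqP; rewrite -subr_eq0; apply/eqP.
  apply: (class_log_der_inj derD Dpev Dy).
  have := class_log_derB derD (eP c).2 (eP c').2.
  by rewrite ec subrr.
have [l [lU ls lE]] := cartier_fixed_enum charp p_odd n0 cnp h_order.
apply: (elementary_rV p_prime _ eI lU _ ls) => [c|A].
  by apply/val_inj; rewrite raddfMn /= tors.
rewrite lE; split=> [fA|[c <-]]; last by have [] := eP c.
have [c ct cA] := cartier_class derD Dpev Dy fA.
have ct' : c \in @torsion k K phi p by rewrite inE ct.
exists (JacTorsion ct'); have [_ cA'] := eP (JacTorsion ct').
have := class_log_derB derD cA' cA; rewrite subrr => /(class_log_der0 derD Dpev)/eqP.
rewrite subr_eq0 => /eqP/(mulIf (invr_neq0 y0)).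
exact: (pev_inj M).
Qed.

End PTorsion.

Theorem theorem5p4 (p n h s : nat)
  (p_prime : prime p) (p_odd : odd p)
  (n_gt0 : (0 < n)%N) (n_p_coprime : coprime n p)
  (h_order : is_order_mod n p h)
  (s_lt : (s < alpha p n h)%N)
  (s_mod : s = ((p - 1) %/ 2)%N %[mod alpha p n h])
  (k : closedFieldType) (iota : {rmorphism 'F_p -> k})
  (k_closure : is_algebraic_closure iota)
  (K : fieldType) (phi : {rmorphism k -> K}) (x y : K)
  (K_C : function_field_C phi n x y) :
  let a := alpha p n h in
  let delta_n := delta_ p n h s in
  (1 <= num_sol p n h s <= s.+1 ^ (h - 1))%N
  /\ (exists2 gamma : nat, has_p_rank phi p gamma &
        gamma%:R = n%:R / (p%:R ^+ h - 1)
                   * (((p%:R + 1) / 2%:R) ^+ h - delta_n%:~R) :> rat)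
  /\ ((a %| (p - 1) %/ 2)%N -> ~~ odd n /\ delta_n = a%:Z + 1)
  /\ ((a %| (p + 1) %/ 2)%N ->
        delta_n = if odd n then a%:Z else 2 * a%:Z)
  /\ ((a %| (p + 3) %/ 2)%N -> ~~ (p - 1 %| n)%N ->
        delta_n = if odd n then a%:Z + (-1) ^+ h else 2 * a%:Z + (-1) ^+ h)
  /\ ((a %| (p + 3) %/ 2)%N -> (p - 1 %| n)%N ->
        ~~ odd n /\ delta_n = 2 * a%:Z + (-1) ^+ h * (1 - a%:Z))
  /\ (odd n -> (a %| p - 1)%N ->
        odd h /\ delta_n%:~R = (a%:R + 2%:R) / 2%:R :> rat).
Proof.
have charp : p \in [pchar k].
  by rewrite (fmorph_pchar iota) pchar_Fp.
move=> a d; split; first exact: num_sol_bounds.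
split.
  exists #|half_orbit p n h|; first by
    exact: p_rank_half_orbit charp p_odd n_gt0 n_p_coprime h_order K_C.
  exact: half_orbit_formula.
split; first exact: delta_div_pred.
split; first exact: delta_div_succ.
split; first exact: delta_add3_ndvd.
split; first exact: delta_add3_dvd.
exact: delta_odd.
Qed.
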